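(* Each of the following decision problems many-one reduces to the next one: $$\mathsf{Halt}\preceq\mathsf{PCP}\preceq\mathsf{MM}\preceq\mathsf{FRACTRAN}\preceq\mathsf{DIO\_FORM}\preceq\mathsf{DIO\_ELEM}\preceq\mathsf{DIO\_SINGLE}\preceq\mathsf{H10}.$$ As a consequence, $\mathsf{H10}$ is undecidable: a decider for $\mathsf{H10}$ would yield a decider for $\mathsf{Halt}$.
   Context: A many-one reduction $P\preceq Q$ between predicates $P:X\to\mathrm{Prop}$ and $Q:Y\to\mathrm{Prop}$ is a function $f:X\to Y$, definable in constructive type theory (Coq) without axioms and hence computable, such that $P\,x\leftrightarrow Q(f\,x)$ for all $x$. $\mathsf{Halt}$: the halting problem for single-tape Turing machines. $\mathsf{PCP}$: the Post correspondence problem. Given a finite list of pairs of strings, is there a nonempty sequence of indices whose top concatenation equals its bottom concatenation? Minsky machines. An instruction over $n$ registers is $\mathrm{INC}\,\alpha$ or $\mathrm{DEC}\,\alpha\,p$ with $\alpha\in\{0,\dots,n-1\}$ and $p\in\mathbb N$. A machine is a pair $(s,[\iota_0;\dots;\iota_k])$, where $\iota_j$ sits at label $s+j$. A state is $(i,\vec v)$ with $i\in\mathbb N$ the program counter and $\vec v\in\mathbb N^n$. If $i$ labels an instruction, one step is as follows. - $\mathrm{INC}\,\alpha$ yields $(i+1,\vec v[\alpha\mapsto v_\alpha+1])$. - $\mathrm{DEC}\,\alpha\,p$ yields $(i+1,\vec v[\alpha\mapsto v_\alpha-1])$ if $v_\alpha>0$, and yields $(p,\vec v)$ if $v_\alpha=0$.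 No step is possible when $i<s$ or $i\ge s+k+1$. The machine terminates from a state if, after finitely many steps, it reaches a state whose program counter is outside the code. $\mathsf{MM}$: given $n$, a list $P$ of instructions over $n$ registers and $\vec v\in\mathbb N^n$, does $(1,P)$ terminate from $(1,\vec v)$? FRACTRAN. A program is a list of pairs $(p,q)\in\mathbb N\times\mathbb N$, written $p/q$. The step relation $Q:x\succ y$ is defined inductively. - $(p/q::Q'):x\succ y$ if $q\,y=p\,x$. - $(p/q::Q'):x\succ y$ if $q\nmid p\,x$ and $Q':x\succ y$. $Q$ terminates from $s$ if some $x$ is reachable from $s$ by finitely many steps with no $y$ satisfying $Q:x\succ y$. $\mathsf{FRACTRAN}$: given $Q$ and $s\in\mathbb N$, does $Q$ terminate from $s$? Diophantine logic. Formulas are $A,B::= x_i\doteq n\mid x_i\doteq x_j\mid x_i\doteq x_j\dot+x_k\mid x_i\doteq x_j\dot\times x_k\mid A\dot\wedge B\mid A\dot\vee B\mid\dot\exists A$, where $n\in\mathbb N$ and the variables are De Bruijn indices. For a valuation $\nu:\mathbb N\to\mathbb N$, the semantics $[\![A]\!]\nu$ is as follows. - Atomic formulas have their obvious meaning, e.g. $[\![x_i\doteq x_j\dot\times x_k]\!]\nu$ iff $\nu(i)=\nu(j)\nu(k)$. - $\dot\wedge$ and $\dot\vee$ are interpreted as $\wedge$ and $\vee$. - $[\![\dot\exists A]\!]\nu$ iff $\exists n,\,[\![A]\!](n\cdot\nu)$, where $(n\cdot\nu)(0)=n$ and $(n\cdot\nu)(i+1)=\nu(i)$. $\mathsf{DIO\_FORM}$: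 given a formula $A$ and a valuation $\nu$, does $[\![A]\!]\nu$ hold? Elementary constraints are $u\doteq n$, $u\doteq v$, $u\doteq x_i$, $u\doteq v\dot+w$ and $u\doteq v\dot\times w$, with $u,v,w\in\mathbb N$ (variables) and $x_i$ a parameter, $i\in\mathbb N$. Given $\varphi:\mathbb N\to\mathbb N$ (variables) and $\nu:\mathbb N\to\mathbb N$ (parameters), a constraint is satisfied if the corresponding equation holds, e.g. $u\doteq x_i$ holds iff $\varphi(u)=\nu(i)$. $\mathsf{DIO\_ELEM}$: given a list $l$ of constraints and $\nu$, is there $\varphi$ satisfying every constraint in $l$? Polynomials over variable type $U$ and parameter type $V$ are $p::=u\in U\mid x\in V\mid n\in\mathbb N\mid p\dot+p\mid p\dot\times p$, evaluated in $\mathbb N$ under $\varphi:U\to\mathbb N$ and $\nu:V\to\mathbb N$. $\mathsf{DIO\_SINGLE}$: given polynomials $p,q$ with $U=V=\mathbb N$ and $\nu$, is there $\varphi$ with equal values of $p$ and $q$? $\mathsf{H10}$: given $n$ and polynomials $p,q$ with variables in $\{0,\dots,n-1\}$ and no parameters, is there a solution in $\mathbb N^n$ of $p=q$? *)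

(* Defs.v *)
From mathcomp Require Import all_boot.
From Stdlib Require Import Relation_Operators.

Set Implicit Arguments.
Unset Strict Implicit.
Unset Printing Implicit Defensive.

(* A many-one reduction is a function definable in type theory without axioms,
   hence computable.  Definability without axioms is not a property that can be
   stated inside the logic, and an existential over all functions would become
   vacuous in the presence of classical choice principles.  Computability is
   therefore required explicitly, in the following Turing-complete model:
   programs over binary trees (S-expressions) with pairing, structural
   recursion and while loops.  As some problems have a valuation
   nat -> nat among their inputs, programs can query an oracle nat -> nat. *)

Inductive tree := leaf | node of tree & tree.

Fixpoint num (n : nat) : tree := if n is m.+1 then node leaf (num m) else leaf.

Inductive prog :=
  | pId
  | pLeaf
  | pFst
  | pSnd
  | pPair of prog & prog
  | pComp of prog & prog
  | pRec of prog & prog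
  | pWhile of prog
  | pAsk.

(* [eval o p x y]: with oracle [o], the program [p] halts on [x] with result
   [y].  [pRec p q] recurses on the second component of its input, the first
   one being a parameter.  [pWhile p] iterates [p] until the first component of
   the current value is [leaf], and then returns that value. *)
Inductive eval (o : nat -> nat) : prog -> tree -> tree -> Prop :=
  | eval_id x : eval o pId x x
  | eval_leaf x : eval o pLeaf x leaf
  | eval_fst a b : eval o pFst (node a b) a
  | eval_snd a b : eval o pSnd (node a b) b
  | eval_pair p q x y z :
      eval o p x y -> eval o q x z -> eval o (pPair p q) x (node y z)
  | eval_comp p q x y z :
      eval o q x y -> eval o p y z -> eval o (pComp p q) x z
  | eval_rec_leaf p q x y :
      eval o p x y -> eval o (pRec p q) (node x leaf) y
  | eval_rec_node p q x a b u v y :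
      eval o (pRec p q) (node x a) u ->
      eval o (pRec p q) (node x b) v ->
      eval o q (node x (node (node a b) (node u v))) y ->
      eval o (pRec p q) (node x (node a b)) y
  | eval_while_stop p x : eval o (pWhile p) (node leaf x) (node leaf x)
  | eval_while_step p a b x y z :
      eval o p (node (node a b) x) y ->
      eval o (pWhile p) y z ->
      eval o (pWhile p) (node (node a b) x) z
  | eval_ask n : eval o pAsk (num n) (num (o n)).

Lemma num_inj : injective num.
Proof. by elim=> [|m IHm] [|n] //= [] /IHm ->. Qed.

Lemma eval_det o p x y z : eval o p x y -> eval o p x z -> y = z.
Proof.
move=> H; elim: H z => {p x y} /=;
  try by [move=> > H; inversion H | move=> > _ IHp _ IHq > H; inversion H;
          subst; f_equal; auto | move=> > _ IHp > H; inversion H; subst; auto].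
- move=> p q x y z _ IHq _ IHp w H; inversion H as [ | | | | |? ? ? y' ? Hq Hp| | | | |]; subst.
  by apply: IHp; rewrite (IHq _ Hq).
- move=> p q x a b u v y _ IHu _ IHv _ IHy z H.
  inversion H as [ | | | | | | |? ? ? ? ? u' v' ? Hu Hv Hy| | |]; subst.
  by apply: IHy; rewrite (IHu _ Hu) (IHv _ Hv).
- move=> p a b x y z _ IHp _ IHw w H.
  inversion H as [ | | | | | | | | |? ? ? ? y' ? Hp Hw|]; subst.
  by apply: IHw; rewrite (IHp _ Hp).
- move=> n z H; inversion H as [ | | | | | | | | | |m Ep En Ez]; subst.
  by rewrite (num_inj En).
Qed.

Class coded (X : Type) := Coded { code : X -> tree; code_inj : injective code }.

#[export] Instance coded_nat : coded nat := Coded num_inj.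

Definition code_bool (b : bool) := num b.
Lemma code_bool_inj : injective code_bool.
Proof. by case; case. Qed.
#[export] Instance coded_bool : coded bool := Coded code_bool_inj.

Definition code_void (x : void) : tree := of_void tree x.
Lemma code_void_inj : injective code_void.
Proof. by case. Qed.
#[export] Instance coded_void : coded void := Coded code_void_inj.

Definition code_ord n (i : 'I_n) := num i.
Lemma code_ord_inj n : injective (@code_ord n).
Proof. by move=> i j /num_inj/val_inj. Qed.
#[export] Instance coded_ord n : coded 'I_n := Coded (@code_ord_inj n).

Definition code_option X `{coded X} (x : option X) :=
  if x is Some x' then node leaf (code x') else leaf.
Lemma code_option_inj X `{coded X} : injective (@code_option X _).
Proof. by case=> [x|] [y|] //= [] /(@code_inj X _) ->. Qed.
#[export] Instance coded_option X `{coded X} : coded (option X) :=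
  Coded (@code_option_inj X _).

Definition code_prod X Y `{coded X} `{coded Y} (x : X * Y) :=
  node (code x.1) (code x.2).
Lemma code_prod_inj X Y `{coded X} `{coded Y} : injective (@code_prod X Y _ _).
Proof. by case=> [x y] [x' y'] /= [] /(@code_inj X _) -> /(@code_inj Y _) ->. Qed.
#[export] Instance coded_prod X Y `{coded X} `{coded Y} : coded (X * Y) :=
  Coded (@code_prod_inj X Y _ _).

Fixpoint code_seq X `{coded X} (s : seq X) :=
  if s is x :: s' then node (code x) (code_seq s') else leaf.
Lemma code_seq_inj X `{coded X} : injective (@code_seq X _).
Proof. by elim=> [|x s IHs] [|y t] //= [] /(@code_inj X _) -> /IHs ->. Qed.
#[export] Instance coded_seq X `{coded X} : coded (seq X) :=
  Coded (@code_seq_inj X _).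

Definition code_sig (T : nat -> Type) `{forall n, coded (T n)}
    (x : {n : nat & T n}) :=
  node (num (tag x)) (code (tagged x)).
Lemma code_sig_inj T `{forall n, coded (T n)} : injective (@code_sig T _).
Proof.
case=> [m x] [n y] [] /= /num_inj eq_mn.
by case: n / eq_mn y => y /(@code_inj (T m) _) ->.
Qed.
#[export] Instance coded_sig T `{forall n, coded (T n)} :
  coded {n : nat & T n} := Coded (@code_sig_inj T _).

(* A finite function is coded by its graph. *)
Definition code_ffun (A : finType) X `{coded A} `{coded X}
    (f : {ffun A -> X}) :=
  code [seq (a, f a) | a <- enum A].
Lemma code_ffun_inj (A : finType) X `{coded A} `{coded X} :
  injective (@code_ffun A X _ _).
Proof.
move=> f g /(@code_inj (seq (A * X)) _) fg; apply/ffunP=> a.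
elim: (enum A) (mem_enum A a) fg => [//|b s IHs].
rewrite inE => /predU1P[<- [] //|as_ [] _ /IHs]; exact.
Qed.
#[export] Instance coded_ffun (A : finType) X `{coded A} `{coded X} :
  coded {ffun A -> X} := Coded (@code_ffun_inj A X _ _).

(* What a program gets to see of an input: a tree, and an oracle, which is
   trivial for finite inputs and gives access to the valuation otherwise. *)
Class presented (X : Type) :=
  Presented { data : X -> tree; oracle : X -> nat -> nat }.

#[export] Instance presented_coded X `{coded X} : presented X | 1 :=
  {| data := code; oracle := fun _ _ => 0 |}.

#[export] Instance presented_valuation X `{coded X} :
    presented (X * (nat -> nat)) | 0 :=
  {| data := fun x => code x.1; oracle := fun x => x.2 |}.

Definition computable X Y `{presented X} `{presented Y} (f : X -> Y) : Prop :=
  exists p q : prog, forall x : X,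
    eval (oracle x) p (data x) (data (f x)) /\
    forall i, eval (oracle x) q (node (data x) (num i)) (num (oracle (f x) i)).

Definition reduces X Y `{presented X} `{presented Y}
    (P : X -> Prop) (Q : Y -> Prop) : Prop :=
  exists f : X -> Y, computable f /\ forall x, P x <-> Q (f x).

Notation "P ⪯ Q" := (reduces P Q) (at level 70).

Definition has_decider X `{presented X} (P : X -> Prop) : Prop :=
  exists d : X -> bool, computable d /\ forall x, P x <-> d x = true.

Inductive direction := goL | goN | goR.

(* In [midtape ls a rs] the head is on [a] and the parts of the tape to the
   left and to the right of it are listed starting from the head.  In [leftof]
   and [rightof] the head is just outside of the nonempty written part. *)
Inductive tape (A : Type) :=
  | niltape
  | leftof of A & seq A
  | rightof of A & seq A
  | midtape of seq A & A & seq A.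
Arguments niltape {A}.

Section Tape.
Variable A : Type.
Implicit Type t : tape A.

Definition current t : option A := if t is midtape _ a _ then Some a else None.

Definition left_part t : seq A :=
  match t with
  | niltape | leftof _ _ => [::]
  | rightof a ls => a :: ls
  | midtape ls _ _ => ls
  end.

Definition right_part t : seq A :=
  match t with
  | niltape | rightof _ _ => [::]
  | leftof a rs => a :: rs
  | midtape _ _ rs => rs
  end.

Definition write (w : option A) t : tape A :=
  if w is Some a then midtape (left_part t) a (right_part t) else t.

Definition go (d : direction) t : tape A :=
  match d, t with
  | goL, rightof a ls => midtape ls a [::]
  | goL, midtape [::] a rs => leftof a rs
  | goL, midtape (b :: ls) a rs => midtape ls b (a :: rs)
  | goR, leftof a rs => midtape [::] a rs
  | goR, midtape ls a [::] => rightof a ls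
  | goR, midtape ls a (b :: rs) => midtape (a :: ls) b rs
  | _, _ => t
  end.
End Tape.

(* [k] symbols and [n] states.  A transition reads [None] off the written part
   of the tape, and writes nothing if its second component is [None]. *)
Record tm (k n : nat) := TM {
  start : 'I_n;
  halting : {ffun 'I_n -> bool};
  trans : {ffun 'I_n * option 'I_k -> 'I_n * (option 'I_k * direction)}
}.

Section TuringMachine.
Variables (k n : nat) (M : tm k n).

Definition tm_config : Type := 'I_n * tape 'I_k.

Inductive tm_step : tm_config -> tm_config -> Prop :=
  | tm_step_intro q t q' w d :
      ~~ halting M q ->
      trans M (q, current t) = (q', (w, d)) ->
      tm_step (q, t) (q', go d (write w t)).

Definition tm_halts (t : tape 'I_k) : Prop :=
  exists c, clos_refl_trans _ tm_step (start M, t) c /\ halting M c.1.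
End TuringMachine.

Definition Halt (x : {k : nat & {n : nat & (tm k n * tape 'I_k)%type}}) : Prop :=
  let: existT k (existT n (M, t)) := x in tm_halts M t.

Definition code_direction (d : direction) :=
  num (match d with goL => 0 | goN => 1 | goR => 2 end).
Lemma code_direction_inj : injective code_direction.
Proof. by case; case. Qed.
#[export] Instance coded_direction : coded direction :=
  Coded code_direction_inj.

Definition code_tape A `{coded A} (t : tape A) :=
  match t with
  | niltape => node (num 0) leaf
  | leftof a rs => node (num 1) (code (a, rs))
  | rightof a ls => node (num 2) (code (a, ls))
  | midtape ls a rs => node (num 3) (code (ls, a, rs))
  end.
Lemma code_tape_inj A `{coded A} : injective (@code_tape A _).
Proof.
case=> [|a rs|a ls|ls a rs] [|a' rs'|a' ls'|ls' a' rs'] //= [].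
- by move=> /(@code_inj A _) -> /code_seq_inj ->.
- by move=> /(@code_inj A _) -> /code_seq_inj ->.
- by move=> /code_seq_inj -> /(@code_inj A _) -> /code_seq_inj ->.
Qed.
#[export] Instance coded_tape A `{coded A} : coded (tape A) :=
  Coded (@code_tape_inj A _).

Definition code_tm k n (M : tm k n) := code (start M, halting M, trans M).
Lemma code_tm_inj k n : injective (@code_tm k n).
Proof. by case=> [s h t] [s' h' t'] /code_prod_inj [] -> -> ->. Qed.
#[export] Instance coded_tm k n : coded (tm k n) := Coded (@code_tm_inj k n).

Definition PCP (P : seq (seq nat * seq nat)) : Prop :=
  exists I : seq 'I_(size P), I <> [::] /\
    flatten [seq (tnth (in_tuple P) i).1 | i <- I] =
    flatten [seq (tnth (in_tuple P) i).2 | i <- I].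

Inductive instr (n : nat) :=
  | INC of 'I_n
  | DEC of 'I_n & nat.

Section Minsky.
Variable n : nat.

Definition vec : Type := {ffun 'I_n -> nat}.
Definition mm_machine : Type := nat * seq (instr n).
Definition mm_state : Type := nat * vec.

Definition update (v : vec) (a : 'I_n) (x : nat) : vec :=
  [ffun b => if b == a then x else v b].

Definition labels (M : mm_machine) (i : nat) (ins : instr n) : Prop :=
  M.1 <= i /\ onth M.2 (i - M.1) = Some ins.

Definition outside (M : mm_machine) (i : nat) : Prop :=
  i < M.1 \/ M.1 + size M.2 <= i.

Inductive mm_step (M : mm_machine) : mm_state -> mm_state -> Prop :=
  | mm_step_inc i (v : vec) a :
      labels M i (INC a) ->
      mm_step M (i, v) (i.+1, update v a (v a).+1)
  | mm_step_dec i (v : vec) a p :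
      labels M i (DEC a p) -> 0 < v a ->
      mm_step M (i, v) (i.+1, update v a (v a).-1)
  | mm_step_jump i (v : vec) a p :
      labels M i (DEC a p) -> v a = 0 ->
      mm_step M (i, v) (p, v).

Definition mm_terminates (M : mm_machine) (x : mm_state) : Prop :=
  exists y, clos_refl_trans _ (mm_step M) x y /\ outside M y.1.
End Minsky.

Definition MM (x : {n : nat & (seq (instr n) * {ffun 'I_n -> nat})%type}) : Prop :=
  let: existT n (P, v) := x in mm_terminates (1, P) (1, v).

Definition code_instr n (ins : instr n) :=
  match ins with
  | INC a => node (num 0) (code a)
  | DEC a p => node (num 1) (code (a, p))
  end.
Lemma code_instr_inj n : injective (@code_instr n).
Proof.
case=> [a|a p] [a'|a' p'] //= [].
- by move=> /code_ord_inj ->.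
- by move=> /code_ord_inj -> /num_inj ->.
Qed.
#[export] Instance coded_instr n : coded (instr n) := Coded (@code_instr_inj n).

(* Denominators may be zero; note that [0 %| m] iff [m = 0]. *)
Inductive fractran_step : seq (nat * nat) -> nat -> nat -> Prop :=
  | fractran_here p q Q x y :
      q * y = p * x -> fractran_step ((p, q) :: Q) x y
  | fractran_next p q Q x y :
      ~~ (q %| p * x) -> fractran_step Q x y ->
      fractran_step ((p, q) :: Q) x y.

Definition FRACTRAN (a : seq (nat * nat) * nat) : Prop :=
  let: (Q, s) := a in
  exists x, clos_refl_trans _ (fractran_step Q) s x /\
    forall y, ~ fractran_step Q x y.

Inductive form :=
  | FNat of nat & nat
  | FVar of nat & nat
  | FAdd of nat & nat & nat
  | FMul of nat & nat & nat
  | FAnd of form & form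
  | FOr of form & form
  | FEx of form.

Definition scons (n : nat) (nu : nat -> nat) (i : nat) : nat :=
  if i is j.+1 then nu j else n.

Fixpoint sem (A : form) (nu : nat -> nat) : Prop :=
  match A with
  | FNat i n => nu i = n
  | FVar i j => nu i = nu j
  | FAdd i j k => nu i = nu j + nu k
  | FMul i j k => nu i = nu j * nu k
  | FAnd A B => sem A nu /\ sem B nu
  | FOr A B => sem A nu \/ sem B nu
  | FEx A => exists n, sem A (scons n nu)
  end.

Definition DIO_FORM (x : form * (nat -> nat)) : Prop := sem x.1 x.2.

Fixpoint code_form (A : form) : tree :=
  match A with
  | FNat i n => node (num 0) (code (i, n))
  | FVar i j => node (num 1) (code (i, j))
  | FAdd i j k => node (num 2) (code (i, j, k))
  | FMul i j k => node (num 3) (code (i, j, k))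
  | FAnd A B => node (num 4) (node (code_form A) (code_form B))
  | FOr A B => node (num 5) (node (code_form A) (code_form B))
  | FEx A => node (num 6) (code_form A)
  end.
Lemma code_form_inj : injective code_form.
Proof.
elim=> [i n|i j|i j k|i j k|A IHA B IHB|A IHA B IHB|A IHA] [] //=.
- by move=> i' n' [] /num_inj -> /num_inj ->.
- by move=> i' j' [] /num_inj -> /num_inj ->.
- by move=> i' j' k' [] /num_inj -> /num_inj -> /num_inj ->.
- by move=> i' j' k' [] /num_inj -> /num_inj -> /num_inj ->.
- by move=> A' B' [] /IHA -> /IHB ->.
- by move=> A' B' [] /IHA -> /IHB ->.
- by move=> A' [] /IHA ->.
Qed.
#[export] Instance coded_form : coded form := Coded code_form_inj.

Inductive constraint :=
  | CNat of nat & nat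
  | CVar of nat & nat
  | CPar of nat & nat
  | CAdd of nat & nat & nat
  | CMul of nat & nat & nat.

Definition holds (phi nu : nat -> nat) (c : constraint) : bool :=
  match c with
  | CNat u n => phi u == n
  | CVar u v => phi u == phi v
  | CPar u i => phi u == nu i
  | CAdd u v w => phi u == phi v + phi w
  | CMul u v w => phi u == phi v * phi w
  end.

Definition DIO_ELEM (x : seq constraint * (nat -> nat)) : Prop :=
  exists phi : nat -> nat, all (holds phi x.2) x.1.

Definition code_constraint (c : constraint) : tree :=
  match c with
  | CNat u n => node (num 0) (code (u, n))
  | CVar u v => node (num 1) (code (u, v))
  | CPar u i => node (num 2) (code (u, i))
  | CAdd u v w => node (num 3) (code (u, v, w))
  | CMul u v w => node (num 4) (code (u, v, w))
  end.
Lemma code_constraint_inj : injective code_constraint.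
Proof.
case=> [u n|u v|u i|u v w|u v w] [] //=.
- by move=> u' n' [] /num_inj -> /num_inj ->.
- by move=> u' v' [] /num_inj -> /num_inj ->.
- by move=> u' i' [] /num_inj -> /num_inj ->.
- by move=> u' v' w' [] /num_inj -> /num_inj -> /num_inj ->.
- by move=> u' v' w' [] /num_inj -> /num_inj -> /num_inj ->.
Qed.
#[export] Instance coded_constraint : coded constraint :=
  Coded code_constraint_inj.

Inductive dpoly (U V : Type) :=
  | PVar of U
  | PPar of V
  | PNat of nat
  | PAdd of dpoly U V & dpoly U V
  | PMul of dpoly U V & dpoly U V.
Arguments PVar {U V}.
Arguments PPar {U V}.
Arguments PNat {U V}.

Fixpoint value U V (phi : U -> nat) (nu : V -> nat) (p : dpoly U V) : nat :=
  match p with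
  | PVar u => phi u
  | PPar x => nu x
  | PNat n => n
  | PAdd p q => value phi nu p + value phi nu q
  | PMul p q => value phi nu p * value phi nu q
  end.

Definition DIO_SINGLE
    (x : (dpoly nat nat * dpoly nat nat) * (nat -> nat)) : Prop :=
  let: ((p, q), nu) := x in
  exists phi : nat -> nat, value phi nu p = value phi nu q.

Definition H10
    (x : {n : nat & (dpoly 'I_n void * dpoly 'I_n void)%type}) : Prop :=
  let: existT n (p, q) := x in
  exists phi : {ffun 'I_n -> nat},
    value phi (of_void nat) p = value phi (of_void nat) q.

Fixpoint code_dpoly U V `{coded U} `{coded V} (p : dpoly U V) : tree :=
  match p with
  | PVar u => node (num 0) (code u)
  | PPar x => node (num 1) (code x)
  | PNat n => node (num 2) (code n)
  | PAdd p q => node (num 3) (node (code_dpoly p) (code_dpoly q))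
  | PMul p q => node (num 4) (node (code_dpoly p) (code_dpoly q))
  end.
Lemma code_dpoly_inj U V `{coded U} `{coded V} :
  injective (@code_dpoly U V _ _).
Proof.
elim=> [u|x|n|p IHp q IHq|p IHp q IHq] [] //=.
- by move=> u' [] /(@code_inj U _) ->.
- by move=> x' [] /(@code_inj V _) ->.
- by move=> n' [] /num_inj ->.
- by move=> p' q' [] /IHp -> /IHq ->.
- by move=> p' q' [] /IHp -> /IHq ->.
Qed.
#[export] Instance coded_dpoly U V `{coded U} `{coded V} :
  coded (dpoly U V) := Coded (@code_dpoly_inj U V _ _).

(* Main.v *)
(** Reductions compose, so only the seven reductions matter.

    Halt to PCP: a Turing machine is a string rewriting system on the words
    "left part, state, right part" in which a halting state becomes a letter that
    erases everything else; the solutions of a PCP instance spell out the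
    derivations of that letter.

    PCP to MM and FRACTRAN to DIO_FORM: both source problems are defined by one
    fixed Diophantine formula in a few numbers computed from the instance.  A
    fixed Minsky machine then searches for witnesses of the formula for PCP below
    larger and larger bounds.  The formulas need the reflexive-transitive closure
    of a Diophantine relation: the successive states are the digits of a number,
    exponentiation is Diophantine by Matiyasevich's analysis of the Pell equation,
    and a bounded universal quantifier is eliminated by replacing the values of
    each variable with one number that has them as residues modulo pairwise
    coprime factors of a binomial coefficient.

    MM to FRACTRAN: a state is a product of powers of pairwise coprime numbers,
    one for each register and two for each label.

    DIO_FORM to H10: a formula becomes an always satisfiable system of elementary
    constraints with a distinguished variable that may vanish iff the formula
    holds; a system becomes one equation between sums of squares; and the
    parameters are replaced with their values. *)

Require Import Defs.
From mathcomp Require Import all_boot order ssralg ssrnum ssrint intdiv zify ring.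
From Stdlib Require Import Relation_Operators Operators_Properties.

Set Implicit Arguments.
Unset Strict Implicit.
Unset Printing Implicit Defensive.

(** * Total programs *)

(** The obstacle is that every reduction must come with a program. Evaluation is partial, so the
    basic notion [tcomp] is a program that halts on all trees, and [cf] transports its closure
    properties to coded types. Dependent or recursive instance types (machines with [n] registers,
    formulas, polynomials) are out of reach of these combinators, so their translations are repeated
    on bare trees and the two versions are shown to agree on codes. The heavy arithmetic escapes
    this burden: the Diophantine formulas for PCP and FRACTRAN come out of existence proofs and
    enter the reductions as constants, as does the machine that searches for witnesses. Only their
    numerical parameters are programmed, and no syntactic transformation behind exponentiation or
    bounded quantification has to be shown computable. *)

Definition tfst (t : tree) := if t is node a _ then a else leaf.
Definition tsnd (t : tree) := if t is node _ b then b else leaf.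

Fixpoint trec (p q : tree -> tree) (x t : tree) : tree :=
  match t with
  | leaf => p x
  | node a b => q (node x (node (node a b) (node (trec p q x a) (trec p q x b))))
  end.

Fixpoint unnum (t : tree) : nat := if t is node _ b then (unnum b).+1 else 0.

Lemma numK : cancel num unnum.
Proof. by elim=> //= n ->. Qed.

Definition tcomp (F : (nat -> nat) -> tree -> tree) : Prop :=
  exists p, forall o x, eval o p x (F o x).

Lemma tcomp_ext F G : (forall o x, F o x = G o x) -> tcomp F -> tcomp G.
Proof. by move=> FG [p Hp]; exists p => o x; rewrite -FG. Qed.

Lemma tcomp_id : tcomp (fun _ x => x).
Proof. by exists pId => o x; constructor. Qed.

Lemma tcomp_leaf : tcomp (fun _ _ => leaf).
Proof. by exists pLeaf => o x; constructor. Qed.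

Lemma tcomp_node F G : tcomp F -> tcomp G -> tcomp (fun o x => node (F o x) (G o x)).
Proof. by move=> [p Hp] [q Hq]; exists (pPair p q) => o x; constructor. Qed.

Lemma tcomp_comp F G : tcomp F -> tcomp G -> tcomp (fun o x => F o (G o x)).
Proof. by move=> [p Hp] [q Hq]; exists (pComp p q) => o x; econstructor; eauto. Qed.

Lemma tcomp_rec P Q F G : tcomp P -> tcomp Q -> tcomp F -> tcomp G ->
  tcomp (fun o x => trec (P o) (Q o) (F o x) (G o x)).
Proof.
move=> [p Hp] [q Hq] HF HG.
case: (tcomp_node HF HG) => r Hr; exists (pComp (pRec p q) r) => o x.
apply: eval_comp (Hr o x) _; elim: (G o x) => [|a IHa b IHb] /=.
  by constructor.
by apply: eval_rec_node IHa IHb _.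
Qed.

(** [pFst] is stuck on [leaf], so the total projection is a degenerate recursion: the node case
    returns the left subtree and ignores the recursive results, which still have to exist. *)
Lemma tcomp_fst : tcomp (fun _ => tfst).
Proof.
set q := pComp pFst (pComp pFst pSnd).
have Hq o x a b r : eval o q (node x (node (node a b) r)) a.
  by do 2 (econstructor; [|constructor]); econstructor.
exists (pComp (pRec pLeaf q) (pPair pLeaf pId)) => o x.
apply: (@eval_comp _ _ _ _ (node leaf x)); first by do 2 constructor.
have [u Hu] : exists u, eval o (pRec pLeaf q) (node leaf x) u.
  elim: x => [|a [u Hu] b [v Hv]]; first by exists leaf; do 2 constructor.
  by exists a; apply: eval_rec_node Hu Hv (Hq _ _ _ _ _).
case: x u Hu => [|a b] u Hu /=; first by do 2 constructor.
inversion Hu as [| | | | | | |? ? ? ? ? u' v' ? Hu' Hv' Hy| | |]; subst.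
exact: eval_rec_node Hu' Hv' (Hq _ _ _ _ _).
Qed.

Lemma tcomp_snd : tcomp (fun _ => tsnd).
Proof.
set q := pComp pSnd (pComp pFst pSnd).
have Hq o x a b r : eval o q (node x (node (node a b) r)) b.
  by do 2 (econstructor; [|constructor]); econstructor.
exists (pComp (pRec pLeaf q) (pPair pLeaf pId)) => o x.
apply: (@eval_comp _ _ _ _ (node leaf x)); first by do 2 constructor.
have [u Hu] : exists u, eval o (pRec pLeaf q) (node leaf x) u.
  elim: x => [|a [u Hu] b [v Hv]]; first by exists leaf; do 2 constructor.
  by exists b; apply: eval_rec_node Hu Hv (Hq _ _ _ _ _).
case: x u Hu => [|a b] u Hu /=; first by do 2 constructor.
inversion Hu as [| | | | | | |? ? ? ? ? u' v' ? Hu' Hv' Hy| | |]; subst.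
exact: eval_rec_node Hu' Hv' (Hq _ _ _ _ _).
Qed.

Lemma tcomp_fst_of F : tcomp F -> tcomp (fun o x => tfst (F o x)).
Proof. exact: tcomp_comp tcomp_fst. Qed.

Lemma tcomp_snd_of F : tcomp F -> tcomp (fun o x => tsnd (F o x)).
Proof. exact: tcomp_comp tcomp_snd. Qed.

Lemma tcomp_const t : tcomp (fun _ _ => t).
Proof. by elim: t => [|a IHa b IHb]; [exact: tcomp_leaf | exact: tcomp_node]. Qed.

Ltac tcomp :=
  repeat first
    [ exact: tcomp_id | exact: tcomp_const | assumption
    | apply: tcomp_node | apply: tcomp_fst_of | apply: tcomp_snd_of ].

Lemma tcomp_case P Q G : tcomp P -> tcomp Q -> tcomp G ->
  tcomp (fun o x => if G o x is node a b then Q o (node x (node a b)) else P o x).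
Proof.
move=> HP HQ HG.
apply: (@tcomp_ext (fun o x => trec (P o)
  (fun t => Q o (node (tfst t) (tfst (tsnd t)))) x (G o x))).
  by move=> o x; case: (G o x).
apply: (@tcomp_rec P (fun o t => Q o (node (tfst t) (tfst (tsnd t)))) _ G HP) HG;
  last exact: tcomp_id.
by apply: (@tcomp_comp Q) => //; tcomp.
Qed.

(** [pAsk] answers on numerals only; normalising the right spine of an arbitrary tree to a numeral
    makes queries total. *)
Lemma tcomp_unnum : tcomp (fun _ t => num (unnum t)).
Proof.
apply: (@tcomp_ext (fun o x => trec (fun=> leaf)
   (fun t => node leaf (tsnd (tsnd (tsnd t)))) leaf x)).
  by move=> o; elim=> //= a _ b ->.
by apply: (@tcomp_rec (fun _ _ => leaf)
  (fun _ t => node leaf (tsnd (tsnd (tsnd t)))) (fun _ _ => leaf) (fun _ x => x)); tcomp.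
Qed.

Lemma tcomp_ask : tcomp (fun o t => num (o (unnum t))).
Proof.
case: tcomp_unnum => p Hp; exists (pComp pAsk p) => o x.
exact: eval_comp (Hp o x) (eval_ask o _).
Qed.

(** * Computable functions on coded types *)

#[export] Instance coded_tree : coded tree := Coded (fun x y (e : id x = id y) => e).

(** The tree function is unconstrained outside the codes, and on codes its result is the same for
    every oracle. *)
Definition cf A B `{coded A} `{coded B} (f : A -> B) : Prop :=
  exists2 F, tcomp F & forall o a, F o (code a) = code (f a).

Lemma cf_ext A B `{coded A} `{coded B} (f g : A -> B) : f =1 g -> cf f -> cf g.
Proof. by move=> fg [F cF Ff]; exists F => // o a; rewrite Ff fg. Qed.

Lemma cf_id A `{coded A} : cf (fun x : A => x).
Proof. by exists (fun _ x => x) => //; exact: tcomp_id. Qed.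

Lemma cf_const A B `{coded A} `{coded B} (b : B) : cf (fun _ : A => b).
Proof. by exists (fun _ _ => code b) => //; exact: tcomp_const. Qed.

Lemma cf_comp A B C `{coded A} `{coded B} `{coded C} (g : B -> C) (f : A -> B) :
  cf g -> cf f -> cf (fun x => g (f x)).
Proof.
move=> [G cG Gg] [F cF Ff]; exists (fun o x => G o (F o x)); first exact: tcomp_comp.
by move=> o a; rewrite Ff Gg.
Qed.

Lemma cf_pair A B C `{coded A} `{coded B} `{coded C} (f : A -> B) (g : A -> C) :
  cf f -> cf g -> cf (fun x => (f x, g x)).
Proof.
move=> [F cF Ff] [G cG Gg]; exists (fun o x => node (F o x) (G o x)).
  exact: tcomp_node.
by move=> o a; rewrite Ff Gg.
Qed.

Lemma cf_fst A B C `{coded A} `{coded B} `{coded C} (f : A -> B * C) :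
  cf f -> cf (fun x => (f x).1).
Proof.
move=> [F cF Ff]; exists (fun o x => tfst (F o x)); first exact: tcomp_fst_of.
by move=> o a; rewrite Ff; case: (f a).
Qed.

Lemma cf_snd A B C `{coded A} `{coded B} `{coded C} (f : A -> B * C) :
  cf f -> cf (fun x => (f x).2).
Proof.
move=> [F cF Ff]; exists (fun o x => tsnd (F o x)); first exact: tcomp_snd_of.
by move=> o a; rewrite Ff; case: (f a).
Qed.

Lemma cf_comp2 A B C D `{coded A} `{coded B} `{coded C} `{coded D}
    (h : B -> C -> D) (f : A -> B) (g : A -> C) :
  cf (fun x => h x.1 x.2) -> cf f -> cf g -> cf (fun x => h (f x) (g x)).
Proof. by move=> Hh Hf Hg; exact: (cf_comp Hh (cf_pair Hf Hg)). Qed.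

Lemma cf_code A B `{coded A} `{coded B} (f : A -> B) : cf f -> cf (fun x => code (f x)).
Proof. by move=> [F cF Ff]; exists F. Qed.

Lemma cf_num A `{coded A} (f : A -> nat) : cf f -> cf (fun x => num (f x)).
Proof. exact: cf_code. Qed.

Lemma cf_node A `{coded A} (f g : A -> tree) : cf f -> cf g -> cf (fun x => node (f x) (g x)).
Proof.
move=> [F cF Ff] [G cG Gg]; exists (fun o x => node (F o x) (G o x)).
  exact: tcomp_node.
by move=> o a; rewrite Ff Gg.
Qed.

Lemma cf_tfst A `{coded A} (f : A -> tree) : cf f -> cf (fun x => tfst (f x)).
Proof.
move=> [F cF Ff]; exists (fun o x => tfst (F o x)); first exact: tcomp_fst_of.
by move=> o a; rewrite Ff.
Qed.

Lemma cf_tsnd A `{coded A} (f : A -> tree) : cf f -> cf (fun x => tsnd (f x)).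
Proof.
move=> [F cF Ff]; exists (fun o x => tsnd (F o x)); first exact: tcomp_snd_of.
by move=> o a; rewrite Ff.
Qed.

Lemma cf_unnum A `{coded A} (f : A -> tree) : cf f -> cf (fun x => unnum (f x)).
Proof.
move=> [F cF Ff]; exists (fun o x => num (unnum (F o x))).
  exact: tcomp_comp tcomp_unnum cF.
by move=> o a; rewrite Ff.
Qed.

(** Every tree is the code of a list of trees: [code (unseq t)] is [t] itself, so this conversion
    costs no computation. *)
Fixpoint unseq (t : tree) : seq tree := if t is node a b then a :: unseq b else [::].

Lemma cf_unseq A `{coded A} (f : A -> tree) : cf f -> cf (fun x => unseq (f x)).
Proof.
move=> [F cF Ff]; exists F => // o a; rewrite Ff.
by elim: (f a) => //= b _ c {1}->.
Qed.

Lemma unseq_code A `{coded A} (s : seq A) : unseq (code s) = [seq code x | x <- s].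
Proof. by elim: s => //= x s ->. Qed.

Lemma cf_cons A B `{coded A} `{coded B} (f : A -> B) (g : A -> seq B) :
  cf f -> cf g -> cf (fun x => f x :: g x).
Proof.
move=> [F cF Ff] [G cG Gg]; exists (fun o x => node (F o x) (G o x)).
  exact: tcomp_node.
by move=> o a; rewrite Ff Gg.
Qed.

(** Lists are right spines, so a fold is a tree recursion that keeps the result for the right
    subtree; the one for the code of the head is computed and dropped. *)
Lemma cf_foldr A B C `{coded A} `{coded B} `{coded C}
    (s : A -> C -> B -> B) (b : A -> B) (l : A -> seq C) :
  cf (fun x : A * (C * B) => s x.1 x.2.1 x.2.2) -> cf b -> cf l ->
  cf (fun x => foldr (s x) (b x) (l x)).
Proof.
move=> [S cS Ss] [B0 cB Bb] [L cL Ll].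
exists (fun o x => trec (B0 o) (fun t => S o
   (node (tfst t) (node (tfst (tfst (tsnd t))) (tsnd (tsnd (tsnd t))))))
   x (L o x)).
  apply: (@tcomp_rec B0 (fun o t => S o
   (node (tfst t) (node (tfst (tfst (tsnd t))) (tsnd (tsnd (tsnd t)))))) _ L) => //.
    by apply: (@tcomp_comp S) => //; tcomp.
  exact: tcomp_id.
move=> o a; rewrite Ll; elim: (l a) => [|c r IHr] //=.
have := Ss o (a, (c, foldr (s a) (b a) r)) => /= <-.
by rewrite IHr.
Qed.

Lemma cf_iteri A B `{coded A} `{coded B}
    (n : A -> nat) (s : A -> nat -> B -> B) (b : A -> B) :
  cf (fun x : A * (nat * B) => s x.1 x.2.1 x.2.2) -> cf b -> cf n ->
  cf (fun x => iteri (n x) (s x) (b x)).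
Proof.
move=> [S cS Ss] [B0 cB Bb] [N cN Nn].
exists (fun o x => trec (B0 o) (fun t => S o
   (node (tfst t) (node (tsnd (tfst (tsnd t))) (tsnd (tsnd (tsnd t))))))
   x (N o x)).
  apply: (@tcomp_rec B0 (fun o t => S o
   (node (tfst t) (node (tsnd (tfst (tsnd t))) (tsnd (tsnd (tsnd t)))))) _ N) => //.
    by apply: (@tcomp_comp S) => //; tcomp.
  exact: tcomp_id.
move=> o a; rewrite Nn; elim: (n a) => [|k IHk] //=.
have := Ss o (a, (k, iteri k (s a) (b a))) => /= <-.
by rewrite IHk.
Qed.

Lemma cf_if A B `{coded A} `{coded B} (c : A -> bool) (f g : A -> B) :
  cf c -> cf f -> cf g -> cf (fun x => if c x then f x else g x).
Proof.
move=> [C cC Cc] [F cF Ff] [G cG Gg].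
exists (fun o x => if C o x is node a b then F o (tfst (node x (node a b))) else G o x).
  apply: (@tcomp_case G (fun o t => F o (tfst t)) C) => //.
  by apply: (@tcomp_comp F) => //; tcomp.
by move=> o a; rewrite Cc; case: (c a); rewrite /= ?Ff ?Gg.
Qed.

Lemma cf_succ A `{coded A} (f : A -> nat) : cf f -> cf (fun x => (f x).+1).
Proof.
move=> [F cF Ff]; exists (fun o x => node leaf (F o x)) => [|o a]; first by tcomp.
by rewrite Ff.
Qed.

Lemma cf_pred A `{coded A} (f : A -> nat) : cf f -> cf (fun x => (f x).-1).
Proof.
move=> [F cF Ff]; exists (fun o x => tsnd (F o x)) => [|o a]; first by tcomp.
by rewrite Ff; case: (f a).
Qed.

Lemma cf_iter A B `{coded A} `{coded B}
    (n : A -> nat) (s : A -> B -> B) (b : A -> B) :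
  cf (fun x : A * B => s x.1 x.2) -> cf b -> cf n ->
  cf (fun x => iter (n x) (s x) (b x)).
Proof.
move=> Hs Hb Hn.
apply: (@cf_ext _ _ _ _ (fun x => iteri (n x) (fun _ => s x) (b x))).
  by move=> x; elim: (n x) => //= k ->.
apply: cf_iteri Hb Hn.
apply: (cf_comp2 (h := s) Hs (f := fun x : A * (nat * B) => x.1) (g := fun x => x.2.2)).
  exact/cf_fst/cf_id.
exact/cf_snd/cf_snd/cf_id.
Qed.

Lemma cf_add A `{coded A} (f g : A -> nat) : cf f -> cf g -> cf (fun x => f x + g x).
Proof.
move=> Hf Hg; apply: (@cf_ext _ _ _ _ (fun x => iter (f x) succn (g x))).
  by move=> x; rewrite iter_succn addnC.
by apply: (cf_iter (s := fun _ => succn)) => //; apply/cf_succ/cf_snd/cf_id.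
Qed.

Lemma cf_sub A `{coded A} (f g : A -> nat) : cf f -> cf g -> cf (fun x => f x - g x).
Proof.
move=> Hf Hg; apply: (@cf_ext _ _ _ _ (fun x => iter (g x) predn (f x))).
  by move=> x; elim: (g x) => [|k /= ->]; rewrite ?subn0 ?subnS.
by apply: (cf_iter (s := fun _ => predn)) => //; apply/cf_pred/cf_snd/cf_id.
Qed.

Lemma cf_mul A `{coded A} (f g : A -> nat) : cf f -> cf g -> cf (fun x => f x * g x).
Proof.
move=> Hf Hg; apply: (@cf_ext _ _ _ _ (fun x => iter (f x) (addn (g x)) 0)).
  by move=> x; rewrite iter_addn_0 mulnC.
apply: (cf_iter (s := fun x => addn (g x))) => //; last exact: cf_const.
apply: cf_add; last exact/cf_snd/cf_id.
exact/(cf_comp Hg)/cf_fst/cf_id.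
Qed.

Lemma cf_eq0 A `{coded A} (f : A -> nat) : cf f -> cf (fun x => f x == 0).
Proof.
move=> [F cF Ff]; exists (fun o x => if F o x is node a b then tsnd (node leaf leaf)
   else node leaf leaf).
  by apply: (@tcomp_case (fun _ _ => node leaf leaf) (fun _ _ => leaf)) => //; tcomp.
by move=> o a; rewrite Ff; case: (f a).
Qed.

Lemma cf_leq A `{coded A} (f g : A -> nat) : cf f -> cf g -> cf (fun x => f x <= g x).
Proof. by move=> Hf Hg; exact/cf_eq0/cf_sub. Qed.

Lemma cf_andb A `{coded A} (f g : A -> bool) : cf f -> cf g -> cf (fun x => f x && g x).
Proof.
move=> Hf Hg; apply: (@cf_ext _ _ _ _ (fun x => if f x then g x else false)) => //.
by apply: cf_if => //; exact: cf_const.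
Qed.

Lemma cf_orb A `{coded A} (f g : A -> bool) : cf f -> cf g -> cf (fun x => f x || g x).
Proof.
move=> Hf Hg; apply: (@cf_ext _ _ _ _ (fun x => if f x then true else g x)) => //.
by apply: cf_if => //; exact: cf_const.
Qed.

Lemma cf_negb A `{coded A} (f : A -> bool) : cf f -> cf (fun x => ~~ f x).
Proof.
move=> Hf; apply: (@cf_ext _ _ _ _ (fun x => if f x then false else true)) => //.
by apply: cf_if => //; exact: cf_const.
Qed.

Lemma cf_eqn A `{coded A} (f g : A -> nat) : cf f -> cf g -> cf (fun x => f x == g x).
Proof.
move=> Hf Hg; apply: (@cf_ext _ _ _ _ (fun x => (f x <= g x) && (g x <= f x))).
  by move=> x; rewrite eqn_leq.
by apply: cf_andb; exact: cf_leq.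
Qed.

Lemma cf_map A B C `{coded A} `{coded B} `{coded C} (s : A -> B -> C) (l : A -> seq B) :
  cf (fun x : A * B => s x.1 x.2) -> cf l -> cf (fun x => map (s x) (l x)).
Proof.
move=> Hs Hl; apply: (@cf_ext _ _ _ _ (fun x => foldr (fun b r => s x b :: r) [::] (l x))).
  by [].
apply: (cf_foldr (s := fun x b r => s x b :: r)) => //; last exact: cf_const.
apply: cf_cons; last exact/cf_snd/cf_snd/cf_id.
apply: (cf_comp2 Hs); first exact/cf_fst/cf_id.
exact/cf_fst/cf_snd/cf_id.
Qed.

Lemma cf_cat A B `{coded A} `{coded B} (f g : A -> seq B) :
  cf f -> cf g -> cf (fun x => f x ++ g x).
Proof.
move=> Hf Hg; apply: (@cf_ext _ _ _ _ (fun x => foldr (fun b r => b :: r) (g x) (f x))).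
  by move=> x; elim: (f x) => //= ? ? ->.
apply: (cf_foldr (s := fun _ b r => b :: r)) => //.
by apply: cf_cons; [exact/cf_fst/cf_snd/cf_id | exact/cf_snd/cf_snd/cf_id].
Qed.

Lemma cf_flatten A B `{coded A} `{coded B} (f : A -> seq (seq B)) :
  cf f -> cf (fun x => flatten (f x)).
Proof.
move=> Hf; apply: (cf_foldr (s := fun _ b r => b ++ r)) => //; last exact: cf_const.
by apply: cf_cat; [exact/cf_fst/cf_snd/cf_id | exact/cf_snd/cf_snd/cf_id].
Qed.

Lemma cf_size A B `{coded A} `{coded B} (f : A -> seq B) : cf f -> cf (fun x => size (f x)).
Proof.
move=> Hf; apply: (@cf_ext _ _ _ _ (fun x => foldr (fun b r => r.+1) 0 (f x))).
  by move=> x; elim: (f x) => //= ? ? ->.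
apply: (cf_foldr (s := fun _ b r => r.+1)) => //; last exact: cf_const.
exact/cf_succ/cf_snd/cf_snd/cf_id.
Qed.

Lemma cf_iota A `{coded A} (f g : A -> nat) : cf f -> cf g -> cf (fun x => iota (f x) (g x)).
Proof.
move=> Hf Hg; apply: (@cf_ext _ _ _ _
  (fun x => iteri (g x) (fun k r => r ++ [:: f x + k]) [::])).
  by move=> x; elim: (g x) => // k /= ->; rewrite -[RHS]/(iota (f x) k.+1) -[in RHS]addn1 iotaD.
apply: (cf_iteri (s := fun x k r => r ++ [:: f x + k])) => //; last exact: cf_const.
apply: cf_cat; first exact/cf_snd/cf_snd/cf_id.
apply: cf_cons; last exact: cf_const.
by apply: cf_add; [exact/(cf_comp Hf)/cf_fst/cf_id | exact/cf_fst/cf_snd/cf_id].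
Qed.

Lemma cf_behead A B `{coded A} `{coded B} (f : A -> seq B) : cf f -> cf (fun x => behead (f x)).
Proof.
move=> [F cF Ff]; exists (fun o x => tsnd (F o x)); first exact: tcomp_snd_of.
by move=> o a; rewrite Ff; case: (f a).
Qed.

Lemma cf_nth0 A `{coded A} (f : A -> seq nat) (g : A -> nat) :
  cf f -> cf g -> cf (fun x => nth 0 (f x) (g x)).
Proof.
move=> Hf Hg; apply: (@cf_ext _ _ _ _ (fun x => head 0 (iter (g x) behead (f x)))).
  move=> x; elim: (g x) (f x) => [|i IHi] s; first by case: s.
  by rewrite iterSr IHi nth_behead.
have [F cF Ff] : cf (fun x => iter (g x) behead (f x)).
  by apply: (cf_iter (s := fun _ => behead)) => //; apply/cf_behead/cf_snd/cf_id.
exists (fun o x => tfst (F o x)); first exact: tcomp_fst_of.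
by move=> o a; rewrite Ff; case: (iter _ _ _).
Qed.

Lemma cf_expn A `{coded A} (f g : A -> nat) : cf f -> cf g -> cf (fun x => f x ^ g x).
Proof.
move=> Hf Hg; apply: (@cf_ext _ _ _ _ (fun x => iter (g x) (muln (f x)) 1)).
  by move=> x; elim: (g x) => //= k ->; rewrite expnS.
apply: (cf_iter (s := fun x => muln (f x))) => //; last exact: cf_const.
apply: cf_mul; last exact/cf_snd/cf_id.
exact/(cf_comp Hf)/cf_fst/cf_id.
Qed.

Ltac cf_step :=
  match goal with
  | H : ?G |- ?G => exact H
  | |- cf tfst => apply: (cf_tfst (f := fun x => x))
  | |- cf tsnd => apply: (cf_tsnd (f := fun x => x))
  | |- cf (fun x => x) => exact: cf_id
  | |- cf (fun _ => ?b) => exact: cf_const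
  | |- cf (fun x => (@?f x, @?g x)) => apply: (cf_pair (f := f) (g := g))
  | |- cf (fun x => (@?f x).1) => apply: (cf_fst (f := f))
  | |- cf (fun x => (@?f x).2) => apply: (cf_snd (f := f))
  | |- cf (fun x => (@?f x).+1) => apply: (cf_succ (f := f))
  | |- cf (fun x => (@?f x).-1) => apply: (cf_pred (f := f))
  | |- cf (fun x => @?f x + @?g x) => apply: (cf_add (f := f) (g := g))
  | |- cf (fun x => @?f x - @?g x) => apply: (cf_sub (f := f) (g := g))
  | |- cf (fun x => @?f x * @?g x) => apply: (cf_mul (f := f) (g := g))
  | |- cf (fun x => @?f x ^ @?g x) => apply: (cf_expn (f := f) (g := g))
  | |- cf (fun x => @?f x == @?g x) => apply: (cf_eqn (f := f) (g := g))
  | |- cf (fun x => @?f x <= @?g x) => apply: (cf_leq (f := f) (g := g))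
  | |- cf (fun x => @?f x && @?g x) => apply: (cf_andb (f := f) (g := g))
  | |- cf (fun x => @?f x || @?g x) => apply: (cf_orb (f := f) (g := g))
  | |- cf (fun x => ~~ @?f x) => apply: (cf_negb (f := f))
  | |- cf (fun x => if _ then _ else _) => apply: cf_if
  | |- cf (fun x => @?f x :: @?g x) => apply: (cf_cons (f := f) (g := g))
  | |- cf (fun x => @?f x ++ @?g x) => apply: (cf_cat (f := f) (g := g))
  | |- cf (fun x => flatten (@?f x)) => apply: (cf_flatten (f := f))
  | |- cf (fun x => size (@?f x)) => apply: (cf_size (f := f))
  | |- cf (fun x => behead (@?f x)) => apply: (cf_behead (f := f))
  | |- cf (fun x => nth 0 (@?f x) (@?g x)) => apply: (cf_nth0 (f := f) (g := g))
  | |- cf (fun x => iota (@?f x) (@?g x)) => apply: (cf_iota (f := f) (g := g))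
  | |- cf (fun x => map (@?s x) (@?l x)) => apply: (cf_map (s := s) (l := l))
  | |- cf (fun x => foldr (@?s x) (@?b x) (@?l x)) =>
      apply: (cf_foldr (s := s) (b := b) (l := l))
  | |- cf (fun x => iteri (@?n x) (@?s x) (@?b x)) =>
      apply: (cf_iteri (s := s) (b := b) (n := n))
  | |- cf (fun x => iter (@?n x) (@?s x) (@?b x)) =>
      apply: (cf_iter (s := s) (b := b) (n := n))
  | |- cf (fun x => node (@?f x) (@?g x)) => apply: (cf_node (f := f) (g := g))
  | |- cf (fun x => tfst (@?f x)) => apply: (cf_tfst (f := f))
  | |- cf (fun x => tsnd (@?f x)) => apply: (cf_tsnd (f := f))
  | |- cf (fun x => unnum (@?f x)) => apply: (cf_unnum (f := f))
  | |- cf (fun x => unseq (@?f x)) => apply: (cf_unseq (f := f))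
  | |- cf (fun x => num (@?f x)) => apply: (cf_num (f := f))
  | |- cf (fun x => code (@?f x)) => apply: (cf_code (f := f))
  end.
Ltac cf := repeat (cf_step; cbv beta).

(** Working on bare trees avoids types that depend on the numbers of the instance. A finite output
    has the zero oracle, which [pLeaf] answers. *)
Lemma computable_cf X Y `{coded X} `{coded Y} (f : X -> Y) (g : tree -> tree) :
  cf g -> (forall x, g (code x) = code (f x)) -> computable f.
Proof.
move=> [G [p Hp] Gg] gf; exists p, pLeaf => x; split; last by move=> i; constructor.
have E : G (oracle x) (code x) = code (f x) by rewrite -gf; exact: Gg.
by rewrite /= -E; exact: Hp.
Qed.

(** * Composition of reductions *)

(** A while loop tests the first component of its state; swapping moves the parameter behind that
    flag and back. *)
Definition pSwap := pPair (pComp pFst pSnd) (pPair pFst (pComp pSnd pSnd)).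

(* Runs [p] with the answers of the oracle computed by [q]; the first component
   of the input is a parameter that is kept for [q]. *)
Fixpoint subst_oracle (q p : prog) : prog :=
  match p with
  | pId => pSnd
  | pLeaf => pLeaf
  | pFst => pComp pFst pSnd
  | pSnd => pComp pSnd pSnd
  | pPair a b => pPair (subst_oracle q a) (subst_oracle q b)
  | pComp a b => pComp (subst_oracle q a) (pPair pFst (subst_oracle q b))
  | pRec a b =>
      pComp (pRec (subst_oracle q a)
               (pComp (subst_oracle q b)
                  (pPair (pComp pFst pFst) (pPair (pComp pSnd pFst) pSnd))))
        (pPair (pPair pFst (pComp pFst pSnd)) (pComp pSnd pSnd))
  | pWhile a =>
      pComp (pComp pSnd pSwap)
        (pComp (pWhile (pComp pSwap (pPair (pComp pFst pSnd) (pComp (subst_oracle q a) pSwap))))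
           pSwap)
  | pAsk => q
  end.

Lemma eval_swap o a b c : eval o pSwap (node a (node b c)) (node b (node a c)).
Proof. by repeat econstructor. Qed.

Lemma eval_while_node o p x z : eval o (pWhile p) x z -> exists a b, x = node a b.
Proof. by move=> H; inversion H; subst; eauto. Qed.

Lemma eval_subst_oracle o o' q d p x y :
  (forall i, eval o q (node d (num i)) (num (o' i))) ->
  eval o' p x y -> eval o (subst_oracle q p) (node d x) y.
Proof.
move=> Hq; elim=> {p x y} /=.
- by move=> x; constructor.
- by move=> x; constructor.
- by move=> a b; repeat econstructor.
- by move=> a b; repeat econstructor.
- by move=> *; constructor.
- move=> p r x y z _ IHr _ IHp.
  by apply: eval_comp IHp; constructor=> //; constructor.
- move=> p r x y _ IHp; apply: (@eval_comp _ _ _ _ (node (node d x) leaf)).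
    by repeat econstructor.
  by constructor.
- move=> p r x a b u v y _ IHu _ IHv _ IHr.
  apply: (@eval_comp _ _ _ _ (node (node d x) (node a b))); first by repeat econstructor.
  (* The induction hypotheses run the translation including its rearranging prefix. Inversion and
     determinism of [eval] strip the prefix and leave runs of the inner recursion. *)
  inversion IHu as [| | | | |? ? ? ? ? Hu1 Hu2| | | | |]; subst.
  inversion IHv as [| | | | |? ? ? ? ? Hv1 Hv2| | | | |]; subst.
  have Hin t : eval o (pPair (pPair pFst (pComp pFst pSnd)) (pComp pSnd pSnd))
      (node d (node x t)) (node (node d x) t) by repeat econstructor.
  rewrite (eval_det Hu1 (Hin a)) in Hu2; rewrite (eval_det Hv1 (Hin b)) in Hv2.
  apply: eval_rec_node Hu2 Hv2 _.
  by apply: eval_comp IHr; repeat econstructor.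
- move=> p x; apply: (@eval_comp _ _ _ _ (node leaf (node d x))).
    by apply: eval_comp (eval_swap _ _ _ _) _; constructor.
  by apply: eval_comp (eval_swap _ _ _ _) _; constructor.
- move=> p a b x y z _ IHp Hw IHw.
  have [c [e def_y]] := eval_while_node Hw; subst y.
  inversion IHw as [| | | | |? ? ? s ? Hs Hout| | | | |]; subst.
  inversion Hs as [| | | | |? ? ? ? ? Hsw Hwh| | | | |]; subst.
  rewrite (eval_det Hsw (eval_swap _ _ _ _)) in Hwh.
  apply: eval_comp Hout; apply: eval_comp (eval_swap _ _ _ _) _.
  apply: eval_while_step Hwh.
  apply: (@eval_comp _ _ _ _ (node d (node c e))); last exact: eval_swap.
  constructor; first by repeat econstructor.
  by apply: eval_comp IHp; exact: eval_swap.
- by [].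
Qed.

Lemma computable_comp X Y Z `{presented X} `{presented Y} `{presented Z}
    (g : Y -> Z) (f : X -> Y) : computable f -> computable g -> computable (fun x => g (f x)).
Proof.
move=> [pf [qf Hf]] [pg [qg Hg]].
exists (pComp (subst_oracle qf pg) (pPair pId pf)).
exists (pComp (subst_oracle qf qg) (pPair pFst (pPair (pComp pf pFst) pSnd))).
move=> x; have [Hpf Hqf] := Hf x; have [Hpg Hqg] := Hg (f x); split.
  apply: eval_comp (eval_subst_oracle Hqf Hpg).
  by constructor=> //; constructor.
move=> i; apply: eval_comp (eval_subst_oracle Hqf (Hqg i)).
by repeat econstructor.
Qed.

Lemma reduces_trans X Y Z `{presented X} `{presented Y} `{presented Z}
    (P : X -> Prop) (Q : Y -> Prop) (R : Z -> Prop) : P ⪯ Q -> Q ⪯ R -> P ⪯ R.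
Proof.
move=> [f [cf_f Hf]] [g [cf_g Hg]]; exists (fun x => g (f x)).
split=> [|x]; first exact: computable_comp.
by split=> [/Hf/Hg|/Hg/Hf].
Qed.

Lemma reduces_decider X Y `{presented X} `{presented Y} (P : X -> Prop) (Q : Y -> Prop) :
  P ⪯ Q -> has_decider Q -> has_decider P.
Proof.
move=> [f [cf_f Hf]] [d [cf_d Hd]]; exists (fun x => d (f x)).
split=> [|x]; first exact: computable_comp.
by split=> [/Hf/Hd|/Hd/Hf].
Qed.

(** * Pell equations *)

Section Pell.
Import GRing.Theory Num.Theory Order.TTheory.
Local Open Scope ring_scope.

(** The pair [(x, y)] with [(a + sqrt d)^n = x + y sqrt d] for [d = a^2 - 1]. *)
Fixpoint pell (a : int) (n : nat) : int * int :=
  if n is m.+1 then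
    let: (x, y) := pell a m in (a * x + (a ^+ 2 - 1) * y, x + a * y)
  else (1, 0).

Definition pX a n := (pell a n).1.
Definition pY a n := (pell a n).2.

Lemma pX0 a : pX a 0 = 1. Proof. by []. Qed.
Lemma pY0 a : pY a 0 = 0. Proof. by []. Qed.
Lemma pXS a n : pX a n.+1 = a * pX a n + (a ^+ 2 - 1) * pY a n.
Proof. by rewrite /pX /pY /=; case: (pell a n). Qed.
Lemma pYS a n : pY a n.+1 = pX a n + a * pY a n.
Proof. by rewrite /pX /pY /=; case: (pell a n). Qed.

Lemma pell_norm a n : pX a n ^+ 2 - (a ^+ 2 - 1) * pY a n ^+ 2 = 1.
Proof.
elim: n => [|n IHn]; first by rewrite pX0 pY0; ring.
by rewrite -[RHS]IHn pXS pYS; ring.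
Qed.

Lemma pellD a m n :
  pX a (m + n) = pX a m * pX a n + (a ^+ 2 - 1) * (pY a m * pY a n) /\
  pY a (m + n) = pX a m * pY a n + pY a m * pX a n.
Proof.
elim: m => [|m [IHx IHy]]; first by rewrite add0n pX0 pY0; split; ring.
by rewrite addSn !(pXS, pYS) IHx IHy; split; ring.
Qed.

Lemma pXD a m n :
  pX a (m + n) = pX a m * pX a n + (a ^+ 2 - 1) * (pY a m * pY a n).
Proof. by case: (pellD a m n). Qed.

Lemma pYD a m n : pY a (m + n) = pX a m * pY a n + pY a m * pX a n.
Proof. by case: (pellD a m n). Qed.

Section Growth.
Variable a : int.
Hypothesis a_gt1 : 1 < a.

Lemma pell_bounds n : [/\ 1 <= pX a n, 0 <= pY a n & pY a n <= pX a n].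
Proof.
elim: n => [|n [x1 y0 yx]]; first by rewrite pX0 pY0.
rewrite pXS pYS; split; nia.
Qed.

Lemma pX_ge1 n : 1 <= pX a n. Proof. by case: (pell_bounds n). Qed.
Lemma pY_ge0 n : 0 <= pY a n. Proof. by case: (pell_bounds n). Qed.

Lemma pY_ltS n : pY a n < pY a n.+1.
Proof. by case: (pell_bounds n) => x1 y0 yx; rewrite pYS; nia. Qed.

Lemma pX_dblS n : 2 * pX a n <= pX a n.+1.
Proof. by case: (pell_bounds n) => x1 y0 yx; rewrite pXS; nia. Qed.

Lemma pX_ltS n : pX a n < pX a n.+1.
Proof. by case: (pell_bounds n) => x1 y0 yx; have := pX_dblS n; lia. Qed.

Lemma pY_lt m n : (m < n)%N -> pY a m < pY a n.
Proof.
elim: n => // n IHn; rewrite ltnS leq_eqVlt => /predU1P[->|/IHn lt_mn].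
  exact: pY_ltS.
exact: lt_trans lt_mn (pY_ltS n).
Qed.

Lemma pX_lt m n : (m < n)%N -> pX a m < pX a n.
Proof.
elim: n => // n IHn; rewrite ltnS leq_eqVlt => /predU1P[->|/IHn lt_mn].
  exact: pX_ltS.
exact: lt_trans lt_mn (pX_ltS n).
Qed.

Lemma pY_ge n : n%:Z <= pY a n.
Proof. by elim: n => // n IHn; have := pY_ltS n; lia. Qed.

(** Descent: a solution with [y > 0] is multiplied by [a - sqrt d]. The three inequalities say that
    [y] drops and that both new coordinates are still nonnegative. *)
Lemma pell_complete (x y : nat) :
  x%:Z ^+ 2 - (a ^+ 2 - 1) * y%:Z ^+ 2 = 1 -> exists n, x%:Z = pX a n /\ y%:Z = pY a n.
Proof.
elim/ltn_ind: y x => y IHy x E.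
have [y0|y_gt0] := posnP y.
  by exists 0%N; rewrite pX0 pY0; subst y; split=> //; nia.
have h1 : (a - 1) * y%:Z < x%:Z by nia.
have h2 : x%:Z <= a * y%:Z by nia.
have h3 : (a ^+ 2 - 1) * y%:Z <= a * x%:Z by nia.
have [x' def_x'] : exists x' : nat, x'%:Z = a * x%:Z - (a ^+ 2 - 1) * y%:Z.
  by exists (absz (a * x%:Z - (a ^+ 2 - 1) * y%:Z)%R); lia.
have [y' def_y'] : exists y' : nat, y'%:Z = a * y%:Z - x%:Z.
  by exists (absz (a * y%:Z - x%:Z)%R); lia.
have [|| n [Ex Ey]] := IHy y' _ x'.
- lia.
- by rewrite -[RHS]E def_x' def_y'; ring.
exists n.+1; rewrite pXS pYS -Ex -Ey def_x' def_y'; split; ring.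
Qed.
End Growth.

(** Both sequences are polynomials in [a] with integer coefficients. *)
Lemma pell_congr a b n : (a - b %| pX a n - pX b n)%Z /\ (a - b %| pY a n - pY b n)%Z.
Proof.
elim: n => [|n [/dvdzP[u Eu] /dvdzP[v Ev]]]; first by rewrite !pX0 !pY0 !subrr dvdz0.
have {}Eu : pX a n = pX b n + u * (a - b) by rewrite -Eu; ring.
have {}Ev : pY a n = pY b n + v * (a - b) by rewrite -Ev; ring.
rewrite !pXS !pYS Eu Ev; split; apply/dvdzP.
  exists (pX b n + a * u + (a + b) * pY b n + (a ^+ 2 - 1) * v); ring.
exists (u + a * v + pY b n); ring.
Qed.

(** The case [b = 1] of the previous congruence, where the recursion degenerates to [(1, n)]. *)
Lemma pY_mod a n : (a - 1 %| pY a n - n%:Z)%Z.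
Proof.
suff [x1 yn] : (a - 1 %| pX a n - 1)%Z /\ (a - 1 %| pY a n - n%:Z)%Z by [].
elim: n => [|n [/dvdzP[u Eu] /dvdzP[v Ev]]]; first by rewrite pX0 pY0 !subrr dvdz0.
have {}Eu : pX a n = 1 + u * (a - 1) by rewrite -Eu; ring.
have {}Ev : pY a n = n%:Z + v * (a - 1) by rewrite -Ev; ring.
rewrite !pXS !pYS Eu Ev intS; split; apply/dvdzP.
  exists (1 + a * u + (a + 1) * (n%:Z + v * (a - 1))); ring.
exists (u + n%:Z + a * v); ring.
Qed.

Lemma pell_coprime a n : coprimez (pX a n) (pY a n).
Proof.
apply/coprimezP; exists (pX a n, - (a ^+ 2 - 1) * pY a n) => /=.
by rewrite -[RHS](pell_norm a n); ring.
Qed.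

(** The binomial expansion of [(X + Y sqrt d)^q] modulo [Y] and [Y^2] respectively. The extra factor
    [pX a i] avoids the exponent [q - 1] and is harmless, being coprime to [pY a i]. *)
Lemma pell_mul_mod a i q : exists u v,
  pX a (i * q) = pX a i ^+ q + u * pY a i /\
  pY a (i * q) * pX a i = q%:Z * pX a i ^+ q * pY a i + v * pY a i ^+ 2.
Proof.
elim: q => [|q [u [v [Ex Ey]]]].
  by exists 0, 0; rewrite muln0 pX0 pY0 expr0; split; ring.
exists (u * pX a i + (a ^+ 2 - 1) * pY a (i * q)), ((u + v) * pX a i).
rewrite mulnS addnC pXD pYD; split; first by rewrite Ex (exprSr _ q); ring.
rewrite mulrDl Ey Ex (exprSr _ q) intS; ring.
Qed.

Lemma pY_dvdl a i q : (pY a i %| pY a (i * q))%Z.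
Proof.
have [u [v [_ E]]] := pell_mul_mod a i q.
rewrite -(@Gauss_dvdzl _ _ (pX a i)); last by rewrite coprimez_sym pell_coprime.
by rewrite E; apply/dvdzP; exists (q%:Z * pX a i ^+ q + v * pY a i); ring.
Qed.

Lemma pY_sqr_dvd a i : (pY a i ^+ 2 %| pY a (i * absz (pY a i)))%Z.
Proof.
have [u [v [_ E]]] := pell_mul_mod a i (absz (pY a i)).
rewrite -(@Gauss_dvdzl _ _ (pX a i)); last first.
  by rewrite coprimez_sym coprimezXr // pell_coprime.
rewrite E; apply/dvdzP; rewrite abszE.
have [s ->] : exists s, `|pY a i| = s * pY a i by exists (sgz (pY a i)); rewrite -normrEsg.
by exists (s * pX a i ^+ absz (pY a i) + v); ring.
Qed.

Lemma pY_dvd_index a i n : 1 < a -> (pY a i %| pY a n)%Z -> (i %| n)%N.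
Proof.
move=> a1 dvd_in; have [i0|i_gt0] := posnP i.
  subst i; rewrite pY0 dvd0z in dvd_in; rewrite dvd0n.
  by have := pY_ge a1 n; lia.
have lt_r := ltn_pmod n i_gt0.
have D : (pY a i %| pY a (n %% i))%Z.
  move: dvd_in; rewrite {1}(divn_eq n i) mulnC pYD.
  rewrite rpredDr; last by apply: dvdz_mulr; exact: pY_dvdl.
  rewrite Gauss_dvdzr // coprimez_sym.
  apply: coprimez_dvdr (pell_coprime a (i * (n %/ i))); exact: pY_dvdl.
have [r0|r_gt0] := posnP (n %% i); first by rewrite /dvdn r0.
have Yr_gt0 : 0 < pY a (n %% i) by apply: lt_le_trans (pY_ge a1 _); rewrite ltz_nat.
have := pY_lt a1 lt_r; move: Yr_gt0; move/dvdzP: D => [k ->].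
by have := pY_ge0 a1 i; move: (pY a i) => y; case: (lerP k 0) => ?; nia.
Qed.

(** First [i] divides [n], say [n = i q]. Modulo [Y^2] only the linear term [q X^q Y] of the
    expansion survives, so [Y] divides [q]. *)
Lemma pY_sqr_dvd_index a i n : 1 < a -> (pY a i ^+ 2 %| pY a n)%Z -> (pY a i %| n%:Z)%Z.
Proof.
move=> a1 D; have [i0|i_gt0] := posnP i.
  move: D; rewrite i0 pY0 expr2 mul0r !dvd0z => /eqP n0.
  by have := pY_ge a1 n; rewrite n0; case: (n).
have/dvdnP[q def_n] : (i %| n)%N.
  by apply: pY_dvd_index a1 _; apply: dvdz_trans D; rewrite expr2 dvdz_mulr.
move: D; rewrite def_n mulnC; have [u [v [_ E]]] := pell_mul_mod a i q.
move=> /(dvdz_mulr (pX a i)); rewrite E.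
rewrite rpredDr; last by apply: dvdz_mull.
rewrite (expr2 (pY a i)) dvdz_mul2r => [D|].
  rewrite PoszM; apply: dvdz_mull; rewrite -(@Gauss_dvdzl _ _ (pX a i ^+ q)) //.
  by rewrite coprimez_sym coprimezXl // pell_coprime.
by have := pY_ge a1 i; lia.
Qed.

Lemma pX_sum a k e : pX a (k + e + e) + pX a k = 2 * pX a (k + e) * pX a e.
Proof.
have E : pX a k = (pX a e ^+ 2 - (a ^+ 2 - 1) * pY a e ^+ 2) * pX a k.
  by rewrite pell_norm mul1r.
by rewrite (pXD a (k + e) e) pXD pYD {3}E; ring.
Qed.

(** By [pX_sum], modulo [pX a n] the values at [2n + k] and [2n - k] are both the negative of the
    value at [k]. Every index thus folds into [[0, n]] at the cost of signs. *)
Lemma pX_reduce a n j : (0 < n)%N -> exists i, [/\ (i <= n)%N,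
  (pX a n %| pX a j - pX a i)%Z \/ (pX a n %| pX a j + pX a i)%Z &
  (2 * n%:Z %| j%:Z - i%:Z)%Z \/ (2 * n%:Z %| j%:Z + i%:Z)%Z].
Proof.
move=> n_gt0; elim/ltn_ind: j => j IHj.
have [le_jn|lt_nj] := leqP j n.
  by exists j; rewrite !subrr !dvdz0; split=> //; left.
have [k [lt_kj Xk Dk]] : exists k, [/\ (k < j)%N, (pX a n %| pX a j + pX a k)%Z &
   (2 * n%:Z %| j%:Z - k%:Z)%Z \/ (2 * n%:Z %| j%:Z + k%:Z)%Z].
  have [le_j2n|lt_2nj] := leqP j (n + n).
    have [k [e [Ej En]]] : exists k e, j = (k + e + e)%N /\ n = (k + e)%N.
      by exists (n + n - j)%N, (j - n)%N; lia.
    exists k; split; first lia.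
      by rewrite Ej pX_sum -En mulrAC dvdz_mull.
    by right; have -> : j%:Z + k%:Z = 2 * n%:Z by lia.
  have [k Ej] : exists k, j = (k + n + n)%N by exists (j - (n + n))%N; lia.
  exists k; split; first lia.
    by rewrite Ej pX_sum dvdz_mull.
  by left; have -> : j%:Z - k%:Z = 2 * n%:Z by lia.
have [i [le_in Xi Di]] := IHj k lt_kj; exists i; split=> //.
  case: Xi => Xi; [right|left].
    by rewrite (_ : _ + _ = (pX a j + pX a k) - (pX a k - pX a i)); [exact: rpredB | ring].
  by rewrite (_ : _ - _ = (pX a j + pX a k) - (pX a k + pX a i)); [exact: rpredB | ring].
case: Dk => Dk; case: Di => Di.
- left; rewrite (_ : _ - _ = (j%:Z - k%:Z) + (k%:Z - i%:Z)); [exact: rpredD | ring].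
- right; rewrite (_ : _ + _ = (j%:Z - k%:Z) + (k%:Z + i%:Z)); [exact: rpredD | ring].
- right; rewrite (_ : _ + _ = (j%:Z + k%:Z) - (k%:Z - i%:Z)); [exact: rpredB | ring].
- left; rewrite (_ : _ - _ = (j%:Z + k%:Z) - (k%:Z + i%:Z)); [exact: rpredB | ring].
Qed.

(** Two values at indices below [n] thereby add up to less than [pX a n]. For [a = 2] this fails at
    once: the values at 0 sum to the value at 1. *)
Lemma pX_ge3 a i n : 2 < a -> (i < n)%N -> 3 * pX a i <= pX a n.
Proof.
move=> a2; have a1 : 1 < a by lia.
case: n => // n le_in.
have le_i : pX a i <= pX a n.
  move: le_in; rewrite ltnS leq_eqVlt => /predU1P[->//|/(pX_lt a1)/ltW //].
apply: le_trans (_ : 3 * pX a n <= _); first lia.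
by rewrite pXS; have := pX_ge1 a1 n; have := pY_ge0 a1 n; nia.
Qed.

Lemma dvdz_small (m x : int) : (m %| x)%Z -> - m < x -> x < m -> x = 0.
Proof.
move/dvdzP=> [k ->] h1 h2; have m_gt0 : 0 < m by lia.
case: (ltrgtP k 0) => [k_lt0|k_gt0|->]; [nia | nia | by rewrite mul0r].
Qed.

(** Fold [j] to some [k <= n]. Then the difference or the sum of the values at [i] and [k] is a
    multiple of [pX a n], and both are too small for that unless [i = k]. *)
Lemma pX_cong_index a n i j : 2 < a -> (0 < n)%N -> (i <= n)%N ->
  (pX a n %| pX a j - pX a i)%Z ->
  (2 * n%:Z %| j%:Z - i%:Z)%Z \/ (2 * n%:Z %| j%:Z + i%:Z)%Z.
Proof.
move=> a2 n_gt0 le_in Xij; have a1 : 1 < a by lia.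
have [k [le_kn Xk Dk]] := pX_reduce a j n_gt0.
suff Eik : i = k by rewrite Eik.
have Xle m : (m <= n)%N -> m = n \/ 3 * pX a m <= pX a n.
  by rewrite leq_eqVlt => /predU1P[->|/(pX_ge3 a2)]; [left | right].
have Xinj : pX a i = pX a k -> i = k.
  by move=> E; case: (ltngtP i k) => // /(pX_lt a1); rewrite E ltxx.
have Xi1 := pX_ge1 a1 i; have Xk1 := pX_ge1 a1 k; have Xn1 := pX_ge1 a1 n.
have Xi_le : pX a i <= pX a n.
  by case: (Xle i le_in) => [->//|]; move: Xi1; clear; move: (pX a i) (pX a n) => ? ?; lia.
have Xk_le : pX a k <= pX a n.
  by case: (Xle k le_kn) => [->//|]; move: Xk1; clear; move: (pX a k) (pX a n) => ? ?; lia.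
case: Xk => Xk.
  have D : (pX a n %| pX a i - pX a k)%Z.
    rewrite (_ : _ - _ = (pX a j - pX a k) - (pX a j - pX a i)); [exact: rpredB | ring].
  by apply: Xinj; apply/eqP; rewrite -subr_eq0; apply/eqP; apply: dvdz_small D _ _; lia.
have D : (pX a n %| pX a i + pX a k)%Z.
  rewrite (_ : _ + _ = (pX a j + pX a k) - (pX a j - pX a i)); [exact: rpredB | ring].
case: (Xle i le_in) => [Ei|Li]; case: (Xle k le_kn) => [Ek|Lk].
- by rewrite Ei Ek.
- have {}D : (pX a n %| pX a k)%Z.
    by have := rpredB D (dvdzz (pX a n)); rewrite Ei addrAC subrr add0r.
  by have := dvdz_small D; move: Xi1 Xk1 Lk; clear; move: (pX a i) (pX a k) (pX a n) => ? ? ?; lia.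
- have {}D : (pX a n %| pX a i)%Z.
    by have := rpredB D (dvdzz (pX a n)); rewrite Ek addrK.
  by have := dvdz_small D; move: Xi1 Xk1 Li; clear; move: (pX a i) (pX a k) (pX a n) => ? ? ?; lia.
- have := dvdz_small D; move: Xi1 Xk1 Li Lk; clear; move: (pX a i) (pX a k) (pX a n) => ? ? ?; lia.
Qed.

Lemma modn_dvdz (a b m : nat) : a = b %[mod m] <-> (m%:Z %| a%:Z - b%:Z)%Z.
Proof.
rewrite -eqz_mod_dvd !modz_nat; split=> [->|/eqP] //.
by case.
Qed.

Lemma dvdn_dvdz (d m : nat) : (d %| m)%N = (d%:Z %| m%:Z)%Z.
Proof. by []. Qed.

Definition pell_eq (a x y : nat) := (x * x + y * y = a * a * (y * y) + 1)%N.

Lemma pell_eqP (a x y : nat) : (1 < a)%N ->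
  pell_eq a x y <-> exists n, x%:Z = pX a n /\ y%:Z = pY a n.
Proof.
move=> a1; split=> [E|[n [Ex Ey]]].
  by apply: pell_complete; [lia | rewrite /pell_eq in E; lia].
have := pell_norm a n; rewrite -Ex -Ey /pell_eq; lia.
Qed.

Lemma pX_nat (a n : nat) : (1 < a)%N -> exists x : nat, x%:Z = pX a n.
Proof.
by move=> a1; exists (absz (pX a n)); have := @pX_ge1 a%:Z ltac:(lia) n; lia.
Qed.

Lemma pY_nat (a n : nat) : (1 < a)%N -> exists x : nat, x%:Z = pY a n.
Proof.
by move=> a1; exists (absz (pY a n)); have := @pY_ge0 a%:Z ltac:(lia) n; lia.
Qed.

(** The index [i] of the solution [(x, y)] is read off a second sequence. As [b] is 1 modulo
    [2 * y], [t] reveals its index [j] modulo [2 * y]. As [b] is [a] modulo [u = pX a n], the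
    congruence of [s] and [x] carries over to base [a] and gives [j = i] or [j = - i] modulo
    [2 * n], and [y * y %| v] forces [y] to divide [n]. So [k] is [i] or [- i] modulo [2 * y], where
    [0 < k <= y] and [i <= y] leave only [k = i]. *)
Theorem matiyasevich (a k x y : nat) : (2 < a)%N ->
  x%:Z = pX a k /\ y%:Z = pY a k <->
  [/\ k = 0, x = 1 & y = 0]%N \/ (0 < k <= y)%N /\ exists u v s t b : nat,
    [/\ pell_eq a x y, pell_eq a u v, pell_eq b s t, (2 < b)%N & (0 < v)%N] /\
    [/\ b = 1 %[mod 2 * y], b = a %[mod u], (y * y %| v)%N, s = x %[mod u] &
        t = k %[mod 2 * y]].
Proof.
move=> a2; have a1 : (1 < a)%N by lia.
have a1' : 1 < a%:Z by lia. have a2' : 2 < a%:Z by lia.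
split=> [[Ex Ey]|].
  have [k0|k_gt0] := posnP k.
    by left; subst k; rewrite pX0 in Ex; rewrite pY0 in Ey; split=> //; lia.
  right; have le_ky : (k <= y)%N by have := pY_ge a1' k; lia.
  split; first lia.
  (* The index is [2 * k * y]: the factor [y] yields [y * y %| v], and doubling makes [v] even, so
     that [u], being coprime to [v], is coprime to [2 * y], as the Chinese remainder theorem
     requires. *)
  have [u Eu] := pX_nat (k * y + k * y) a1; have [v Ev] := pY_nat (k * y + k * y) a1.
  have Ev2 : v%:Z = 2 * (pX a (k * y) * pY a (k * y)) by rewrite Ev pYD; ring.
  have D : ((y * y)%N%:Z %| pY a (k * y))%Z.
    by have := pY_sqr_dvd a k; rewrite -Ey expr2.
  have Dv : (y * y %| v)%N by rewrite dvdn_dvdz Ev2; do 2!apply: dvdz_mull.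
  have cuv : coprime u v by have := pell_coprime a (k * y + k * y); rewrite -Eu -Ev.
  have cu2y : coprime u (2 * y).
    rewrite coprimeMr; apply/andP; split.
      apply: coprime_dvdr cuv; rewrite dvdn_dvdz Ev2; exact: dvdz_mulr.
    by apply: coprime_dvdr cuv; apply: dvdn_trans Dv; exact: dvdn_mulr.
  have u_gt0 : (0 < u)%N by have := pX_ge1 a1' (k * y + k * y); lia.
  (* The added multiple of both moduli only ensures [2 < b]. *)
  pose b := (chinese u (2 * y) a 1 + u * (2 * y) * 3)%N.
  have b2 : (2 < b)%N by rewrite /b; nia.
  have b1 : (1 < b)%N by lia.
  have b_u : b = a %[mod u].
    by rewrite /b -mulnA -modnDmr modnMr addn0 chinese_modl.
  have b_y : b = 1 %[mod 2 * y].
    by rewrite /b -mulnA mulnCA -modnDmr modnMr addn0 chinese_modr.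
  have [s Es] := pX_nat k b1; have [t Et] := pY_nat k b1.
  exists u, v, s, t, b; split; split=> //; try by apply/pell_eqP; eauto.
  - rewrite lt0n; apply/eqP=> v0; have := pY_ge a1' (k * y + k * y).
    have : (0 < k * y)%N by rewrite muln_gt0 k_gt0; exact: leq_trans k_gt0 le_ky.
    by rewrite -Ev v0 lez_nat; case: (k * y)%N.
  - apply/modn_dvdz; rewrite Es Ex; have [D1 _] := pell_congr b a k.
    by apply: dvdz_trans D1; apply/modn_dvdz.
  - apply/modn_dvdz; rewrite Et; apply: dvdz_trans (pY_mod b k).
    by apply/modn_dvdz.
case=> [[-> -> ->]|]; first by rewrite pX0 pY0.
case=> /andP[k_gt0 le_ky] [u [v [s [t [b [[]]]]]]].
move=> /(pell_eqP _ _ a1)[i [Ex Ey]] /(pell_eqP _ _ a1)[n [Eu Ev]].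
move=> /[swap] b2; have b1 : (1 < b)%N by lia.
move=> /(pell_eqP _ _ b1)[j [Es Et]] v_gt0 [b_y b_u Dv s_x t_k].
suff -> : k = i by [].
have n_gt0 : (0 < n)%N by case: (n) Ev => //; rewrite pY0; lia.
have Dn : (y%:Z %| n%:Z)%Z by rewrite Ey; apply: pY_sqr_dvd_index a1' _; rewrite -Ey -Ev expr2.
have le_in : (i <= n)%N.
  rewrite leqNgt; apply/negP=> /(pY_lt a1'); rewrite -Ey -Ev .
  by rewrite ltz_nat ltnNge (leq_trans (leq_pmull y _) (dvdn_leq v_gt0 Dv)) // (leq_trans k_gt0).
have Dj : (2 * y%:Z %| 2 * n%:Z)%Z by rewrite dvdz_mul2l.
have D : (pX a n %| pX a j - pX a i)%Z.
  rewrite -Eu (_ : _ - _ = (pX b j - pX a i) - (pX b j - pX a j)); last ring.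
  apply: rpredB; first by rewrite -Es -Ex; apply/modn_dvdz.
  have [D1 _] := pell_congr b a j.
  by apply: dvdz_trans D1; apply/modn_dvdz.
have Dt : (2 * y%:Z %| k%:Z - j%:Z)%Z.
  rewrite (_ : _ - _ = (t%:Z - j%:Z) - (t%:Z - k%:Z)); last ring.
  apply: rpredB; last by apply/modn_dvdz.
  rewrite Et; apply: dvdz_trans (pY_mod b j); exact/modn_dvdz.
have le_iy : (i <= y)%N by rewrite -lez_nat Ey pY_ge.
case: (pX_cong_index a2' n_gt0 le_in D) => /(dvdz_trans Dj) Dji.
  have : (2 * y%:Z %| k%:Z - i%:Z)%Z.
    by rewrite (_ : _ - _ = (k%:Z - j%:Z) + (j%:Z - i%:Z)); [exact: rpredD | ring].
  by move/dvdz_small; move: le_ky k_gt0 le_iy; clear; lia.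
have : (2 * y%:Z %| k%:Z + i%:Z - 2 * y%:Z)%Z.
  rewrite rpredBr ?dvdzz //.
  by rewrite (_ : _ + _ = (k%:Z - j%:Z) + (j%:Z + i%:Z)); [exact: rpredD | ring].
by move/dvdz_small; move: le_ky k_gt0 le_iy; clear; lia.
Qed.

(** Modulo [2 a n - n^2 - 1] the number [n - a] is a square root of [a^2 - 1]; substituting it turns
    [(a + sqrt d)^k] into [n^k]. *)
Lemma pell_expn_mod (a n k : nat) :
  (2%:Z * a%:Z * n%:Z - n%:Z ^+ 2 - 1 %|
   pX a k - pY a k * (a%:Z - n%:Z) - n%:Z ^+ k)%Z.
Proof.
elim: k => [|k IHk]; first by rewrite pX0 pY0 expr0 mul0r subr0 subrr dvdz0.
have -> : pX a k.+1 - pY a k.+1 * (a%:Z - n%:Z) - n%:Z ^+ k.+1 =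
   n%:Z * (pX a k - pY a k * (a%:Z - n%:Z) - n%:Z ^+ k) +
   pY a k * (2%:Z * a%:Z * n%:Z - n%:Z ^+ 2 - 1).
  by rewrite pXS pYS (exprS _ k); ring.
by apply: rpredD; [exact: dvdz_mull | exact: dvdz_mull].
Qed.

Lemma pY_ge_expn (a k : nat) : (1 < a)%N -> (a ^ k)%N%:Z <= pY a k.+1.
Proof.
move=> a1; have a1' : 1 < a%:Z by lia.
have Xk : (a ^ k)%N%:Z <= pX a k.
  elim: k => // k IHk; rewrite expnS PoszM pXS.
  apply: le_trans (_ : a%:Z * pX a k <= _); first by rewrite ler_pM2l //; lia.
  by rewrite lerDl mulr_ge0 ?pY_ge0 // subr_ge0 exprn_ege1 // ltW.
by rewrite pYS; apply: le_trans Xk _; rewrite lerDl mulr_ge0 ?pY_ge0 //; lia.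
Qed.

(* For [A = z + n + 3], [X A k - (A - n) * Y A k] is congruent to [n ^ k] modulo
   [2 * A * n - n * n - 1], and [z] is large enough for [n ^ k] to be the residue. *)
Theorem expn_pell (n k m : nat) : (0 < n)%N ->
  m = (n ^ k)%N <-> exists z x y t : nat,
    [/\ z%:Z = pY (n + 3)%N k.+1, x%:Z = pX (z + n + 3)%N k /\ y%:Z = pY (z + n + 3)%N k,
        (t + (n * n + 1) = 2 * (z + n + 3) * n)%N, (m < t)%N &
        x = m + y * (z + 3) %[mod t]].
Proof.
move=> n_gt0; have n3 : (1 < n + 3)%N by lia.
have congr z x y t : z%:Z = pY (n + 3)%N k.+1 ->
    x%:Z = pX (z + n + 3)%N k -> y%:Z = pY (z + n + 3)%N k ->
    (t + (n * n + 1) = 2 * (z + n + 3) * n)%N ->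
    (n ^ k < t)%N /\ x = n ^ k + y * (z + 3) %[mod t].
  move=> Ez Ex Ey Et; split.
    have le_z : (n ^ k <= z)%N.
      rewrite -lez_nat Ez; apply: le_trans (pY_ge_expn k n3).
      by rewrite lez_nat; elim: (k) => // j IHj; rewrite !expnS leq_mul ?leq_addr.
    apply: leq_ltn_trans le_z _; move: Et n_gt0; clear; nia.
  apply/modn_dvdz; have := pell_expn_mod (z + n + 3) n k.
  rewrite -Ex -Ey.
  have -> : 2%:Z * (z + n + 3)%N%:Z * n%:Z - n%:Z ^+ 2 - 1 = t%:Z.
    move: Et; clear; lia.
  have -> : (z + n + 3)%N%:Z - n%:Z = (z + 3)%N%:Z by clear; lia.
  have ED u v w : (u + v * w)%N%:Z = u%:Z + v%:Z * w%:Z by rewrite PoszD PoszM.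
  have EX : (n ^ k)%N%:Z = n%:Z ^+ k by rewrite -natz natrX natz.
  by rewrite ED EX opprD addrA addrAC.
split=> [->|[z [x [y [t [Ez [Ex Ey] Et lt_mt E]]]]]].
  have [z Ez] := pY_nat k.+1 n3; have a1 : (1 < z + n + 3)%N by lia.
  have [x Ex] := pX_nat k a1; have [y Ey] := pY_nat k a1.
  have [t Et] : exists t, (t + (n * n + 1) = 2 * (z + n + 3) * n)%N.
    exists (2 * (z + n + 3) * n - (n * n + 1))%N; rewrite subnK //.
    by move: n_gt0; clear; nia.
  by have [lt_nt E] := congr z x y t Ez Ex Ey Et; exists z, x, y, t.
have [lt_nt] := congr z x y t Ez Ex Ey Et; rewrite E => /eqP.
by rewrite eqn_modDr !modn_small // => /eqP.
Qed.

End Pell.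

(** * From formulas to elementary constraints *)

Definition ren_constraint (r : nat -> nat) (c : constraint) : constraint :=
  match c with
  | CNat u n => CNat (r u) n
  | CVar u v => CVar (r u) (r v)
  | CPar u i => CPar (r u) i
  | CAdd u v w => CAdd (r u) (r v) (r w)
  | CMul u v w => CMul (r u) (r v) (r w)
  end.

(** Under a quantifier, parameter 0 becomes variable 1, the guessed witness. Variable 0 is reserved
    for the verdict, whence the shift by 2. *)
Definition bind_constraint (c : constraint) : constraint :=
  if c is CPar u i then if i is j.+1 then CPar u.+2 j else CVar u.+2 1
  else ren_constraint (fun u => u.+2) c.

(* Variable 0 vanishes iff variables 1 and 2 agree. *)
Definition cmp_constraints := [:: CAdd 3 1 4; CAdd 3 2 5; CAdd 0 4 5].

(* The constraints of [elems A] are always satisfiable; they are satisfiable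
   with value 0 for variable 0 iff [A] holds.  Hence disjunction amounts to a
   product of the variables 0 of the two systems, and conjunction to a sum. *)
Fixpoint elems (A : form) : seq constraint :=
  match A with
  | FNat i n => CPar 1 i :: CNat 2 n :: cmp_constraints
  | FVar i j => CPar 1 i :: CPar 2 j :: cmp_constraints
  | FAdd i j k => CPar 1 i :: CPar 6 j :: CPar 7 k :: CAdd 2 6 7 :: cmp_constraints
  | FMul i j k => CPar 1 i :: CPar 6 j :: CPar 7 k :: CMul 2 6 7 :: cmp_constraints
  | FAnd A B => CAdd 0 1 2 :: map (ren_constraint (fun u => u.*2.+1)) (elems A)
                  ++ map (ren_constraint (fun u => u.*2.+2)) (elems B)
  | FOr A B => CMul 0 1 2 :: map (ren_constraint (fun u => u.*2.+1)) (elems A)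
                  ++ map (ren_constraint (fun u => u.*2.+2)) (elems B)
  | FEx A => CVar 0 2 :: map bind_constraint (elems A)
  end.

Lemma holds_ren r c phi nu :
  holds phi nu (ren_constraint r c) = holds (fun u => phi (r u)) nu c.
Proof. by case: c. Qed.

Lemma all_holds_ren r l phi nu :
  all (holds phi nu) (map (ren_constraint r) l) = all (holds (fun u => phi (r u)) nu) l.
Proof. by rewrite all_map; apply: eq_all => c; exact: holds_ren. Qed.

Lemma all_holds_bind l phi nu :
  all (holds phi nu) (map bind_constraint l) =
  all (holds (fun u => phi u.+2) (scons (phi 1) nu)) l.
Proof. by rewrite all_map; apply: eq_all => -[] //= u []. Qed.

Lemma holds_ext phi psi nu c : phi =1 psi -> holds phi nu c = holds psi nu c.
Proof. by move=> E; case: c => * /=; rewrite !E. Qed.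

Definition join (x : nat) (phi psi : nat -> nat) (u : nat) : nat :=
  if u is v.+1 then if odd v then psi v./2 else phi v./2 else x.

Lemma all_holds_join1 x phi psi nu l :
  all (holds (fun u => join x phi psi u.*2.+1) nu) l = all (holds phi nu) l.
Proof. by apply: eq_all => c; apply: holds_ext => u /=; rewrite odd_double doubleK. Qed.

Lemma all_holds_join2 x phi psi nu l :
  all (holds (fun u => join x phi psi u.*2.+2) nu) l = all (holds psi nu) l.
Proof.
by apply: eq_all => c; apply: holds_ext => u /=; rewrite odd_double uphalf_double.
Qed.

Lemma elems_sat A nu : exists phi, all (holds phi nu) (elems A).
Proof.
(* Values of variables 0 to 7 when the two sides are [a] and [b]: with their maximum as variable 3,
   variables 4 and 5 are the truncated differences. *)
pose f a b j k := nth 0 [:: (a - b) + (b - a); a; b; maxn a b; b - a; a - b; j; k].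
elim: A nu => [i n|i j|i j k|i j k|A IHA B IHB|A IHA B IHB|A IHA] nu.
- by exists (f (nu i) n 0 0); rewrite /f /= ?eqxx /=; apply/and3P; split; lia.
- by exists (f (nu i) (nu j) 0 0); rewrite /f /= ?eqxx /=; apply/and3P; split; lia.
- by exists (f (nu i) (nu j + nu k) (nu j) (nu k)); rewrite /f /= ?eqxx /=; apply/and3P; split; lia.
- by exists (f (nu i) (nu j * nu k) (nu j) (nu k)); rewrite /f /= ?eqxx /=; apply/and3P; split; lia.
- have [phi Hphi] := IHA nu; have [psi Hpsi] := IHB nu.
  exists (join (phi 0 + psi 0) phi psi).
  by rewrite /= all_cat !all_holds_ren all_holds_join1 all_holds_join2 Hphi Hpsi /= eqxx.
- have [phi Hphi] := IHA nu; have [psi Hpsi] := IHB nu.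
  exists (join (phi 0 * psi 0) phi psi).
  by rewrite /= all_cat !all_holds_ren all_holds_join1 all_holds_join2 Hphi Hpsi /= eqxx.
- have [phi Hphi] := IHA (scons 0 nu); exists (scons (phi 0) (scons 0 phi)).
  by rewrite /= all_holds_bind eqxx.
Qed.

Lemma elemsP A nu : sem A nu <-> exists phi, all (holds phi nu) (elems A) /\ phi 0 = 0.
Proof.
pose f a j k := nth 0 [:: 0; a; a; a; 0; 0; j; k].
elim: A nu => [i n|i j|i j k|i j k|A IHA B IHB|A IHA B IHB|A IHA] nu /=.
- split=> [<-|[phi /=]]; last lia.
  by exists (f (nu i) 0 0); rewrite /f /= addn0 !eqxx.
- split=> [<-|[phi /=]]; last lia.
  by exists (f (nu i) 0 0); rewrite /f /= addn0 !eqxx.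
- split=> [E|[phi /=]]; last lia.
  by exists (f (nu i) (nu j) (nu k)); rewrite /f /= addn0 -E !eqxx.
- split=> [E|[phi /=]]; last first.
    move=> [/and5P[/eqP<- /eqP<- /eqP<- /eqP<-]]; lia.
  by exists (f (nu i) (nu j) (nu k)); rewrite /f /= addn0 -E !eqxx.
- split=> [[/IHA[phi [Hphi z1]] /IHB[psi [Hpsi z2]]]|[phi []]].
    exists (join 0 phi psi); rewrite /= z1 z2.
    by rewrite /= all_cat !all_holds_ren all_holds_join1 all_holds_join2 Hphi Hpsi.
  rewrite all_cat !all_holds_ren => /and3P[/eqP E HA HB] z.
  by split; [apply/IHA | apply/IHB]; eexists; (split; first eassumption);
    rewrite /= double0; lia.
- split=> [[/IHA|/IHB]|[phi []]].
  + move=> [phi [Hphi z1]]; have [psi Hpsi] := elems_sat B nu.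
    exists (join 0 phi psi); rewrite /= z1.
    by rewrite /= all_cat !all_holds_ren all_holds_join1 all_holds_join2 Hphi Hpsi.
  + move=> [psi [Hpsi z2]]; have [phi Hphi] := elems_sat A nu.
    exists (join 0 phi psi); rewrite /= z2 muln0.
    by rewrite /= all_cat !all_holds_ren all_holds_join1 all_holds_join2 Hphi Hpsi.
  rewrite all_cat !all_holds_ren => /and3P[/eqP E HA HB] z.
  have /eqP := esym E; rewrite z muln_eq0 => /orP[] /eqP z'; [left; apply/IHA | right; apply/IHB].
    by eexists; split; first eassumption; rewrite /= double0.
  by eexists; split; first eassumption; rewrite /= double0.
- split=> [[n /IHA[phi [Hphi z]]]|[phi []]].
    exists (scons 0 (scons n phi)); rewrite /= all_holds_bind z.
    by split.
  rewrite all_holds_bind => /andP[/eqP E H] z.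
  by exists (phi 1); apply/IHA; eexists; split; [eassumption | rewrite /= -E].
Qed.

(** * Diophantine relations *)

Definition dio (P : (nat -> nat) -> Prop) : Prop :=
  exists A, forall nu, sem A nu <-> P nu.

Definition dfun (f : (nat -> nat) -> nat) : Prop :=
  dio (fun nu => nu 0 = f (fun i => nu i.+1)).

Definition up (r : nat -> nat) (i : nat) : nat := if i is j.+1 then (r j).+1 else 0.

Fixpoint ren (r : nat -> nat) (A : form) : form :=
  match A with
  | FNat i n => FNat (r i) n
  | FVar i j => FVar (r i) (r j)
  | FAdd i j k => FAdd (r i) (r j) (r k)
  | FMul i j k => FMul (r i) (r j) (r k)
  | FAnd A B => FAnd (ren r A) (ren r B)
  | FOr A B => FOr (ren r A) (ren r B)
  | FEx A => FEx (ren (up r) A)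
  end.

Lemma sem_ren A r nu mu : (forall i, nu (r i) = mu i) -> sem (ren r A) nu <-> sem A mu.
Proof.
elim: A r nu mu => [i n|i j|i j k|i j k|A IHA B IHB|A IHA B IHB|A IHA] r nu mu E /=;
  rewrite ?E //.
- by split=> -[/(IHA _ _ _ E) ? /(IHB _ _ _ E) ?].
- by split=> -[/(IHA _ _ _ E) ?|/(IHB _ _ _ E) ?]; by [left|right].
- have E' n i : scons n nu (up r i) = scons n mu i by case: i => //= i.
  by split=> -[n /(IHA _ _ _ (E' n)) ?]; exists n.
Qed.

Lemma sem_ext A nu mu : nu =1 mu -> sem A nu <-> sem A mu.
Proof.
move=> E; have H : sem (ren id A) nu <-> sem A mu by apply: sem_ren.
by have H' : sem (ren id A) nu <-> sem A nu by [apply: sem_ren]; tauto.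
Qed.

Lemma dio_iff P Q : (forall nu, P nu <-> Q nu) -> dio P -> dio Q.
Proof. by move=> PQ [A HA]; exists A => nu; rewrite -> HA. Qed.

Lemma dio_ren P r : dio P -> dio (fun nu => P (fun i => nu (r i))).
Proof.
move=> [A HA]; exists (ren r A) => nu.
have H := @sem_ren A r nu (fun i => nu (r i)) (fun=> erefl).
by have := HA (fun i => nu (r i)); tauto.
Qed.

Lemma dio_and P Q : dio P -> dio Q -> dio (fun nu => P nu /\ Q nu).
Proof. by move=> [A HA] [B HB]; exists (FAnd A B) => nu /=; rewrite -> HA, HB. Qed.

Lemma dio_or P Q : dio P -> dio Q -> dio (fun nu => P nu \/ Q nu).
Proof. by move=> [A HA] [B HB]; exists (FOr A B) => nu /=; rewrite -> HA, HB. Qed.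

Lemma dio_ex (P : nat -> (nat -> nat) -> Prop) :
  dio (fun nu => P (nu 0) (fun i => nu i.+1)) -> dio (fun nu => exists x, P x nu).
Proof.
move=> [A HA]; exists (FEx A) => nu.
by split=> -[x Hx]; exists x; apply/(HA (scons x nu)).
Qed.

Lemma dio_let (P : nat -> (nat -> nat) -> Prop) f :
  dfun f -> dio (fun nu => P (nu 0) (fun i => nu i.+1)) -> dio (fun nu => P (f nu) nu).
Proof.
move=> Hf HP; apply: dio_iff (dio_ex (P := fun x nu => x = f nu /\ P x nu) (dio_and Hf HP)).
by move=> nu; split=> [[x [-> //]]|]; exists (f nu).
Qed.

Lemma dfun_var i : dfun (fun nu => nu i).
Proof. by exists (FVar 0 i.+1). Qed.

Lemma dfun_const n : dfun (fun=> n).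
Proof. by exists (FNat 0 n). Qed.

Lemma dfun_ren f r : dfun f -> dfun (fun nu => f (fun i => nu (r i))).
Proof. exact: (dio_ren (up r)). Qed.

Lemma dio_comp2 (R : nat -> nat -> Prop) f g :
  dio (fun nu => R (nu 0) (nu 1)) -> dfun f -> dfun g -> dio (fun nu => R (f nu) (g nu)).
Proof.
move=> HR Hf Hg; apply: (dio_let (P := fun x nu => R x (g nu))) => //.
apply: (dio_let (P := fun y nu => R (nu 0) y)); first exact: (dfun_ren S).
exact: (dio_ren (fun i => if i is 0 then 1 else 0) HR).
Qed.

Lemma dio_comp3 (R : nat -> nat -> nat -> Prop) f g h :
  dio (fun nu => R (nu 0) (nu 1) (nu 2)) -> dfun f -> dfun g -> dfun h ->
  dio (fun nu => R (f nu) (g nu) (h nu)).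
Proof.
move=> HR Hf Hg Hh; apply: (dio_let (P := fun x nu => R x (g nu) (h nu))) => //.
apply: (dio_let (P := fun y nu => R (nu 0) y (h (fun i => nu i.+1)))); first exact: (dfun_ren S).
apply: (dio_let (P := fun z nu => R (nu 1) (nu 0) z)); first exact: (dfun_ren (fun i => i.+2)).
exact: (dio_ren (fun i => nth 0 [:: 2; 1; 0] i) HR).
Qed.

Lemma dfun_comp2 (F : nat -> nat -> nat) f g :
  dio (fun nu => nu 0 = F (nu 1) (nu 2)) -> dfun f -> dfun g -> dfun (fun nu => F (f nu) (g nu)).
Proof.
move=> HF Hf Hg; apply: (dio_comp3 (R := fun x y z => x = F y z)) => //.
- exact: dfun_var.
- exact: (dfun_ren S).
- exact: (dfun_ren S).
Qed.

Lemma dfun_add f g : dfun f -> dfun g -> dfun (fun nu => f nu + g nu).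
Proof. by apply: dfun_comp2; exists (FAdd 0 1 2). Qed.

Lemma dfun_mul f g : dfun f -> dfun g -> dfun (fun nu => f nu * g nu).
Proof. by apply: dfun_comp2; exists (FMul 0 1 2). Qed.

Lemma dfun_succ f : dfun f -> dfun (fun nu => (f nu).+1).
Proof.
move=> Hf; apply: dio_iff (dfun_add Hf (dfun_const 1)) => nu.
by rewrite addn1.
Qed.

Lemma dio_eq f g : dfun f -> dfun g -> dio (fun nu => f nu = g nu).
Proof. by apply: dio_comp2; exists (FVar 0 1). Qed.

Ltac dio_step0 :=
  match goal with
  | H : ?G |- ?G => exact H
  | H : dfun ?f |- dfun (fun nu => ?f (fun i => nu (@?r i))) => exact: (dfun_ren r H)
  | |- dfun (fun nu => nu ?i) => exact: dfun_var
  | |- dfun (fun _ => ?b) => exact: dfun_const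
  | |- dfun (fun nu => (@?f nu).+1) => apply: (dfun_succ (f := f))
  | |- dfun (fun nu => @?f nu + @?g nu) => apply: (dfun_add (f := f) (g := g))
  | |- dfun (fun nu => @?f nu * @?g nu) => apply: (dfun_mul (f := f) (g := g))
  | |- dio (fun nu => @?P nu /\ @?Q nu) => apply: (dio_and (P := P) (Q := Q))
  | |- dio (fun nu => @?P nu \/ @?Q nu) => apply: (dio_or (P := P) (Q := Q))
  | |- dio (fun nu => exists x, @?Q nu x) =>
      let P := constr:(fun x nu => Q nu x) in apply (@dio_ex P)
  | |- dio (fun nu => @?f nu = @?g nu) => apply: (dio_eq (f := f) (g := g))
  end.
Ltac dio := repeat (dio_step0; cbv beta).

Lemma dio_leq f g : dfun f -> dfun g -> dio (fun nu => f nu <= g nu).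
Proof.
move=> Hf Hg; apply: (@dio_iff (fun nu => exists z, g nu = f nu + z)); last by dio.
by move=> nu; split=> [[z ->]|?]; [exact: leq_addr | exists (g nu - f nu); lia].
Qed.

Ltac dio_step1 :=
  first [dio_step0 | match goal with
  | |- dio (fun nu => is_true (@?f nu <= @?g nu)) => apply: (dio_leq (f := f) (g := g))
  end].
Ltac dio ::= repeat (dio_step1; cbv beta).

Lemma dfun_graph f (P : nat -> (nat -> nat) -> Prop) :
  (forall nu x, P x nu <-> x = f nu) -> dio (fun nu => P (nu 0) (fun i => nu i.+1)) -> dfun f.
Proof. by move=> Pf; apply: dio_iff => nu; exact: Pf. Qed.

Lemma dio_dvdn f g : dfun f -> dfun g -> dio (fun nu => f nu %| g nu).
Proof.
move=> Hf Hg; apply: (@dio_iff (fun nu => exists z, g nu = z * f nu)); last by dio.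
by move=> nu; split=> [/dvdnP|/dvdnP].
Qed.

Lemma dfun_sub f g : dfun f -> dfun g -> dfun (fun nu => f nu - g nu).
Proof.
move=> Hf Hg; apply: (@dfun_graph _ (fun x nu => f nu = x + g nu \/ f nu <= g nu /\ x = 0)).
  move=> nu x; lia.
dio.
Qed.

Lemma dfun_div f g : dfun f -> dfun g -> dfun (fun nu => f nu %/ g nu).
Proof.
move=> Hf Hg; apply: (@dfun_graph _ (fun x nu => g nu = 0 /\ x = 0 \/
   exists r, r < g nu /\ f nu = x * g nu + r)); last by dio.
move=> nu x; split=> [[[-> ->]|[r [lt_r ->]]]|->]; first by rewrite divn0.
  by rewrite divnMDl ?divn_small ?addn0 //; lia.
have [->|g_gt0] := posnP (g nu); first by left; rewrite divn0.
by right; exists (f nu %% g nu); rewrite ltn_pmod // -divn_eq.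
Qed.

Ltac dio_step2 :=
  first [dio_step1 | match goal with
  | |- dio (fun nu => is_true (@?f nu %| @?g nu)) => apply: (dio_dvdn (f := f) (g := g))
  | |- dfun (fun nu => @?f nu - @?g nu) => apply: (dfun_sub (f := f) (g := g))
  | |- dfun (fun nu => @?f nu %/ @?g nu) => apply: (dfun_div (f := f) (g := g))
  end].
Ltac dio ::= repeat (dio_step2; cbv beta).

Lemma dfun_mod f g : dfun f -> dfun g -> dfun (fun nu => f nu %% g nu).
Proof.
move=> Hf Hg; apply: (@dfun_graph _ (fun x nu => f nu = f nu %/ g nu * g nu + x)); last by dio.
by move=> nu x; rewrite {1}(divn_eq (f nu) (g nu)); lia.
Qed.

Ltac dio_step3 :=
  first [dio_step2 | match goal with
  | |- dfun (fun nu => @?f nu %% @?g nu) => apply: (dfun_mod (f := f) (g := g))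
  end].
Ltac dio ::= repeat (dio_step3; cbv beta).

Definition pell_rel (a k x y : nat) : Prop :=
  2 < a /\ Posz x = pX a k /\ Posz y = pY a k.

Lemma dio_pell f g h k : dfun f -> dfun g -> dfun h -> dfun k ->
  dio (fun nu => pell_rel (f nu) (g nu) (h nu) (k nu)).
Proof.
move=> Hf Hg Hh Hk; pose P a k x y := 2 < a /\ (
  (k = 0 /\ x = 1 /\ y = 0) \/ (0 < k /\ k <= y) /\ exists u v s t b : nat,
    (pell_eq a x y /\ pell_eq a u v /\ pell_eq b s t /\ 2 < b /\ 0 < v) /\
    (b %% (2 * y) = 1 %% (2 * y) /\ b %% u = a %% u /\ y * y %| v /\ s %% u = x %% u /\
        t %% (2 * y) = k %% (2 * y))).
apply: (@dio_iff (fun nu => P (f nu) (g nu) (h nu) (k nu))); last by rewrite /P /pell_eq; dio.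
move=> nu; split=> -[a2 H]; split=> //.
  apply/(matiyasevich _ _ _ a2); case: H => [[? [? ?]]|[[? ?] H]]; first by left.
  right; split; first exact/andP.
  by case: H => u [v [s [t [b [[? [? [? [? ?]]]] [? [? [? [? ?]]]]]]]]]; exists u, v, s, t, b.
case/(matiyasevich _ _ _ a2): H => [[? ? ?]|[/andP[? ?] H]]; first by left.
right; split=> //.
by case: H => u [v [s [t [b [[? ? ? ? ?] [? ? ? ? ?]]]]]]; exists u, v, s, t, b.
Qed.

Ltac dio_step4 :=
  first [dio_step3 | match goal with
  | |- dio (fun nu => pell_rel (@?f nu) (@?g nu) (@?h nu) (@?k nu)) =>
      apply: (dio_pell (f := f) (g := g) (h := h) (k := k))
  end].
Ltac dio ::= repeat (dio_step4; cbv beta).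

Lemma dfun_expn f g : dfun f -> dfun g -> dfun (fun nu => f nu ^ g nu).
Proof.
move=> Hf Hg; pose P n k m := n = 0 /\ (k = 0 /\ m = 1 \/ 0 < k /\ m = 0) \/ 0 < n /\
  exists z x y t w : nat,
    pell_rel (n + 3) k.+1 w z /\ pell_rel (z + n + 3) k x y /\
    t + (n * n + 1) = 2 * (z + n + 3) * n /\ m < t /\ x %% t = (m + y * (z + 3)) %% t.
apply: (@dfun_graph _ (fun x nu => P (f nu) (g nu) x)); last by rewrite /P; dio.
move=> nu m; have [n0|n_gt0] := posnP (f nu).
  rewrite /P n0; case: (g nu) => [|k]; first by rewrite expn0; lia.
  by rewrite exp0n //; lia.
split=> [[[]|[_]]|]; first lia.
  move=> [z [x [y [t [w [[_ [_ Ez]] [[_ [Ex Ey]] [Et [lt_mt E]]]]]]]]].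
  by apply/expn_pell => //; exists z, x, y, t.
move/(expn_pell _ _ n_gt0) => [z [x [y [t [Ez [Ex Ey] Et lt_mt E]]]]]; right; split=> //.
have n3 : 1 < f nu + 3 by lia.
have [w Ew] := pX_nat (g nu).+1 n3.
by exists z, x, y, t, w; do !split=> //; lia.
Qed.

(** * Digits, binomial coefficients and factorials *)

Definition encode (b : nat) (s : seq nat) : nat := foldr (fun x acc => x + b * acc) 0 s.
Definition digit (b n i : nat) : nat := (n %/ b ^ i) %% b.

Lemma digit_encode b s i : 0 < b -> all (fun x => x < b) s -> digit b (encode b s) i = nth 0 s i.
Proof.
move=> b_gt0; rewrite /digit; elim: s i => [|x s IHs] i /=; first by rewrite div0n mod0n nth_nil.
case/andP=> lt_x Hs; case: i => [|i] /=.
  by rewrite expn0 divn1 mulnC -modnDmr modnMl addn0 modn_small.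
by rewrite expnS divnMA addnC mulnC divnMDl // (divn_small lt_x) addn0 IHs.
Qed.

Lemma encode_sum b f m : encode b (mkseq f m) = \sum_(i < m) f i * b ^ i.
Proof.
elim: m f => [|m IHm] f; first by rewrite big_ord0.
rewrite big_ord_recl expn0 muln1 /mkseq /= (iotaDl 1 0) -map_comp.
rewrite -/(encode b _) -/(mkseq (fun i => f (1 + i)) m) IHm big_distrr /=; congr (_ + _).
by apply: eq_bigr => i _; rewrite expnS mulnCA.
Qed.

Lemma bin_leq_exp2 n k : 'C(n, k) <= 2 ^ n.
Proof.
have [lt_nk|le_kn] := ltnP n k; first by rewrite bin_small.
have -> : 2 ^ n = \sum_(i < n.+1) 'C(n, i).
  by rewrite -[2]/(1 + 1) expnDn; apply: eq_bigr => i _; rewrite !exp1n !muln1.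
by rewrite (bigD1 (inord k)) //= inordK // leq_addr.
Qed.

(** Binomial theorem: the coefficients are the digits of [(u + 1)^n] in any base [u] that exceeds
    them all, such as [2^n + 1]. *)
Lemma bin_digit n k : 'C(n, k) = digit (2 ^ n).+1 ((2 ^ n).+2 ^ n) k.
Proof.
set u := (2 ^ n).+1.
have -> : u.+1 ^ n = encode u (mkseq (fun i => 'C(n, i)) n.+1).
  rewrite encode_sum -[u.+1]addn1 addnC expnDn.
  by apply: eq_bigr => i _; rewrite exp1n mul1n.
rewrite digit_encode //; last first.
  by apply/allP=> _ /mapP[i _ ->]; rewrite ltnS bin_leq_exp2.
have [lt_k|le_k] := ltnP k n.+1; first by rewrite nth_mkseq.
by rewrite nth_default ?size_mkseq // bin_small.
Qed.

Ltac dio_step5 :=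
  first [dio_step4 | match goal with
  | |- dfun (fun nu => @?f nu ^ @?g nu) => apply: (dfun_expn (f := f) (g := g))
  end].
Ltac dio ::= repeat (dio_step5; cbv beta).

Lemma dfun_pred f : dfun f -> dfun (fun nu => (f nu).-1).
Proof.
by move=> Hf; apply: dio_iff (dfun_sub Hf (dfun_const 1)) => nu; rewrite subn1.
Qed.

Lemma dfun_ext f g : f =1 g -> dfun f -> dfun g.
Proof. by move=> E; apply: dio_iff => nu; rewrite E. Qed.

Lemma dfun_digit f g h : dfun f -> dfun g -> dfun h ->
  dfun (fun nu => digit (f nu) (g nu) (h nu)).
Proof. by move=> Hf Hg Hh; rewrite /digit; dio. Qed.

Lemma dfun_bin f g : dfun f -> dfun g -> dfun (fun nu => 'C(f nu, g nu)).
Proof.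
move=> Hf Hg; apply: (dfun_ext (fun nu => esym (bin_digit (f nu) (g nu)))).
by rewrite /digit; dio.
Qed.

(** Each of the [n] factors of the falling factorial loses at most [n] against [r], hence a relative
    loss of at most [n^2 / r] against the power. *)
Lemma expn_ffact_leq r n : r ^ n.+1 <= r * r ^_ n + n ^ 2 * r ^ n.
Proof.
suff H m : m <= n -> r ^ m.+1 <= r * r ^_ m + m * n * r ^ m by exact: H.
elim: m => [|m IHm] le_mn; first by rewrite expn1 ffactn0 muln1 leq_addr.
rewrite expnS; apply: leq_trans (leq_mul (leqnn r) (IHm (ltnW le_mn))) _.
rewrite ffactnSr (expnS r m).
have : r ^_ m <= r ^ m.
  by elim: (m) => // j IHj; rewrite ffactnSr expnSr leq_mul // leq_subr.
have : r <= (r - m) + n by lia.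
move: (r ^_ m) (r ^ m) (r - m) => a b c; clear -le_mn.
move=> h1 h2; have : r * (r * a) <= r * ((c + n) * a) by rewrite leq_mul // leq_mul.
have : r * (n * a) <= r * (n * b) by rewrite !leq_mul.
nia.
Qed.

(** The quotient of [r^n] by the binomial coefficient is the factorial of [n] times the ratio of
    [r^n] to the falling factorial. That ratio is at least 1 and tends to 1; the bound on [r] brings
    it close enough for the integer part to be exact. *)
Lemma fact_div r n : (n`! + 1) * n ^ 2 < r -> n`! = r ^ n %/ 'C(r, n).
Proof.
move=> lt_r; have le_nr : n <= r by move: (fact_gt0 n); nia.
have C_gt0 : 0 < 'C(r, n) by rewrite bin_gt0.
have ffE := bin_ffact r n.
have le1 : n`! * 'C(r, n) <= r ^ n.
  by rewrite mulnC ffE; elim: (n) => // j IHj; rewrite ffactnSr expnSr leq_mul // leq_subr.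
have lt2 : r ^ n < (n`! + 1) * 'C(r, n).
  have := expn_ffact_leq r n; rewrite -ffE expnS.
  have : 0 < r ^ n by rewrite expn_gt0; apply/orP; left; lia.
  move: lt_r (fact_gt0 n); move: (r ^ n) (n ^ 2) (n`!) ('C(r, n)) => p q f c; clear.
  move=> h1 h2 h3 h4; rewrite ltnNge; apply/negP=> h5.
  have h6 : f * (r * p) <= f * (r * (c * f) + q * p) by rewrite leq_mul.
  have h7 : r * (f * ((f + 1) * c)) <= r * (f * p) by rewrite !leq_mul.
  have h8 : (f + 1) * q * p < r * p by rewrite ltn_mul2r h3.
  have h9 : (f + 1) * (r * p) <= (f + 1) * (r * (c * f) + q * p) by rewrite leq_mul.
  nia.
by apply: anti_leq; rewrite leq_divRL // le1 -ltnS ltn_divLR // -[_`!.+1]addn1.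
Qed.

Ltac dio_step6 :=
  first [dio_step5 | match goal with
  | |- dfun (fun nu => digit (@?f nu) (@?g nu) (@?h nu)) =>
      apply: (dfun_digit (f := f) (g := g) (h := h))
  | |- dfun (fun nu => 'C(@?f nu, @?g nu)) => apply: (dfun_bin (f := f) (g := g))
  end].
Ltac dio ::= repeat (dio_step6; cbv beta).

Lemma fact_leq_expn n : n`! <= n ^ n.
Proof. by rewrite -ffactnn; elim: {2 4}n => // j IHj; rewrite ffactnSr expnSr leq_mul // leq_subr. Qed.

Lemma dfun_fact f : dfun f -> dfun (fun nu => (f nu)`!).
Proof.
move=> Hf.
(* The bound of [fact_div], with [n ^ n] in place of the factorial that is being defined. *)
pose r n := ((n ^ n + 1) * n ^ 2).+1.
apply: (@dfun_ext (fun nu => r (f nu) ^ f nu %/ 'C(r (f nu), f nu))).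
  move=> nu; rewrite -fact_div // ltnS leq_mul2r leq_add2r fact_leq_expn orbT //.
by rewrite /r; dio.
Qed.

Lemma dfun_ffact f g : dfun f -> dfun g -> dfun (fun nu => f nu ^_ g nu).
Proof.
move=> Hf Hg; apply: (@dfun_ext (fun nu => 'C(f nu, g nu) * (g nu)`!)).
  by move=> nu; exact: bin_ffact.
by apply: dfun_mul; [exact: dfun_bin | exact: dfun_fact].
Qed.

Ltac dio_step7 :=
  first [dio_step6 | match goal with
  | |- dfun (fun nu => (@?f nu)`!) => apply: (dfun_fact (f := f))
  | |- dfun (fun nu => @?f nu ^_ @?g nu) => apply: (dfun_ffact (f := f) (g := g))
  end].
Ltac dio ::= repeat (dio_step7; cbv beta).

(** * Bounded universal quantification *)

(* With [s = (W!)^2], the binomial coefficient [C(s-1, y)] is the product for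
   [k < y] of the numbers [s/(k+1) - 1].  They are pairwise coprime, all their
   prime factors exceed [W], and [s-1] is congruent to [k] modulo the [k]-th. *)
Section Moduli.
Variable W : nat.
Hypothesis W_gt2 : 2 < W.
Let s := W`! * W`!.
Definition modulus k := (W`! * (W`! %/ k.+1)).-1.

Lemma modulusE k : k < W -> k.+1 * (modulus k).+1 = s.
Proof.
move=> lt_kW; rewrite /modulus prednK ?muln_gt0 ?fact_gt0 /=; last first.
  by rewrite divn_gt0 // dvdn_leq ?fact_gt0 // dvdn_fact.
by rewrite mulnCA [k.+1 * _]mulnC divnK // dvdn_fact.
Qed.

Lemma modulus_gt1 k : k < W -> 1 < modulus k.
Proof.
move=> lt_kW; have : 2 < W`! by apply: leq_trans W_gt2 _; rewrite dvdn_leq ?fact_gt0 // dvdn_fact //; lia.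
have : 0 < W`! %/ k.+1 by rewrite divn_gt0 // dvdn_leq ?fact_gt0 // dvdn_fact.
rewrite /modulus; nia.
Qed.

(** This is why the factorial is squared: after the division by [k.+1], the successor of the modulus
    is still a multiple of the factorial of [W], hence of every prime up to [W]. *)
Lemma modulus_prime k p : k < W -> prime p -> p %| modulus k -> W < p.
Proof.
move=> lt_kW p_pr p_dvd; rewrite ltnNge; apply/negP=> le_pW.
have : p %| (modulus k).+1.
  rewrite /modulus prednK; first by rewrite dvdn_mulr // dvdn_fact // prime_gt0.
  rewrite muln_gt0 fact_gt0 divn_gt0 // dvdn_leq ?fact_gt0 // dvdn_fact //.
by rewrite -addn1 dvdn_addr // dvdn1 => /eqP p1; rewrite p1 in p_pr.
Qed.

Lemma modulus_cong k : k < W -> s.-1 = k %[mod modulus k].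
Proof.
move=> lt_kW; have -> : s.-1 = k.+1 * modulus k + k.
  by rewrite -(modulusE lt_kW) mulnS /= addnC.
by rewrite -modnDml modnMl add0n.
Qed.

(** Modulo a common prime factor, [k] and [l] would both be congruent to [s.-1], although they are
    distinct and smaller than that prime. *)
Lemma modulus_coprime k l : k < l -> l < W -> coprime (modulus k) (modulus l).
Proof.
move=> lt_kl lt_lW; have lt_kW := ltn_trans lt_kl lt_lW.
rewrite /coprime eqn_leq gcdn_gt0 (ltnW (modulus_gt1 lt_kW)) andbT leqNgt.
apply/negP=> /pdivP[p p_pr]; rewrite dvdn_gcd => /andP[pk pl].
have lt_Wp := modulus_prime lt_kW p_pr pk.
have : k = l %[mod p].
  rewrite -(modn_dvdm k pk) -(modn_dvdm l pl) -modulus_cong // -modulus_cong //.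
  by rewrite !modn_dvdm.
rewrite !modn_small //; lia.
Qed.

(** Passing from [y] to [y.+1] multiplies the coefficient by [(s.-1 - y) / y.+1], which is
    [modulus y]. *)
Lemma bin_modulus y : y <= W -> 'C(s.-1, y) = \prod_(k < y) modulus k.
Proof.
elim: y => [|y IHy] lt_yW; first by rewrite bin0 big_ord0.
rewrite big_ord_recr /= -(IHy (ltnW lt_yW)); apply/eqP.
rewrite -(eqn_pmul2l (ltn0Sn y)) mul_bin_left mulnCA mulnC; apply/eqP; congr (_ * _).
by rewrite -(modulusE lt_yW) mulnS addSn /= addnC addnK.
Qed.

End Moduli.

Lemma coprime_prod m y n : (forall k, k < y -> coprime (m k) n) -> coprime (\prod_(k < y) m k) n.
Proof.
elim: y => [|y IHy] co_m; first by rewrite big_ord0 coprime1n.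
by rewrite big_ord_recr /= coprimeMl co_m // IHy // => k lt_ky; apply/co_m/ltnW.
Qed.

Definition pairwise_coprime m y := forall k l, k < l -> l < y -> coprime (m k) (m l).

Lemma cong_prod m y a b : pairwise_coprime m y ->
  (forall k, k < y -> a = b %[mod m k]) -> a = b %[mod \prod_(k < y) m k].
Proof.
elim: y => [|y IHy] co_m ab; first by rewrite big_ord0 !modn1.
rewrite big_ord_recr /=; apply/eqP; rewrite chinese_remainder; last first.
  by apply: coprime_prod => k lt_ky; exact: co_m.
apply/andP; split; apply/eqP; last exact: ab.
by apply: IHy => [k l lt_kl lt_ly|k lt_ky]; [apply: co_m|apply: ab]; rewrite // ltnW.
Qed.

Lemma chinese_seq m y r : pairwise_coprime m y ->
  exists a, forall k, k < y -> a = r k %[mod m k].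
Proof.
elim: y => [|y IHy] co_m; first by exists 0.
have [k l lt_kl lt_ly|a Ha] := IHy; first by apply: co_m; rewrite // ltnW.
have co : coprime (\prod_(k < y) m k) (m y).
  by apply: coprime_prod => k lt_ky; exact: co_m.
exists (chinese (\prod_(k < y) m k) (m y) a (r y)) => k.
rewrite ltnS leq_eqVlt => /predU1P[->|lt_ky]; first exact: chinese_modr.
have dvd_k : m k %| \prod_(k < y) m k by rewrite (bigD1 (Ordinal lt_ky)) //= dvdn_mulr.
by rewrite -(modn_dvdm _ dvd_k) chinese_modl // modn_dvdm // Ha.
Qed.

Lemma finite_choice A (R : nat -> A -> Prop) y (a0 : A) :
  (forall k, k < y -> exists a, R k a) -> exists f, forall k, k < y -> R k (f k).
Proof.
elim: y => [|y IHy] H; first by exists (fun=> a0).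
have [k lt_ky|f Hf] := IHy; first by apply: H; rewrite ltnW.
have [a Ha] := H y (ltnSn y); exists (fun k => if k == y then a else f k) => k.
by rewrite ltnS leq_eqVlt; case: eqP => [-> //|_ /= /Hf].
Qed.

(** The prime divides one of the factors [a], [a - 1], ..., [a - n + 1]. A bound on residues thus
    becomes a divisibility, which a single condition modulo the product of all moduli can impose at
    once. *)
Lemma ffact_mod_lt p n a : prime p -> n <= p -> p %| a ^_ n -> a %% p < n.
Proof.
move=> p_pr; elim: n => [|n IHn] le_np; first by rewrite ffactn0 dvdn1 => /eqP p1; rewrite p1 in p_pr.
rewrite ffactnSr Euclid_dvdM // => /orP[/(IHn (ltnW le_np))/ltnW //|D].
have [le_an|lt_na] := leqP a n; first by rewrite modn_small ?ltnS // (leq_ltn_trans le_an).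
by move: D; rewrite -eqn_mod_dvd ?(ltnW lt_na) // => /eqP ->; rewrite modn_small.
Qed.

Lemma dvd_ffact m n a r : a = r %[mod m] -> r < n -> m %| a ^_ n.
Proof.
move=> E; elim: n => // n IHn; rewrite ffactnSr ltnS leq_eqVlt => /predU1P[<-|/IHn].
  have [/eqP ->|lt_ra] := leqP a r; first by rewrite muln0 dvdn0.
  by apply: dvdn_mull; rewrite -eqn_mod_dvd ?(ltnW lt_ra) // E.
exact: dvdn_mulr.
Qed.

Definition var_bound (c : constraint) : nat :=
  match c with
  | CNat u _ | CPar u _ => u.+1
  | CVar u v => maxn u.+1 v.+1
  | CAdd u v w | CMul u v w => maxn u.+1 (maxn v.+1 w.+1)
  end.

Definition value_bound (nu : nat -> nat) (c : constraint) : nat :=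
  match c with
  | CNat _ n => n
  | CPar _ i.+1 => nu i
  | _ => 0
  end.

Lemma all_leq_max (f : constraint -> nat) l :
  all (fun c => f c <= foldr (fun c m => maxn (f c) m) 0 l) l.
Proof.
elim: l => //= c l IHl; rewrite leq_maxl /=.
by apply: sub_all IHl => d /leq_trans; apply; exact: leq_maxr.
Qed.

(* The constraint [c] in the parameters [k :: nu], simultaneously for all
   [k < y]: the residues of the value of [alpha] modulo the [y] moduli stand for
   [y] values. *)
Definition holds_mod (B W y : nat) (alpha nu : nat -> nat) (c : constraint) : bool :=
  let s := (W`! * W`!).-1 in
  let M := 'C(s, y) in
  match c with
  | CNat u n => (n <= W) && (alpha u == n %[mod M])
  | CVar u v => alpha u == alpha v %[mod M]
  | CPar u 0 => alpha u == s %[mod M]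
  | CPar u i.+1 => (nu i <= W) && (alpha u == nu i %[mod M])
  | CAdd u v w => [&& M %| alpha v ^_ B.+1, M %| alpha w ^_ B.+1 &
                      alpha u == alpha v + alpha w %[mod M]]
  | CMul u v w => [&& M %| alpha v ^_ B.+1, M %| alpha w ^_ B.+1 &
                      alpha u == alpha v * alpha w %[mod M]]
  end.

(** A divisible falling factorial bounds a residue only modulo a prime, and the moduli may be
    composite. The values for [k] are therefore read off modulo the least prime factor of the [k]-th
    modulus. It exceeds [W], so sums and products of residues up to [B] do not wrap around and
    congruences become equations. *)
Lemma holds_modP l y nu :
  (forall k, k < y -> exists phi, all (holds phi (scons k nu)) l) <->
  exists B W alpha,
    2 < W /\ y <= W /\ B + B <= W /\ B * B <= W /\ all (holds_mod B W y alpha nu) l.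
Proof.
split=> [H|[B [W [alpha [W2 [le_yW [leDW [leMW Hl]]]]]]] k lt_ky]; last first.
  have lt_kW := leq_trans lt_ky le_yW; pose p := pdiv (modulus W k).
  have p_pr : prime p by apply: pdiv_prime; exact: modulus_gt1.
  have p_dvd : p %| modulus W k by exact: pdiv_dvd.
  have lt_Wp : W < p by exact: modulus_prime lt_kW p_pr p_dvd.
  exists (fun u => alpha u %% p).
  move: Hl; set s := (W`! * W`!).-1; set M := 'C(s, y) => Hl.
  have pM : p %| M.
    rewrite /M bin_modulus // (bigD1 (Ordinal lt_ky)) //=; exact: dvdn_mulr.
  have congp a b : a = b %[mod M] -> a = b %[mod p].
    by move=> E; rewrite -(modn_dvdm a pM) E modn_dvdm.
  have small a : M %| a ^_ B.+1 -> a %% p <= B.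
    by move/(dvdn_trans pM)/ffact_mod_lt; rewrite ltnS; apply=> //; lia.
  apply: sub_all Hl => -[u n|u v|u [|i]|u v w|u v w] /=.
  - by case/andP=> le_nW /eqP/congp ->; rewrite modn_small //; lia.
  - by move/eqP/congp ->.
  - move/eqP/congp ->; rewrite -(modn_dvdm _ p_dvd) modulus_cong // modn_dvdm //.
    by rewrite modn_small //; lia.
  - by case/andP=> le_nW /eqP/congp ->; rewrite modn_small //; lia.
  - case/and3P=> /small Bv /small Bw /eqP/congp ->.
    rewrite -modnDm modn_small //; apply: leq_ltn_trans lt_Wp; apply: leq_trans leDW.
    exact: leq_add.
  - case/and3P=> /small Bv /small Bw /eqP/congp ->.
    rewrite -modnMm modn_small //; apply: leq_ltn_trans lt_Wp; apply: leq_trans leMW.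
    exact: leq_mul.
have [Phi HPhi] := finite_choice (fun=> 0) H.
pose V := foldr (fun c m => maxn (var_bound c) m) 0 l.
pose B := \max_(k < y) \max_(u < V) Phi k u.
have le_B k u : k < y -> u < V -> Phi k u <= B.
  move=> lt_k lt_u; apply: leq_trans (leq_bigmax (Ordinal lt_k)).
  exact: (leq_bigmax (F := fun v : 'I_V => Phi k v) (Ordinal lt_u)).
pose N := foldr (fun c m => maxn (value_bound nu c) m) 0 l.
pose W := 3 + y + (B + B) + B * B + N.
have W2 : 2 < W by rewrite /W; lia.
have le_yW : y <= W by rewrite /W; lia.
have co : pairwise_coprime (modulus W) y.
  by move=> k j lt_kj lt_jy; apply: modulus_coprime => //; exact: leq_trans le_yW.
have [alpha Halpha] : exists alpha, forall u, u < V -> forall k, k < y ->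
    alpha u = Phi k u %[mod modulus W k].
  apply: (finite_choice (R := fun u a => forall k, k < y ->
     a = Phi k u %[mod modulus W k]) 0) => u _.
  exact: (chinese_seq (fun k => Phi k u) co).
exists B, W, alpha; do 4 (split; first by rewrite /W; lia).
have congM a b : (forall k, k < y -> a = b %[mod modulus W k]) ->
    a = b %[mod 'C((W`! * W`!).-1, y)].
  by move=> E; rewrite bin_modulus //; exact: cong_prod.
have boundM v : v < V -> 'C((W`! * W`!).-1, y) %| alpha v ^_ B.+1.
  move=> lt_v; rewrite /dvdn (congM _ 0) ?mod0n // => k lt_k.
  apply/eqP; rewrite mod0n; apply: dvd_ffact (Halpha v lt_v k lt_k) _.
  by rewrite ltnS le_B.
have vbl := all_leq_max var_bound l; have nbl := all_leq_max (value_bound nu) l.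
rewrite -/V in vbl; rewrite -/N in nbl.
have HPhi' : all (fun c => [&& var_bound c <= V, value_bound nu c <= N &
    [forall k : 'I_y, holds (Phi k) (scons k nu) c]]) l.
  move: vbl nbl HPhi; elim: (l) => //= c l' IHl /andP[-> vb] /andP[-> nb] Hc /=.
  apply/andP; split; first by apply/forallP=> k; case/andP: (Hc k (ltn_ord k)).
  by apply: IHl => // k lt_k; case/andP: (Hc k lt_k).
apply: sub_all HPhi' => c /and3P[vb nb /forallP Hc].
have {}Hc k : k < y -> holds (Phi k) (scons k nu) c by move=> lt_k; exact: (Hc (Ordinal lt_k)).
case: c vb nb Hc => [u n|u v|u [|i]|u v w|u v w] /=; rewrite ?geq_max.
- move=> lt_u le_n Hc; apply/andP; split; first by rewrite /W; lia.
  by apply/eqP/congM => k lt_k; rewrite Halpha // (eqP (Hc k lt_k)).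
- move=> /andP[lt_u lt_v] _ Hc.
  by apply/eqP/congM => k lt_k; rewrite !Halpha // (eqP (Hc k lt_k)).
- move=> lt_u _ Hc; apply/eqP/congM => k lt_k; rewrite Halpha // (eqP (Hc k lt_k)) /=.
  by rewrite modulus_cong //; exact: leq_trans le_yW.
- move=> lt_u le_n Hc; apply/andP; split; first by rewrite /W; lia.
  by apply/eqP/congM => k lt_k; rewrite Halpha // (eqP (Hc k lt_k)).
- move=> /and3P[lt_u lt_v lt_w] _ Hc; rewrite !boundM //=.
  apply/eqP/congM => k lt_k; rewrite Halpha // (eqP (Hc k lt_k)).
  by rewrite -modnDm -!Halpha // modnDm.
- move=> /and3P[lt_u lt_v lt_w] _ Hc; rewrite !boundM //=.
  apply/eqP/congM => k lt_k; rewrite Halpha // (eqP (Hc k lt_k)).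
  by rewrite -modnMm -!Halpha // modnMm.
Qed.

Lemma dio_eqb f g : dfun f -> dfun g -> dio (fun nu => f nu == g nu).
Proof. by move=> Hf Hg; apply: dio_iff (dio_eq Hf Hg) => nu; split=> /eqP. Qed.

Lemma dio_andb (p q : (nat -> nat) -> bool) :
  dio (fun nu => p nu) -> dio (fun nu => q nu) -> dio (fun nu => p nu && q nu).
Proof. by move=> Hp Hq; apply: dio_iff (dio_and Hp Hq) => nu; split=> /andP. Qed.

Lemma dio_true : dio (fun=> is_true true).
Proof. by apply: dio_iff (dio_eq (dfun_const 0) (dfun_const 0)). Qed.

Ltac dio_step8 :=
  first [dio_step7 | match goal with
  | |- dfun (fun nu => (@?f nu).-1) => apply: (dfun_pred (f := f))
  | |- dio (fun nu => is_true (@?f nu == @?g nu)) => apply: (dio_eqb (f := f) (g := g))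
  | |- dio (fun nu => is_true (@?f nu && @?g nu)) => apply: (dio_andb (p := f) (q := g))
  end].
Ltac dio ::= repeat (dio_step8; cbv beta).

(** Of the function [alpha] only the first [V] values are visible to [P], so [V] existential
    quantifiers suffice. *)
Lemma dio_ex_seq P V : dio P ->
  dio (fun nu => exists alpha : nat -> nat, P (fun i => if i < V then alpha i else nu (i - V))).
Proof.
move=> [A HA]; exists (iter V FEx A) => nu.
have {HA} -> : (exists alpha, P (fun i => if i < V then alpha i else nu (i - V))) <->
  exists alpha, sem A (fun i => if i < V then alpha i else nu (i - V)).
  by split=> -[alpha H]; exists alpha; apply/HA.
elim: V A => [|V IHV] A.
  split=> [H|[alpha H]]; [exists nu|]; by apply: (iffLR (sem_ext A _)) H => i; rewrite subn0.
rewrite iterSr; rewrite -> IHV; split=> [[alpha [x H]]|[alpha H]].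
  by exists (scons x alpha); apply: (iffLR (sem_ext A _)) H => -[|i].
exists (fun i => alpha i.+1), (alpha 0).
by apply: (iffLR (sem_ext A _)) H => -[|i].
Qed.

Lemma holds_mod_ext B W y alpha beta nu c V : var_bound c <= V ->
  (forall u, u < V -> alpha u = beta u) ->
  holds_mod B W y alpha nu c = holds_mod B W y beta nu c.
Proof.
by case: c => [u n|u v|u [|i]|u v w|u v w] /=; rewrite ?geq_max => H E;
  rewrite !E //; case/andP: H => // ? /andP[].
Qed.

Lemma dio_holds_mod V l : dio (fun mu =>
  all (holds_mod (mu V) (mu V.+1) (mu V.+2) mu (fun i => mu (V + i.+3))) l).
Proof.
elim: l => [|c l IHl] /=; first exact: dio_true.
apply: dio_andb => //.
by case: c => [u n|u v|u [|i]|u v w|u v w] /=; dio.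
Qed.

(** Only conjunctions of constraints can be checked modulo all the moduli at once, so the body is
    first turned into the system [elems A] with verdict 0. *)
Lemma dio_forall_lt (P : nat -> (nat -> nat) -> Prop) b :
  dfun b -> dio (fun nu => P (nu 0) (fun i => nu i.+1)) ->
  dio (fun nu => forall k, k < b nu -> P k nu).
Proof.
move=> Hb [A HA]; apply: (dio_let (P := fun y nu => forall k, k < y -> P k nu) Hb).
pose l := CNat 0 0 :: elems A; pose V := foldr (fun c m => maxn (var_bound c) m) 0 l.
(* With [B] innermost, the indices after the [V] values of [alpha] are [B], [W] and the bound, the
   order expected by [dio_holds_mod]. *)
apply: (@dio_iff (fun nu => exists W, exists B,
   2 < W /\ nu 0 <= W /\ B + B <= W /\ B * B <= W /\ exists alpha,
   all (holds_mod B W (nu 0) alpha (fun i => nu i.+1)) l)); last first.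
  dio.
  apply: dio_iff (dio_ex_seq V (dio_holds_mod V l)) => nu.
  have vbl := all_leq_max var_bound l; rewrite -/V in vbl.
  have key mu alpha : (forall i, mu (V + i) = nu i) -> (forall u, u < V -> mu u = alpha u) ->
      all (holds_mod (mu V) (mu V.+1) (mu V.+2) mu (fun i => mu (V + i.+3))) l =
      all (holds_mod (nu 0) (nu 1) (nu 2) alpha (fun i => nu i.+3)) l.
    move=> E Ea; have [E0 E1 E2] := And3 (E 0) (E 1) (E 2).
    rewrite addn0 in E0; rewrite addn1 in E1; rewrite addn2 in E2; rewrite E0 E1 E2.
    elim: (l) vbl => //= c l' IHl /andP[vb /IHl ->]; congr (_ && _).
    rewrite (holds_mod_ext _ _ _ _ vb Ea).
    by case: (c) => [u n|u v|u [|i]|u v w|u v w] //=; rewrite E.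
  have E alpha i : (if V + i < V then alpha (V + i) else nu (V + i - V)) = nu i.
    by rewrite ltnNge leq_addr /= addKn.
  have Ea alpha u : u < V -> (if u < V then alpha u else nu (u - V)) = alpha u by move->.
  split=> -[alpha H]; exists alpha; first by rewrite (key _ _ (E alpha) (Ea alpha)) in H.
  by rewrite (key _ _ (E alpha) (Ea alpha)).
move=> nu; have HP k : P k (fun i => nu i.+1) <->
    exists phi, all (holds phi (scons k (fun i => nu i.+1))) l.
  have [H1 H2] := HA (scons k (fun i => nu i.+1)); have [H3 H4] := elemsP A (scons k (fun i => nu i.+1)).
  split=> [/H2/H3[phi [Hphi z]]|[phi /= /andP[/eqP z Hphi]]]; first by exists phi; rewrite /= z.
  by apply/H1/H4; exists phi.
have [H1 H2] := holds_modP l (nu 0) (fun i => nu i.+1).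
split=> [[W [B [? [? [? [? [alpha ?]]]]]]] k lt_k|H].
  by apply/HP; apply: H2 k lt_k; exists B, W, alpha.
have [|B [W [alpha [? [? [? [? ?]]]]]]] := H1; first by move=> k /H/HP.
by exists W, B; do 4!split=> //; exists alpha.
Qed.

Ltac dio_step9 :=
  first [dio_step8 | match goal with
  | |- dio (fun nu => forall k, is_true (k < @?b nu) -> @?Q nu k) =>
      let P := constr:(fun k nu => Q nu k) in apply (@dio_forall_lt P b)
  end].
Ltac dio ::= repeat (dio_step9; cbv beta).

(** * Reflexive-transitive closure *)

Lemma rtc_mono A (R S : A -> A -> Prop) x y : (forall u v, R u v -> S u v) ->
  clos_refl_trans _ R x y -> clos_refl_trans _ S x y.
Proof.
move=> RS; elim=> [u v /RS Suv|u|u v z _ IH1 _ IH2]; first exact: rt_step.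
  exact: rt_refl.
exact: rt_trans IH1 IH2.
Qed.

Lemma rtc_seq A (R : A -> A -> Prop) x y : clos_refl_trans _ R x y <->
  exists k f, f 0 = x /\ f k = y /\ forall i, i < k -> R (f i) (f i.+1).
Proof.
split=> [/clos_rt_rtn1_iff|[k [f [<- [<-]]]]].
  elim=> [|z w Rzw _ [k [f [f0 [fk Hf]]]]]; first by exists 0, (fun=> x).
  exists k.+1, (fun i => if i <= k then f i else w); rewrite leq0n ltnn; split=> //; split=> //.
  move=> i; rewrite ltnS => le_ik; rewrite le_ik.
  by move: le_ik; rewrite leq_eqVlt => /predU1P[->|lt_ik]; [rewrite ltnn fk | rewrite lt_ik; exact: Hf].
elim: k => [|k IHk] Hf; first exact: rt_refl.
apply: rt_trans (IHk _) (rt_step _ _ _ _ (Hf k _)) => // i lt_ik; apply: Hf; exact: ltnW.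
Qed.

(** All large bases are allowed, so that two sequences can be written in a common one. *)
Lemma encode_fun (f : nat -> nat) n : exists b0, forall b, b0 <= b -> exists C,
  forall i, i <= n -> digit b C i = f i.
Proof.
exists (\max_(i < n.+1) f i).+1 => b le_b; exists (encode b (mkseq f n.+1)) => i le_in.
rewrite digit_encode ?nth_mkseq //; first exact: leq_trans le_b.
apply/allP=> x /mapP[j]; rewrite mem_iota add0n => /andP[_ lt_j] ->.
by apply: leq_trans le_b; exact: (leq_bigmax (F := fun i : 'I__ => f i) (Ordinal lt_j)).
Qed.

Lemma dio_rtc (S : nat -> nat -> nat -> nat -> (nat -> nat) -> Prop) f1 f2 g1 g2 :
  dio (fun nu => S (nu 0) (nu 1) (nu 2) (nu 3) (fun i => nu i.+4)) ->
  dfun f1 -> dfun f2 -> dfun g1 -> dfun g2 ->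
  dio (fun nu => clos_refl_trans (nat * nat) (fun u v => S u.1 u.2 v.1 v.2 nu)
        (f1 nu, f2 nu) (g1 nu, g2 nu)).
Proof.
move=> HS Hf1 Hf2 Hg1 Hg2.
apply: (@dio_iff (fun nu => exists k b C D,
  digit b C 0 = f1 nu /\ digit b D 0 = f2 nu /\ digit b C k = g1 nu /\ digit b D k = g2 nu /\
  forall i, i < k -> exists x y x' y', (x = digit b C i /\ y = digit b D i /\
    x' = digit b C i.+1 /\ y' = digit b D i.+1) /\ S x y x' y' nu)); last first.
  dio.
  (* The arguments of [S] are bound as variables 3, 2, 1, 0, and the five variables [i], [D], [C],
     [b], [k] lie between them and the parameters. *)
  pose r i := if i is j.+4 then j.+4.+4.+1 else 3 - i.
  exact: (dio_ren r HS).
move=> nu; split.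
  move=> [k [b [C [D [<- [<- [<- [<- H]]]]]]]]; apply/rtc_seq.
  exists k, (fun i => (digit b C i, digit b D i)); split=> //; split=> // i /H.
  by move=> [x [y [x' [y' [[-> [-> [-> ->]]]]]]]].
move=> /rtc_seq[k [f [f0 [fk H]]]]; exists k.
have [b1 Hb1] := encode_fun (fun i => (f i).1) k.
have [b2 Hb2] := encode_fun (fun i => (f i).2) k.
have [C HC] := Hb1 (b1 + b2) (leq_addr _ _); have [D HD] := Hb2 (b1 + b2) (leq_addl _ _).
exists (b1 + b2), C, D; rewrite !HC // !HD // f0 fk; do 4!split=> //.
move=> i lt_ik; exists (f i).1, (f i).2, (f i.+1).1, (f i.+1).2.
by rewrite !HC ?HD //; [split=> //; exact: H | exact: ltnW | exact: ltnW].
Qed.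

(** Embeds relations on numbers, as in FRACTRAN, into the closure on pairs that PCP requires; the
    second component is left arbitrary. *)
Lemma rtc_fst (R : nat -> nat -> Prop) x y :
  clos_refl_trans _ R x y <->
  exists w, clos_refl_trans (nat * nat) (fun u v => R u.1 v.1) (x, 0) (y, w).
Proof.
split=> [H|[w]].
  exists 0; elim: H => [u v Ruv|u|u v z _ IH1 _ IH2]; first exact: rt_step.
    exact: rt_refl.
  exact: rt_trans IH1 IH2.
have E1 : x = (x, 0).1 by []. have E2 : y = (y, w).1 by [].
rewrite {2}E1 {2}E2; move: (x, 0) (y, w) => u v.
elim=> {x y w E1 E2 u v} [u v Ruv|u|u v z _ IH1 _ IH2]; first exact: rt_step.
  exact: rt_refl.
exact: rt_trans IH1 IH2.
Qed.

(** * Instances as digits of a number *)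

Definition table (w : nat) (rows : seq (seq nat)) := all (fun r => size r == w) rows.

Lemma nth_table w rows j c : table w rows -> c < w ->
  nth 0 (flatten rows) (w * j + c) = nth 0 (nth [::] rows j) c.
Proof.
move=> + lt_c; elim: rows j => [|r rows IHr] j /=; first by rewrite !nth_nil.
case/andP=> /eqP size_r /IHr {}IHr; rewrite nth_cat size_r.
case: j => [|j]; first by rewrite muln0 lt_c.
by rewrite mulnS -addnA ltnNge leq_addr /= addKn IHr.
Qed.

Definition base (rows : seq (seq nat)) := (sumn (flatten rows)).+1.

Lemma digit_table w rows j c : table w rows -> c < w ->
  digit (base rows) (encode (base rows) (flatten rows)) (w * j + c) = nth 0 (nth [::] rows j) c.
Proof.
move=> Hr lt_c; rewrite digit_encode //; first exact: nth_table.
rewrite /base; elim: (flatten rows) => //= x s IHs; rewrite ltnS leq_addr /=.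
apply: sub_all IHs => y; rewrite !ltnS => /leq_trans; apply; exact: leq_addl.
Qed.

Definition code_params (s : nat) (rows : seq (seq nat)) :=
  [:: s; size rows; base rows; encode (base rows) (flatten rows)].

(** ** FRACTRAN *)

Definition fractran_rows (Q : seq (nat * nat)) := [seq [:: e.1; e.2] | e <- Q].

(** Formulas have no negation, so indivisibility is rendered as a positive remainder. This is right
    even for denominator 0, since [m %% 0 = m]. *)
Lemma fractran_stepP Q x y : fractran_step Q x y <-> exists2 j, j < size Q &
  (nth (0, 0) Q j).2 * y = (nth (0, 0) Q j).1 * x /\
  forall i, i < j -> 0 < ((nth (0, 0) Q i).1 * x) %% (nth (0, 0) Q i).2.
Proof.
split=> [|[j]].
  elim=> {Q x y} [p q Q x y E|p q Q x y nd _ [j lt_j [E H]]]; first by exists 0.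
  by exists j.+1 => //; split=> // -[_|i lt_i] /=; [rewrite lt0n | exact: H].
elim: j Q => [|j IHj] [|[p q] Q] // lt_j [E H]; first exact: fractran_here.
apply: fractran_next; first by rewrite /dvdn -lt0n; exact: (H 0).
by apply: IHj => //; split=> // i lt_i; exact: (H i.+1).
Qed.

Lemma fractran_stopP Q x : (forall y, ~ fractran_step Q x y) <->
  forall j, j < size Q -> 0 < ((nth (0, 0) Q j).1 * x) %% (nth (0, 0) Q j).2.
Proof.
split=> [H|H y /fractran_stepP[j lt_j [E _]]]; last first.
  by have := H j lt_j; rewrite -E modnMr.
elim: Q H => [|[p q] Q IHQ] H //.
have nd : ~~ (q %| p * x).
  by apply/negP=> /dvdnP[y E]; apply: (H y); apply: fractran_here; rewrite E mulnC.
case=> [_|j] /=; first by rewrite lt0n.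
by apply: IHQ => y Hy; apply: (H y); exact: fractran_next.
Qed.

Lemma dio_fractran : dio (fun nu => exists x,
  (exists w, clos_refl_trans (nat * nat) (fun u v => exists j, j < nu 1 /\
     digit (nu 2) (nu 3) (2 * j + 1) * v.1 = digit (nu 2) (nu 3) (2 * j + 0) * u.1 /\
     forall i, i < j -> 0 < (digit (nu 2) (nu 3) (2 * i + 0) * u.1) %% digit (nu 2) (nu 3) (2 * i + 1))
   (nu 0, 0) (x, w)) /\
  forall i, i < nu 1 -> 0 < (digit (nu 2) (nu 3) (2 * i + 0) * x) %% digit (nu 2) (nu 3) (2 * i + 1)).
Proof.
dio.
apply: (dio_rtc (S := fun x _ x' _ nu => exists j, j < nu 3 /\
     digit (nu 4) (nu 5) (2 * j + 1) * x' = digit (nu 4) (nu 5) (2 * j + 0) * x /\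
     forall i, i < j -> 0 < (digit (nu 4) (nu 5) (2 * i + 0) * x) %% digit (nu 4) (nu 5) (2 * i + 1))); dio.
Qed.

Lemma fractran_form : exists A, forall Q s,
  sem A (nth 0 (code_params s (fractran_rows Q))) <-> FRACTRAN (Q, s).
Proof.
have [A HA] := dio_fractran; exists A => Q s; rewrite -> HA; clear.
have T : table 2 (fractran_rows Q) by rewrite /table all_map; exact/allP.
have D j : j < size Q -> 
    digit (base (fractran_rows Q)) (encode (base (fractran_rows Q)) (flatten (fractran_rows Q))) (2 * j + 0)
      = (nth (0, 0) Q j).1 /\
    digit (base (fractran_rows Q)) (encode (base (fractran_rows Q)) (flatten (fractran_rows Q))) (2 * j + 1)
      = (nth (0, 0) Q j).2.
  by move=> lt_j; rewrite !digit_table // (nth_map (0, 0)).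
set b := base _ in D *; set L := encode b _ in D *.
have stepE x y : (exists j, j < size Q /\ digit b L (2 * j + 1) * y = digit b L (2 * j + 0) * x /\
     forall i, i < j -> 0 < (digit b L (2 * i + 0) * x) %% digit b L (2 * i + 1)) <->
     fractran_step Q x y.
  split=> [[j [lt_j [E H]]]|/fractran_stepP[j lt_j [E H]]].
    apply/fractran_stepP; exists j => //; have [<- <-] := D j lt_j; split=> // i lt_i.
    by have [<- <-] := D i (ltn_trans lt_i lt_j); exact: H.
  exists j; split=> //; have [-> ->] := D j lt_j; split=> // i lt_i.
  by have [-> ->] := D i (ltn_trans lt_i lt_j); exact: H.
split=> [[x [[w Hx] stop]]|[x [Hx /fractran_stopP stop]]]; exists x; split.
- apply/rtc_fst; exists w; apply: rtc_mono Hx => u v.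
  by rewrite [nth _ _ _]size_map => /stepE.
- apply/fractran_stopP => j lt_j; have [<- <-] := D j lt_j; apply: stop.
  by rewrite [nth _ _ _]size_map.
- have [w Hw] := iffLR (rtc_fst _ _ _) Hx; exists w; apply: rtc_mono Hw => u v.
  by move/stepE; rewrite [nth _ _ 1]size_map.
- move=> j; rewrite [nth _ _ 1]size_map => lt_j.
  by have [E1 E2] := D j lt_j; rewrite [digit _ _ _]E1 [digit _ _ _]E2; exact: stop.
Qed.

(** ** PCP *)

Lemma encode_cat b s t : encode b (s ++ t) = encode b s + b ^ size s * encode b t.
Proof. by elim: s => [|x s IHs] /=; rewrite ?mul1n // IHs expnS mulnDr mulnA addnA. Qed.

(** Letters are shifted to nonzero digits, as trailing zeros would not show in the number. *)
Definition word_code (b : nat) (w : seq nat) := encode b [seq x.+1 | x <- w].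

Lemma word_code_cat b u v : word_code b (u ++ v) = word_code b u + b ^ size u * word_code b v.
Proof. by rewrite /word_code map_cat encode_cat size_map. Qed.

Lemma digits_inj b x y m n : x < b -> y < b -> x + b * m = y + b * n -> x = y /\ m = n.
Proof.
move=> lt_x lt_y E; have b_gt0 : 0 < b by apply: leq_ltn_trans lt_x.
have Dx z k : z < b -> (z + b * k) %% b = z /\ (z + b * k) %/ b = k.
  by move=> lt_z; rewrite addnC mulnC modnMDl divnMDl // modn_small // divn_small // addn0.
have [Mx Qx] := Dx x m lt_x; have [My Qy] := Dx y n lt_y.
by split; [rewrite -Mx -My E | rewrite -Qx -Qy E].
Qed.

Lemma word_code_inj b u v : all (fun x => x.+1 < b) u -> all (fun x => x.+1 < b) v ->
  word_code b u = word_code b v -> u = v.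
Proof.
rewrite /word_code; elim: u v => [|x u IHu] [|y v] //= /andP[lt_x Hu] /andP[lt_y Hv].
by case/(digits_inj lt_x lt_y) => -[->] /(IHu _ Hu Hv) ->.
Qed.

(** Prepending a word is an affine map on word codes; its two coefficients are stored for each side
    of a domino. *)
Definition pcp_rows (b : nat) (P : seq (seq nat * seq nat)) :=
  [seq [:: b ^ size e.1; word_code b e.1; b ^ size e.2; word_code b e.2] | e <- P].

Definition pcp_base (P : seq (seq nat * seq nat)) :=
  (sumn (flatten [seq e.1 ++ e.2 | e <- P])).+2.

Definition pcp_params P := behead (code_params 0 (pcp_rows (pcp_base P) P)).

Definition pcp_step (m b L : nat) (T S T' S' : nat) := exists j, j < m /\
  T' = digit b L (4 * j + 1) + digit b L (4 * j + 0) * T /\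
  S' = digit b L (4 * j + 3) + digit b L (4 * j + 2) * S.

(** The first step is kept out of the closure because a solution uses at least one domino. *)
Lemma dio_pcp : dio (fun nu => exists U T S, pcp_step (nu 0) (nu 1) (nu 2) 0 0 T S /\
  clos_refl_trans (nat * nat) (fun u v => pcp_step (nu 0) (nu 1) (nu 2) u.1 u.2 v.1 v.2)
    (T, S) (U, U)).
Proof.
rewrite /pcp_step; dio.
apply: (dio_rtc (S := fun T S T' S' nu => pcp_step (nu 3) (nu 4) (nu 5) T S T' S'));
  rewrite /pcp_step; dio.
Qed.

Lemma pcp_form : exists A, forall P, sem A (nth 0 (pcp_params P)) <-> PCP P.
Proof.
have [A HA] := dio_pcp; exists A => P; rewrite -> HA; clear A HA.
pose B := pcp_base P; pose rows := pcp_rows B P.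
have T : table 4 rows by rewrite /table all_map; exact/allP.
have D j c : c < 4 -> j < size P -> let e := nth ([::], [::]) P j in
    digit (base rows) (encode (base rows) (flatten rows)) (4 * j + c) =
    nth 0 [:: B ^ size e.1; word_code B e.1; B ^ size e.2; word_code B e.2] c.
  by move=> lt_c lt_j; rewrite digit_table // (nth_map ([::], [::])).
rewrite /pcp_params -/B -/rows /= size_map.
set b := base rows in D *; set L := encode b _ in D *.
pose top (I : seq 'I_(size P)) := flatten [seq (tnth (in_tuple P) i).1 | i <- I].
pose bot (I : seq 'I_(size P)) := flatten [seq (tnth (in_tuple P) i).2 | i <- I].
have stepE I T' S' : pcp_step (size P) b L (word_code B (top I)) (word_code B (bot I)) T' S' <->
    exists i, T' = word_code B (top (i :: I)) /\ S' = word_code B (bot (i :: I)).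
  split=> [[j [lt_j []]]|[i [-> ->]]]; rewrite /top /bot /=.
    rewrite !D //= => -> ->; exists (Ordinal lt_j).
    by rewrite !word_code_cat !(tnth_nth ([::], [::])).
  by exists i; rewrite !D //= !word_code_cat !(tnth_nth ([::], [::])).
have letters (f : seq nat * seq nat -> seq nat) I :
    (forall e, {subset f e <= e.1 ++ e.2}) ->
    all (fun x => x.+1 < B) (flatten [seq f (tnth (in_tuple P) i) | i <- I]).
  move=> sub_f; apply/allP=> x /flattenP[_ /mapP[i _ ->]] /sub_f x_in.
  have : x \in flatten [seq e.1 ++ e.2 | e <- P].
    by apply/flattenP; exists ((tnth (in_tuple P) i).1 ++ (tnth (in_tuple P) i).2);
      first by apply/mapP; exists (tnth (in_tuple P) i) ; first exact: mem_tnth.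
  rewrite /B /pcp_base !ltnS; elim: (flatten _) => //= y s IHs.
  by rewrite inE => /predU1P[->|/IHs]; [exact: leq_addr | move/leq_trans; apply; exact: leq_addl].
split=> [[U [T0 [S0 [Hs Hr]]]]|[I [I_nil E]]].
  have {Hs} [i [E1 E2]] := iffLR (stepE [::] T0 S0) Hs.
  suff H u v : clos_refl_trans (nat * nat)
      (fun u v => pcp_step (size P) b L u.1 u.2 v.1 v.2) u v ->
      (exists i I, u = (word_code B (top (i :: I)), word_code B (bot (i :: I)))) ->
      (exists i I, v = (word_code B (top (i :: I)), word_code B (bot (i :: I)))).
    have [|i' [I [EU EV]]] := H _ _ Hr; first by exists i, [::]; rewrite E1 E2.
    exists (i' :: I); split=> //; apply: (word_code_inj (b := B)); last by rewrite -EU.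
      by apply: letters => e x; rewrite mem_cat => ->.
    by apply: letters => e x; rewrite mem_cat orbC => ->.
  elim=> {u v} [u [T' S'] + [j [I Eu]]|//|u v w _ IH1 _ IH2 Hu]; last by auto.
  by rewrite Eu => /(stepE (j :: I))[k [/= -> ->]]; exists k, (j :: I).
have H i J : exists T0 S0, pcp_step (size P) b L 0 0 T0 S0 /\
  clos_refl_trans (nat * nat) (fun u v => pcp_step (size P) b L u.1 u.2 v.1 v.2)
    (T0, S0) (word_code B (top (i :: J)), word_code B (bot (i :: J))).
  elim: J i => [|j J IHJ] i.
    exists (word_code B (top [:: i])), (word_code B (bot [:: i])).
    by split; [apply/(stepE [::]); exists i | exact: rt_refl].
  have [T0 [S0 [H1 H2]]] := IHJ j; exists T0, S0; split=> //.
  by apply: rt_trans H2 (rt_step _ _ _ _ _); apply/stepE; exists i.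
case: I I_nil E => // i J _ E; have [T0 [S0 [H1 H2]]] := H i J.
by exists (word_code B (top (i :: J))), T0, S0; split=> //; rewrite {2}/top E.
Qed.

(** * Loop programs over counters *)

Definition upd (s : nat -> nat) (r x : nat) : nat -> nat :=
  fun r' => if r' == r then x else s r'.

Inductive cmd :=
  | Skip
  | Inc of nat
  | Dec of nat
  | Seq of cmd & cmd
  | Loop of nat & cmd.

(* [Loop r c] runs [c] and decrements [r] until [r] is zero, where [c] must not
   assign [r]. *)
Fixpoint run (c : cmd) (s : nat -> nat) : nat -> nat :=
  match c with
  | Skip => s
  | Inc r => upd s r (s r).+1
  | Dec r => upd s r (s r).-1
  | Seq c d => run d (run c s)
  | Loop r c => iteri (s r) (fun j t => run c (upd t r (s r - j).-1)) s
  end.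

Fixpoint assigned (c : cmd) : seq nat :=
  match c with
  | Skip => [::]
  | Inc r | Dec r => [:: r]
  | Seq c d => assigned c ++ assigned d
  | Loop r c => r :: assigned c
  end.

Fixpoint wf (c : cmd) : bool :=
  match c with
  | Skip | Inc _ | Dec _ => true
  | Seq c d => wf c && wf d
  | Loop r c => (r \notin assigned c) && wf c
  end.

Lemma upd_ext s t r x : s =1 t -> upd s r x =1 upd t r x.
Proof. by move=> E r'; rewrite /upd E. Qed.

Lemma run_ext c s t : s =1 t -> run c s =1 run c t.
Proof.
elim: c s t => [|r|r|c IHc d IHd|r c IHc] s t E //=; rewrite ?E; try exact: upd_ext.
  by apply: IHd; apply: IHc.
elim: {1 3}(t r) => //= j IHj; apply: IHc; exact: upd_ext.
Qed.

Lemma run_unassigned c s r : r \notin assigned c -> run c s r = s r.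
Proof.
elim: c s => [|r'|r'|c IHc d IHd|r' c IHc] s //=; rewrite ?inE /upd.
- by move/negPf->.
- by move/negPf->.
- by rewrite mem_cat negb_or => /andP[Hc Hd]; rewrite IHd ?IHc.
case/norP=> ne Hc; elim: {1}(s r') => //= j IHj.
by rewrite IHc // (negPf ne).
Qed.

Lemma run_loop r c s (J : nat -> nat -> nat) : J 0 =1 s ->
  (forall j, j < s r -> run c (upd (J j) r (s r - j).-1) =1 J j.+1) ->
  run (Loop r c) s =1 J (s r).
Proof.
move=> J0 JS /=; suff H k : k <= s r ->
    iteri k (fun j t => run c (upd t r (s r - j).-1)) s =1 J k by exact: H.
elim: k => [|k IHk] lt_k /=; first by move=> x; rewrite J0.
move=> x; rewrite -JS //; apply: run_ext; apply: upd_ext; exact/IHk/ltnW.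
Qed.

(** * Compilation to Minsky machines *)

Section Compile.
Variable n : nat.

(* Register 0 is never assigned: [DEC 0] is an unconditional jump. *)
Fixpoint compile (c : cmd) (l : nat) : seq (instr n.+1) :=
  match c with
  | Skip => [::]
  | Inc r => [:: INC (inord r)]
  | Dec r => [:: DEC (inord r) l.+1]
  | Seq c d => compile c l ++ compile d (l + size (compile c l))
  | Loop r c => DEC (inord r) (l + (size (compile c l.+1)).+2) ::
                rcons (compile c l.+1) (DEC ord0 l)
  end.

Definition rep (s : nat -> nat) : {ffun 'I_n.+1 -> nat} := [ffun i : 'I_n.+1 => s i].

Lemma rep_ext s t : s =1 t -> rep s = rep t.
Proof. by move=> E; apply/ffunP=> i; rewrite !ffunE E. Qed.

Lemma rep_upd s r x : r <= n -> update (rep s) (inord r) x = rep (upd s r x).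
Proof.
by move=> le_rn; apply/ffunP=> i; rewrite !ffunE /upd -(inj_eq val_inj) /= inordK.
Qed.

Lemma rep_inord s r : r <= n -> rep s (inord r) = s r.
Proof. by move=> le_rn; rewrite ffunE inordK. Qed.

Lemma labels_nth (P : seq (instr n.+1)) pre i post : P = pre ++ i :: post ->
  labels (1, P) (size pre).+1 i.
Proof.
by move=> ->; split=> //=; rewrite subSS subn0; elim: pre.
Qed.

Lemma compileP c P pre post l s : P = pre ++ compile c l ++ post -> l = (size pre).+1 ->
  wf c -> all (fun r => 0 < r <= n) (assigned c) -> s 0 = 0 ->
  clos_refl_trans _ (mm_step (1, P)) (l, rep s) (l + size (compile c l), rep (run c s)).
Proof.
elim: c pre post l s => [|r|r|c IHc d IHd|r c IHc] pre post l s /= EP El wf_c Hr s0.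
- by rewrite addn0; exact: rt_refl.
- have /andP[/andP[_ le_r] _] := Hr; have Hl := labels_nth EP; rewrite -El in Hl.
  apply: rt_step; rewrite addn1 -rep_upd // -(rep_inord s le_r); exact: mm_step_inc.
- have /andP[/andP[_ le_r] _] := Hr; have Hl := labels_nth EP; rewrite -El in Hl.
  apply: rt_step; rewrite addn1; have [s_r|s_r] := posnP (s r).
    have -> : rep (upd s r (s r).-1) = rep s.
      by apply: rep_ext => x; rewrite /upd s_r; case: eqP => [->|].
    by apply: mm_step_jump Hl _; rewrite rep_inord.
  by rewrite -rep_upd // -(rep_inord s le_r); apply: mm_step_dec Hl _; rewrite rep_inord.
- move: Hr; rewrite all_cat => /andP[Hc Hd]; have /andP[wc wd] := wf_c.
  have n0 e : all (fun r => 0 < r <= n) (assigned e) -> run e s 0 = 0.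
    move=> He; rewrite run_unassigned //; apply/negP=> /(allP He); by rewrite ltnn.
  apply: rt_trans (IHc pre (compile d (l + size (compile c l)) ++ post) l s _ El wc Hc s0) _.
    by rewrite EP -catA.
  rewrite size_cat addnA.
  apply: (IHd (pre ++ compile c l) post) => //; first by rewrite EP -!catA.
    by rewrite size_cat -addSn -El.
  by apply: n0.
have /andP[/andP[r_gt0 le_r] Hc] := Hr; have /andP[r_c wc] := wf_c.
have Hl1 := labels_nth EP; rewrite -El in Hl1.
have EP2 : P = (pre ++ DEC (inord r) (l + (size (compile c l.+1)).+2) :: compile c l.+1) ++
   DEC ord0 l :: post by rewrite EP -cats1 -!catA.
have Hl2 := labels_nth EP2; rewrite size_cat /= addnS -addSn -El -addSn in Hl2.
have EP3 : P = (pre ++ [:: DEC (inord r) (l + (size (compile c l.+1)).+2)]) ++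
   compile c l.+1 ++ (DEC ord0 l :: post) by rewrite EP -cats1 -!catA.
rewrite size_rcons.
pose f j t := run c (upd t r (s r - j).-1); rewrite -[iteri _ _ _]/(iteri (s r) f s).
set K := s r.
have step j : j <= K -> iteri j f s r = K - j /\ iteri j f s 0 = 0 /\
    clos_refl_trans _ (mm_step (1, P)) (l, rep s) (l, rep (iteri j f s)).
  elim: j => [|j IHj] lt_j; first by rewrite subn0; do 2!split=> //; exact: rt_refl.
  have := IHj (ltnW lt_j); set t := iteri j f s => -[Er [E0 Hj]].
  set t' := upd t r (K - j).-1.
  have t'0 : t' 0 = 0 by rewrite /t' /upd; case: eqP => [E|_ //]; rewrite -E in r_gt0.
  have -> : iteri j.+1 f s = run c t' by [].
  split; first by rewrite run_unassigned // /t' /upd eqxx; lia.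
  split; first by rewrite run_unassigned //; apply/negP=> /(allP Hc); rewrite ltnn.
  apply: rt_trans Hj (rt_trans _ _ _ (l.+1, rep t') _ _ _).
    apply: rt_step; rewrite -rep_upd // -Er -(rep_inord t le_r).
    by apply: mm_step_dec Hl1 _; rewrite rep_inord // Er subn_gt0.
  apply: rt_trans (IHc _ _ _ _ EP3 _ wc Hc t'0) _; first by rewrite size_cat addn1 -El.
  apply: rt_step; apply: mm_step_jump Hl2 _.
  by rewrite ffunE run_unassigned //; apply/negP=> /(allP Hc); rewrite ltnn.
have [Er [_ HK]] := step K (leqnn K); apply: rt_trans HK (rt_step _ _ _ _ _).
by apply: mm_step_jump Hl1 _; rewrite rep_inord // Er subnn.
Qed.

Fixpoint stepn A (R : A -> A -> Prop) (k : nat) (x y : A) : Prop :=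
  if k is k'.+1 then exists z, R x z /\ stepn R k' z y else x = y.

Lemma rtc_stepn A (R : A -> A -> Prop) x y : clos_refl_trans _ R x y <-> exists k, stepn R k x y.
Proof.
split=> [/clos_rt_rt1n_iff|[k]].
  elim=> [z|z w v Rzw _ [k Hk]]; first by exists 0.
  by exists k.+1, w.
elim: k x => [|k IHk] x /=; first by move->; exact: rt_refl.
by move=> [z [Rxz /IHk]]; apply: rt_trans; exact: rt_step.
Qed.

(** In a deterministic system every run is a prefix of the run that gets stuck. A simulation by at
    least one step therefore reflects termination, by induction on the number of steps left. *)
Lemma stepn_det A (R : A -> A -> Prop) j k x y z :
  (forall u v w, R u v -> R u w -> v = w) -> (forall w, ~ R z w) ->
  stepn R j x y -> stepn R k x z -> j <= k /\ stepn R (k - j) y z.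
Proof.
move=> det stuck; elim: j k x => [|j IHj] k x /=; first by move=> ->; rewrite subn0.
move=> [u [Rxu Hu]]; case: k => [/= Exz|k [w [Rxw Hw]]].
  by case: (stuck u); rewrite -Exz.
by rewrite (det _ _ _ Rxw Rxu) in Hw; exact: IHj Hu Hw.
Qed.

Lemma mm_step_det m (M : mm_machine m) x y z : mm_step M x y -> mm_step M x z -> y = z.
Proof.
have labE i a b : labels M i a -> labels M i b -> a = b by move=> [_ Ea] [_]; rewrite Ea => -[].
case=> [i v a L|i v a p L v_a|i v a p L v_a] H; inversion H as [? ? ? L'|? ? ? ? L'|? ? ? ? L']; subst;
  have := labE _ _ _ L L'; try done; case=> *; subst => //; lia.
Qed.

Lemma mm_step_outside m (M : mm_machine m) x y : outside M x.1 -> ~ mm_step M x y.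
Proof.
move=> out H; suff [a [le_i Ha]] : exists a, labels M x.1 a.
  case: out => [lt_i|le_s]; first by rewrite ltnNge le_i in lt_i.
  by move: Ha; rewrite onth_default // leq_subRL.
by case: H => *; eexists; eauto.
Qed.

End Compile.

(** The last instruction jumps back to label 1 while the flag is 0, and falls off the end of the
    code otherwise. *)
Definition repeat_machine n (c : cmd) (flag : nat) : seq (instr n.+1) :=
  rcons (compile n c 1) (DEC (inord flag) 1).

Lemma repeat_machineP n c flag s : wf c -> all (fun r => 0 < r <= n) (flag :: assigned c) ->
  s 0 = 0 ->
  mm_terminates (1, repeat_machine n c flag) (1, rep n s) <->
  exists t, 0 < iter t.+1 (run c) s flag.
Proof.
move=> wc /andP[/andP[flag_gt0 le_flag] Hc] s0; set P := repeat_machine n c flag.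
have EP : P = [::] ++ compile n c 1 ++ [:: DEC (inord flag) 1] by rewrite /P /repeat_machine -cats1.
have L : labels (1, P) (size (compile n c 1)).+1 (DEC (inord flag) 1).
  exact: (labels_nth (post := [::]) EP).
have keep0 t : t 0 = 0 -> run c t 0 = 0.
  by move=> t0; rewrite run_unassigned //; apply/negP=> /(allP Hc); rewrite ltnn.
have body t : t 0 = 0 -> clos_refl_trans _ (mm_step (1, P)) (1, rep n t)
    ((size (compile n c 1)).+1, rep n (run c t)).
  by move=> t0; have := compileP EP erefl wc Hc t0; rewrite add1n.
have pass t : t 0 = 0 -> run c t flag = 0 ->
    exists k, stepn (mm_step (1, P)) k.+1 (1, rep n t) (1, rep n (run c t)).
  move=> t0 F0; have [k Hk] := iffLR (rtc_stepn _ _ _) (body t t0).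
  exists k; elim: k (1, rep n t) Hk => [|k IHk] x.
    move=> /= ->; exists (1, rep n (run c t)); split=> //.
    by apply: mm_step_jump L _; rewrite rep_inord.
  by case=> z [Rxz /IHk Hz]; exists z.
split=> [[y [Hy out]]|[t Ht]].
  have [k {}Hy] := iffLR (rtc_stepn _ _ _) Hy.
  have stuck z : ~ mm_step (1, P) y z := mm_step_outside out.
  elim/ltn_ind: k s s0 Hy => k IHk s s0 Hy.
  have [F0|F_gt0] := posnP (run c s flag); last by exists 0.
  have [j Hj] := pass s s0 F0.
  have [lt_jk Hk] := stepn_det (@mm_step_det _ _) stuck Hj Hy.
  have [|t Ht] := IHk (k - j.+1) _ (run c s) (keep0 s s0) Hk; first by lia.
  by exists t.+1; rewrite iterSr.
elim: t s s0 Ht => [|t IHt] s s0 Ht.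
  exists ((size (compile n c 1)).+2, rep n (upd (run c s) flag (run c s flag).-1)); split.
    apply: rt_trans (body s s0) (rt_step _ _ _ _ _).
    by rewrite -rep_upd // -(rep_inord _ le_flag); apply: mm_step_dec L _; rewrite rep_inord.
  by right; rewrite /= /P /repeat_machine size_rcons add1n.
have [F0|F_gt0] := posnP (run c s flag); last first.
  exists ((size (compile n c 1)).+2, rep n (upd (run c s) flag (run c s flag).-1)); split.
    apply: rt_trans (body s s0) (rt_step _ _ _ _ _).
    by rewrite -rep_upd // -(rep_inord _ le_flag); apply: mm_step_dec L _; rewrite rep_inord.
  by right; rewrite /= /P /repeat_machine size_rcons add1n.
have [|y [Hy out]] := IHt (run c s) (keep0 s s0); first by rewrite -iterSr.
exists y; split=> //; have [k Hk] := pass s s0 F0.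
by apply: rt_trans Hy; apply/rtc_stepn; exists k.+1.
Qed.

(** * Deciding bounded truth of a formula *)

(* Counts witnesses below [N] instead of deciding their existence, so that the
   connectives become sums and products, which loops compute by accumulation. *)
Fixpoint count_sem (A : form) (N : nat) (nu : nat -> nat) : nat :=
  match A with
  | FNat i n => nu i == n
  | FVar i j => nu i == nu j
  | FAdd i j k => nu i == nu j + nu k
  | FMul i j k => nu i == nu j * nu k
  | FAnd A B => count_sem A N nu * count_sem B N nu
  | FOr A B => count_sem A N nu + count_sem B N nu
  | FEx A => \sum_(x < N) count_sem A N (scons x nu)
  end.

Lemma count_sem_ext A N nu mu : nu =1 mu -> count_sem A N nu = count_sem A N mu.
Proof.
elim: A nu mu => [i n|i j|i j k|i j k|A IHA B IHB|A IHA B IHB|A IHA] nu mu E /=; rewrite ?E //.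
- by rewrite (IHA _ _ E) (IHB _ _ E).
- by rewrite (IHA _ _ E) (IHB _ _ E).
- by apply: eq_bigr => x _; apply: IHA => -[|i] /=.
Qed.

Lemma count_sem_sound A N nu : 0 < count_sem A N nu -> sem A nu.
Proof.
elim: A nu => [i n|i j|i j k|i j k|A IHA B IHB|A IHA B IHB|A IHA] nu /=;
  try by case: eqP.
- by rewrite muln_gt0 => /andP[/IHA ? /IHB ?].
- by rewrite addn_gt0 => /orP[/IHA|/IHB]; [left|right].
- have [/forallP H|/forallPn[x]] := boolP [forall x : 'I_N, count_sem A N (scons x nu) == 0].
    by rewrite big1 // => x _; apply/eqP.
  by rewrite -lt0n => /IHA ? _; exists x.
Qed.

(** Stated for all large [N], so that the thresholds of two conjuncts can be combined. *)
Lemma count_sem_complete A nu : sem A nu -> exists N0, forall N, N0 <= N -> 0 < count_sem A N nu.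
Proof.
elim: A nu => [i n|i j|i j k|i j k|A IHA B IHB|A IHA B IHB|A IHA] nu /=;
  try by move->; exists 0; rewrite eqxx.
- move=> [/IHA[N1 H1] /IHB[N2 H2]]; exists (N1 + N2) => N le_N.
  by rewrite muln_gt0 H1 ?H2 //; lia.
- move=> [/IHA[N1 H1]|/IHB[N1 H1]]; exists N1 => N le_N; rewrite addn_gt0 H1 ?orbT //.
- move=> [x /IHA[N1 H1]]; exists (N1 + x.+1) => N le_N.
  have lt_xN : x < N by lia.
  by rewrite (bigD1 (Ordinal lt_xN)) //= addn_gt0 H1 //; lia.
Qed.

Lemma run_seq c d s t u : run c s =1 t -> run d t =1 u -> run (Seq c d) s =1 u.
Proof. by move=> Hc Hd x /=; rewrite (run_ext d Hc) Hd. Qed.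

Ltac upd :=
  rewrite /upd; repeat (match goal with
    |- context [?a == ?b] => case: (@eqP _ a b) => ?; subst; try (exfalso; lia); try lia
  end); rewrite ?addn0; try lia; try done.

Definition copy (a b t : nat) : cmd := Seq (Loop a (Seq (Inc t) (Inc b))) (Loop t (Inc a)).

Lemma run_copy a b t s : a <> b -> a <> t -> b <> t -> s t = 0 ->
  run (copy a b t) s =1 upd s b (s b + s a).
Proof.
move=> ab At bt st; apply: run_seq.
  apply: (run_loop (J := fun j => upd (upd (upd s a (s a - j)) t j) b (s b + j))).
    by move=> x; upd.
  by move=> j lt_j x /=; upd.
move=> x; rewrite (run_loop (J := fun j => upd (upd (upd s a j) t (s a - j)) b (s b + s a))).
- by upd.
- by move=> y; upd.
- by move=> j lt_j y /=; move: lt_j; upd.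
Qed.

Definition minus (a b : nat) : cmd := Loop b (Dec a).

Lemma run_minus a b s : a <> b -> run (minus a b) s =1 upd (upd s b 0) a (s a - s b).
Proof.
move=> ab x; rewrite (run_loop (J := fun j => upd (upd s b (s b - j)) a (s a - j))).
- by upd.
- by move=> y; upd.
- by move=> j lt_j y /=; upd.
Qed.

Definition move_to (a b : nat) : cmd := Loop a (Inc b).

Lemma run_move a b s : a <> b -> run (move_to a b) s =1 upd (upd s a 0) b (s b + s a).
Proof.
move=> ab x; rewrite (run_loop (J := fun j => upd (upd s a (s a - j)) b (s b + j))).
- by upd.
- by move=> y; upd.
- by move=> j lt_j y /=; upd.
Qed.

Definition mul (a b r t u : nat) : cmd := Seq (copy a t u) (Loop t (copy b r u)).

Lemma run_mul a b r t u s : uniq [:: a; r; t; u] -> b \notin [:: r; t; u] ->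
  s t = 0 -> s u = 0 -> run (mul a b r t u) s =1 upd s r (s r + s a * s b).
Proof.
move=> U V st su; rewrite /= !inE in U V; apply: run_seq; first by apply: run_copy; lia.
have E : upd s t (s t + s a) t = s a by rewrite /upd eqxx st.
move=> x; rewrite (run_loop (J := fun j => upd (upd s t (s a - j)) r (s r + j * s b))).
- by rewrite E; upd.
- by move=> y; upd.
move=> j; rewrite E => lt_j y; rewrite run_copy; try lia; last by upd.
by rewrite mulSn; upd.
Qed.

Fixpoint add_const (n r : nat) : cmd := if n is m.+1 then Seq (Inc r) (add_const m r) else Skip.

Lemma run_add_const n r s : run (add_const n r) s =1 upd s r (s r + n).
Proof.
elim: n s => [|n IHn] s x /=; first by upd.
by rewrite IHn; upd.
Qed.

Lemma run_inc r s : run (Inc r) s =1 upd s r (s r).+1.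
Proof. by []. Qed.

(** Computes [1 - (a - b) - (b - a)] with truncated subtraction. Subtracting destroys the
    subtrahend, so both values are supplied twice. *)
Definition eq_test (d out : nat) : cmd :=
  Seq (minus d d.+1) (Seq (minus d.+3 d.+2) (Seq (Inc d.+4)
    (Seq (minus d.+4 d) (Seq (minus d.+4 d.+3) (move_to d.+4 out))))).

Lemma run_eq_test d out s a b : out < d -> s d = a -> s d.+1 = b -> s d.+2 = a -> s d.+3 = b ->
  s d.+4 = 0 ->
  run (eq_test d out) s =1
  upd (upd (upd (upd (upd s d 0) d.+1 0) d.+2 0) d.+3 0) out (s out + (a == b)).
Proof.
move=> lt_out s0 s1 s2 s3 s4.
apply: run_seq; first by apply: run_minus; lia.
apply: run_seq; first by apply: run_minus; lia.
apply: run_seq; first exact: run_inc.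
apply: run_seq; first by apply: run_minus; lia.
apply: run_seq; first by apply: run_minus; lia.
move=> x; rewrite run_move; last lia.
have E : 1 - (a - b) - (b - a) = (a == b) by lia.
rewrite -E; upd.
Qed.

Definition check_eq (x : nat) (load : nat -> cmd) (d out : nat) : cmd :=
  Seq (copy x d (d + 5)) (Seq (copy x d.+2 (d + 5))
    (Seq (load d.+1) (Seq (load d.+3) (eq_test d out)))).

Lemma run_check_eq x load d out s b : x < d -> out < d -> (forall r, d <= r -> s r = 0) ->
  (forall r t, d <= r < d + 5 -> (forall u, u < d -> t u = s u) ->
    (forall u, d + 5 <= u -> t u = 0) -> run (load r) t =1 upd t r (t r + b)) ->
  run (check_eq x load d out) s =1 upd s out (s out + (s x == b)).
Proof.
move=> lt_x lt_out Hz Hload.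
have [z0 z1 z2] := And3 (Hz d (leqnn _)) (Hz d.+1 (leqnSn _)) (Hz d.+2 ltac:(lia)).
have [z3 z4 z5] := And3 (Hz d.+3 ltac:(lia)) (Hz d.+4 ltac:(lia)) (Hz (d + 5) ltac:(lia)).
apply: (run_seq (t := upd s d (s x))).
  by move=> u; rewrite run_copy ?z0 //; lia.
apply: (run_seq (t := upd (upd s d (s x)) d.+2 (s x))).
  by move=> u; rewrite run_copy; try lia; upd.
apply: (run_seq (t := upd (upd (upd s d (s x)) d.+2 (s x)) d.+1 b)).
  move=> u; rewrite Hload; [by upd | lia | | ].
    by move=> v lt_v; upd.
  by move=> v le_v; rewrite -[RHS](Hz v); [upd | lia].
apply: (run_seq (t := upd (upd (upd (upd s d (s x)) d.+2 (s x)) d.+1 b) d.+3 b)).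
  move=> u; rewrite Hload; [by upd | lia | | ].
    by move=> v lt_v; upd.
  by move=> v le_v; rewrite -[RHS](Hz v); [upd | lia].
move=> u; rewrite (@run_eq_test _ _ _ (s x) b) //; try by upd.
Qed.

(* Register 2 holds the bound on the quantifiers, [e] gives the registers of the
   free variables, and the registers from [d] on are scratch registers. *)
Fixpoint check (A : form) (e : nat -> nat) (d out : nat) : cmd :=
  match A with
  | FNat i n => check_eq (e i) (add_const n) d out
  | FVar i j => check_eq (e i) (fun r => copy (e j) r (d + 5)) d out
  | FAdd i j k => check_eq (e i)
      (fun r => Seq (copy (e j) r (d + 5)) (copy (e k) r (d + 5))) d out
  | FMul i j k => check_eq (e i) (fun r => mul (e j) (e k) r (d + 5) (d + 6)) d out
  | FAnd A B => Seq (check A e d.+1 d) (Loop d (check B e d.+1 out))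
  | FOr A B => Seq (check A e d out) (check B e d out)
  | FEx A => Seq (copy 2 d.+1 d.+2)
      (Seq (Loop d.+1 (Seq (check A (scons d e) d.+2 out) (Inc d))) (Loop d Skip))
  end.

Lemma run_check A e d out s :
  (forall i, e i < d /\ e i <> out) -> out < d -> 2 < d -> out <> 2 ->
  (forall r, d <= r -> s r = 0) ->
  run (check A e d out) s =1 upd s out (s out + count_sem A (s 2) (fun i => s (e i))).
Proof.
elim: A e d out s => [i n|i j|i j k|i j k|A IHA B IHB|A IHA B IHB|A IHA] e d out s
  He lt_out lt_2 ne2 Hz; rewrite [check _ _ _ _]/= [count_sem _ _ _]/=.
- apply: run_check_eq => //; first by case: (He i).
  by move=> r t _ _ _; exact: run_add_const.
- apply: run_check_eq => //; first by case: (He i).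
  move=> r t Hr Ht Ht0; have [lt_j _] := He j; have t5 := Ht0 (d + 5) (leqnn _).
  by rewrite -(Ht (e j)) //; apply: run_copy; lia.
- apply: run_check_eq => //; first by case: (He i).
  move=> r t Hr Ht Ht0; have [lt_j _] := He j; have [lt_k _] := He k.
  have t5 := Ht0 (d + 5) (leqnn _).
  apply: run_seq; first by apply: run_copy; lia.
  move=> x; rewrite run_copy; try lia; last by upd.
  by rewrite -(Ht (e j)) // -(Ht (e k)) //; upd.
- apply: run_check_eq => //; first by case: (He i).
  move=> r t Hr Ht Ht0; have [lt_j _] := He j; have [lt_k _] := He k.
  have t5 := Ht0 (d + 5) (leqnn _); have t6 := Ht0 (d + 6) ltac:(lia).
  by rewrite -(Ht (e j)) // -(Ht (e k)) //; apply: run_mul => //; rewrite /= !inE; lia.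
- set cA := count_sem A _ _; set cB := count_sem B _ _.
  have zd : s d = 0 by apply: Hz.
  apply: (run_seq (t := upd s d cA)).
    move=> x; rewrite IHA ?zd //; try lia.
      by move=> i; case: (He i); lia.
    by move=> r lt_r; apply: Hz; lia.
  (* The test of [B] is run once for each unit that the test of [A] left in [d], so the product
     accumulates in [out]. *)
  move=> x; rewrite (run_loop (J := fun j => upd (upd s d (cA - j)) out (s out + j * cB))).
  + by rewrite /cA; upd.
  + by move=> y; upd.
  rewrite {1}/upd eqxx => j lt_j y.
  have Ed : upd s d cA d = cA by rewrite /upd eqxx.
  rewrite Ed IHB //; try lia.
  + have -> : count_sem B (upd (upd (upd s d (cA - j)) out (s out + j * cB)) d (cA - j).-1 2)
       (fun i => upd (upd (upd s d (cA - j)) out (s out + j * cB)) d (cA - j).-1 (e i)) = cB.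
      have -> : upd (upd (upd s d (cA - j)) out (s out + j * cB)) d (cA - j).-1 2 = s 2 by upd.
      by apply: count_sem_ext => i; have [? ?] := He i; upd.
    by rewrite mulSn; upd.
  + by move=> i; case: (He i); lia.
  by move=> r lt_r; rewrite -[RHS](Hz r); [upd | lia].
- apply: run_seq; first exact: IHA.
  move=> x; rewrite IHB //; last by move=> r le_r; rewrite -[RHS](Hz r le_r); upd.
  have -> : upd s out (s out + count_sem A (s 2) (fun i => s (e i))) 2 = s 2 by upd.
  rewrite (@count_sem_ext B _ _ (fun i => s (e i))); last by move=> i; have [? ?] := He i; upd.
  by upd.
have [z0 z1 z2] := And3 (Hz d (leqnn _)) (Hz d.+1 (leqnSn _)) (Hz d.+2 ltac:(lia)).
apply: (run_seq (t := upd s d.+1 (s 2))).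
  by move=> x; rewrite run_copy ?z1 //; lia.
(* Register [d] runs through the candidate witnesses while [d.+1] counts down from the bound. The
   final empty loop clears [d], so that scratch registers are zero again. *)
pose c j := \sum_(x < j) count_sem A (s 2) (scons x (fun i => s (e i))).
have c0 : c 0 = 0 by rewrite /c big_ord0.
have cS j : c j.+1 = c j + count_sem A (s 2) (scons j (fun i => s (e i))).
  by rewrite /c big_ord_recr.
apply: (run_seq (t := upd (upd s d (s 2)) out (s out + c (s 2)))).
  have Ed : upd s d.+1 (s 2) d.+1 = s 2 by rewrite /upd eqxx.
  move=> x; rewrite (run_loop (J := fun j =>
     upd (upd (upd s d.+1 (s 2 - j)) d j) out (s out + c j))).
  + by rewrite Ed; upd.
  + by move=> y; rewrite c0; upd.
  rewrite Ed => j lt_j; set t := upd _ _ _; apply: run_seq; first apply: IHA.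
  + case=> [|i] /=; first by lia.
    by case: (He i); lia.
  + lia.
  + lia.
  + by [].
  + by move=> r lt_r; rewrite -[RHS](Hz r); [rewrite /t; upd | lia].
  have -> : t 2 = s 2 by rewrite /t; upd.
  rewrite (@count_sem_ext A _ _ (scons j (fun i => s (e i)))); last first.
    case=> [|i] /=; first by rewrite /t; upd.
    by have [? ?] := He i; rewrite /t; upd.
  by move=> y; rewrite run_inc cS /t; upd.
move=> x; rewrite (run_loop (J := fun j =>
     upd (upd s d (s 2 - j)) out (s out + c (s 2)))).
- by rewrite -/(c (s 2)); upd.
- by move=> y; upd.
- by move=> j lt_j y /=; upd.
Qed.

Lemma assigned_add_const n r x : x \in assigned (add_const n r) -> x = r.
Proof. by elim: n => //= n IHn; rewrite inE => /predU1P[->|/IHn]. Qed.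

Lemma wf_add_const n r : wf (add_const n r).
Proof. by elim: n. Qed.

Lemma wf_copy a b t : uniq [:: a; b; t] -> wf (copy a b t).
Proof. by rewrite /= !inE => H; repeat (apply/andP; split); lia. Qed.

Lemma wf_check_eq x load d out : x < d -> out < d -> wf (load d.+1) -> wf (load d.+3) ->
  wf (check_eq x load d out).
Proof.
move=> lt_x lt_out w1 w3; rewrite [wf _]/= w1 w3 /= !inE; repeat (apply/andP; split); lia.
Qed.

Definition allowed (e : nat -> nat) d out r :=
  r = out \/ r = 2 \/ (exists i, r = e i) \/ d <= r.

Lemma allowed_check_eq e i load d out r :
  (forall r x, d <= r -> x \in assigned (load r) -> allowed e d out x) ->
  r \in assigned (check_eq (e i) load d out) -> allowed e d out r.
Proof.
move=> Hload; rewrite /= !(mem_cat, inE).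
have Hd x : d <= x -> allowed e d out x by right; right; right.
have He : allowed e d out (e i) by right; right; left; exists i.
have Ho : allowed e d out out by left.
repeat (case/orP || move/eqP->); try (apply: Hload; lia); try (apply: Hd; lia); done.
Qed.

Lemma assigned_check A e d out r : r \in assigned (check A e d out) -> allowed e d out r.
Proof.
elim: A e d out r => [i n|i j|i j k|i j k|A IHA B IHB|A IHA B IHB|A IHA] e d out r.
- apply: allowed_check_eq => s x le_s /assigned_add_const ->; by right; right; right.
- apply: allowed_check_eq => s x le_s; rewrite /= !inE.
  repeat (case/orP || move/eqP->); rewrite /allowed; by [right; right; right; lia | right; right; left; eauto].
- apply: allowed_check_eq => s x le_s; rewrite /= !inE.
  repeat (case/orP || move/eqP->); rewrite /allowed; by [right; right; right; lia | right; right; left; eauto].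
- apply: allowed_check_eq => s x le_s; rewrite /= !inE.
  repeat (case/orP || move/eqP->); rewrite /allowed; by [right; right; right; lia | right; right; left; eauto].
- rewrite /= mem_cat inE => /or3P[/IHA|/eqP->|/IHB]; rewrite /allowed.
  + by move=> [->|[->|[[i ->]|?]]]; eauto; right; right; right; lia.
  + by right; right; right.
  + by move=> [->|[->|[[i ->]|?]]]; eauto; right; right; right; lia.
- by rewrite /= mem_cat => /orP[/IHA|/IHB].
rewrite /= !(mem_cat, inE) => H.
have {H} : r \in assigned (check A (scons d e) d.+2 out) \/ r = 2 \/ d <= r by lia.
case=> [/IHA|[->|le_dr]]; rewrite /allowed.
- move=> [->|[->|[[[|i] /= ->]|?]]]; eauto.
  by right; right; right; lia.
- by right; left.
by right; right; right.
Qed.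

Lemma wf_check A e d out : (forall i, e i < d /\ e i <> out) -> out < d -> 2 < d -> out <> 2 ->
  wf (check A e d out).
Proof.
elim: A e d out => [i n|i j|i j k|i j k|A IHA B IHB|A IHA B IHB|A IHA] e d out He lt_out lt_2 ne2;
  rewrite [check _ _ _ _]/=.
- by apply: wf_check_eq; rewrite ?wf_add_const //; case: (He i).
- have [? ?] := He i; have [? ?] := He j.
  by apply: wf_check_eq => //; apply: wf_copy; rewrite /= !inE; lia.
- have [? ?] := He i; have [? ?] := He j; have [? ?] := He k.
  by apply: wf_check_eq => //; apply/andP; split; apply: wf_copy; rewrite /= !inE; lia.
- have [? ?] := He i; have [? ?] := He j; have [? ?] := He k.
  by apply: wf_check_eq => //=; rewrite !inE; repeat (apply/andP; split); lia.
- have He' i : e i < d.+1 /\ e i <> d by case: (He i); lia.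
  have He'' i : e i < d.+1 /\ e i <> out by case: (He i); lia.
  apply/and3P; split; [apply: IHA => //; lia | | apply: IHB => //; lia].
  by apply/negP=> /assigned_check[|[|[[i]|]]]; [lia | lia | case: (He i); lia | lia].
- by apply/andP; split; [apply: IHA | apply: IHB].
have He' i : scons d e i < d.+2 /\ scons d e i <> out.
  by case: i => [|i] /=; [lia | case: (He i); lia].
have w : wf (check A (scons d e) d.+2 out) by apply: IHA => //; lia.
have n1 : d.+1 \notin assigned (check A (scons d e) d.+2 out).
  apply/negP=> /assigned_check[|[|[[[|i] /=]|]]]; [lia | lia | lia | case: (He i); lia | lia].
rewrite /= w mem_cat (negPf n1) !inE; repeat (apply/andP; split); lia.
Qed.

Lemma MM_of_form A : exists n (P : seq (instr n.+1)), forall ps, size ps = 3 ->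
  MM (existT _ n.+1 (P, rep n (nth 0 [:: 0, 0, 0 & ps]))) <-> sem A (nth 0 ps).
Proof.
(* Register 1 receives the count, register 2 the growing bound, and 3 to 5 the parameters. Register
   6 stays 0 and serves all other free variables, in agreement with the default value of
   [nth 0 ps]. *)
pose e := nth 6 [:: 3; 4; 5]; pose body := Seq (Inc 2) (check A e 7 1).
have e_vals i : [\/ e i = 3, e i = 4, e i = 5 | e i = 6].
  by case: i => [|[|[|i]]] /=; rewrite /e /= ?nth_nil; [constructor 1|constructor 2|constructor 3|constructor 4].
have He i : e i < 7 /\ e i <> 1 by case: (e_vals i) => ->.
pose n := \max_(r <- 1 :: assigned body) r.
have w : wf body by rewrite /= wf_check.
have Hr : all (fun r => 0 < r <= n) (1 :: assigned body).
  apply/allP=> r r_in; apply/andP; split; last by apply: (@leq_bigmax_seq _ _ _ id).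
  move: r_in; rewrite !inE => /or3P[/eqP->|/eqP->|/assigned_check[->|[->|[[i ->]|]]]] //; last lia.
  by case: (e_vals i) => ->.
exists n, (repeat_machine n body 1) => ps size_ps; rewrite /MM.
set s0 := nth 0 [:: 0, 0, 0 & ps].
rewrite -> (repeat_machineP w Hr) => //.
have s0e i : s0 (e i) = nth 0 ps i.
  rewrite /s0 /e; clear s0; case: ps size_ps => [|a [|b [|c []]]] // _.
  by case: i => [|[|[|i]]] //=; rewrite !nth_nil.
have s0z r : 6 <= r -> s0 r = 0.
  by move=> le_r; rewrite /s0 nth_default //= size_ps.
have pass t s : s =1 upd s0 2 t ->
    run body s =1 upd (upd s0 2 t.+1) 1 (count_sem A t.+1 (nth 0 ps)).
  move=> Es; apply: (run_seq (t := upd s0 2 t.+1)).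
    by move=> x; rewrite run_inc /upd !Es /upd; case: eqP.
  have E2 : upd s0 2 t.+1 2 = t.+1 by [].
  move=> x; rewrite run_check // ?E2.
    rewrite (@count_sem_ext A _ _ (nth 0 ps)) // => i.
    by rewrite -s0e /upd; case: (e_vals i) => ->.
  by move=> r le_r; rewrite /upd; case: eqP => [E|_]; [lia | apply: s0z; lia].
split=> [[t]|/count_sem_complete[N0 HN]].
  (* As long as all counts were 0, the only trace of [u] rounds is the bound in register 2. *)
  have H u : sem A (nth 0 ps) \/ iter u (run body) s0 =1 upd s0 2 u.
    elim: u => [|u [|IHu]]; [right | by left |].
      by move=> x; rewrite /= /upd; case: eqP => [->|].
    have := pass _ _ IHu; have [->|/count_sem_sound] := posnP (count_sem A u.+1 (nth 0 ps)); last by left.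
    by move=> E; right => x; rewrite iterS E /upd; case: eqP => // ->.
  by case: (H t.+1) => // ->.
have H u : (exists t, 0 < iter t.+1 (run body) s0 1) \/ iter u (run body) s0 =1 upd s0 2 u.
  elim: u => [|u [|IHu]]; [right | by left |].
    by move=> x; rewrite /= /upd; case: eqP => [->|].
  have E := pass _ _ IHu; have [z|c_gt0] := posnP (count_sem A u.+1 (nth 0 ps)).
    by right=> x; rewrite iterS E z /upd; case: eqP => // ->.
  by left; exists u; rewrite iterS E.
case: (H N0) => // E; exists N0; rewrite iterS (pass _ _ E) /upd /=.
by apply: HN.
Qed.

(** * Computing the parameters of the fixed formulas *)

Lemma code_vec n (s : nat -> nat) : code (rep n s) = code [seq (i, s i) | i <- iota 0 n.+1].
Proof.
rewrite -[LHS]/(code [seq (i, rep n s i) | i <- enum 'I_n.+1]) -val_enum_ord.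
by elim: (enum 'I_n.+1) => //= i r ->; rewrite ffunE.
Qed.

Definition pcp_machine_code n (P : seq (instr n.+1)) (Q : seq (seq nat * seq nat)) : tree :=
  node (num n.+1) (node (code P)
    (code [seq (i, nth 0 [:: 0, 0, 0 & pcp_params Q] i) | i <- iota 0 n.+1])).

Theorem PCP_MM : PCP ⪯ MM.
Proof.
have [A HA] := pcp_form; have [n [P HP]] := MM_of_form A.
pose f Q := existT (fun n => (seq (instr n) * {ffun 'I_n -> nat})%type) n.+1
  (P, rep n (nth 0 [:: 0, 0, 0 & pcp_params Q])).
exists f; split; last first.
  by move=> Q; have := HA Q; have := HP (pcp_params Q) erefl; rewrite /f; tauto.
have cf_g : cf (pcp_machine_code P).
  rewrite /pcp_machine_code /pcp_params /code_params /pcp_rows /pcp_base /base /word_code /encode /sumn; cf.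
have [G [p Hp] Gg] := cf_g.
exists p, pLeaf => Q; split; last by move=> i; constructor.
have -> : data (f Q) = code (pcp_machine_code P Q) by rewrite /pcp_machine_code -code_vec.
by rewrite -(Gg (oracle Q)); exact: Hp.
Qed.

Theorem FRACTRAN_DIO_FORM : FRACTRAN ⪯ DIO_FORM.
Proof.
have [A HA] := fractran_form.
pose nu (x : seq (nat * nat) * nat) := nth 0 (code_params x.2 (fractran_rows x.1)).
exists (fun x => (A, nu x)); split; last by move=> [Q s]; have := HA Q s; rewrite /DIO_FORM /nu /=; tauto.
have cf_A : cf (fun _ : seq (nat * nat) * nat => code A) by cf.
have cf_nu : cf (fun x : (seq (nat * nat) * nat) * nat => nu x.1 x.2).
  rewrite /nu /code_params /fractran_rows /base /encode /sumn; cf.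
have [F [p Hp] Ff] := cf_A; have [G [q Hq] Gg] := cf_nu.
exists p, q => x; split; [|move=> i].
  exact: (eq_ind _ (eval _ p _) (Hp (oracle x) (code x)) _ (Ff (oracle x) x)).
exact: (eq_ind _ (eval _ q _) (Hq (oracle x) (code (x, i))) _ (Gg (oracle x) (x, i))).
Qed.

(** * Recursion over syntax trees *)

(* Constructors are coded as [node tag arguments], so the recursive calls are
   on the children of the second component: [h] is given the current tree, and
   the results for its second component and for the children of the latter. *)
Definition syntax_rec (h : tree -> tree) : tree -> tree :=
  trec (fun=> node leaf (node leaf leaf))
    (fun z => node (h (node (tfst (tsnd z)) (tsnd (tsnd (tsnd z)))))
       (node (tfst (tfst (tsnd (tsnd z)))) (tfst (tsnd (tsnd (tsnd z)))))) leaf.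

Lemma tcomp_syntax_rec h : tcomp h -> tcomp (fun o t => syntax_rec (h o) t).
Proof.
move=> Hh; apply: (@tcomp_rec (fun _ _ => node leaf (node leaf leaf)) (fun o z =>
  node (h o (node (tfst (tsnd z)) (tsnd (tsnd (tsnd z)))))
    (node (tfst (tfst (tsnd (tsnd z)))) (tfst (tsnd (tsnd (tsnd z))))))
  (fun _ _ => leaf) (fun _ t => t)); tcomp.
by apply: (@tcomp_comp h) => //; tcomp.
Qed.

Definition syntax_map (h : tree -> tree) (t : tree) : tree := tfst (syntax_rec h t).

Lemma cf_syntax_map (h : tree -> tree) : cf h -> cf (syntax_map h).
Proof.
move=> [F cF Ff]; exists (fun o t => tfst (syntax_rec (F o) t)).
  exact/tcomp_fst_of/tcomp_syntax_rec.
move=> o t; congr tfst; rewrite /syntax_rec /=.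
by elim: t => //= a -> b ->; congr (node _ _); exact: Ff.
Qed.

(** * Formulas to elementary constraints *)

Definition ren_tree (r : nat -> nat) (t : tree) : tree :=
  let a := tsnd t in
  if (unnum (tfst t) == 0) || (unnum (tfst t) == 2) then
    node (tfst t) (node (num (r (unnum (tfst a)))) (tsnd a))
  else if unnum (tfst t) == 1 then
    node (tfst t) (node (num (r (unnum (tfst a)))) (num (r (unnum (tsnd a)))))
  else
    node (tfst t) (node (node (num (r (unnum (tfst (tfst a))))) (num (r (unnum (tsnd (tfst a))))))
      (num (r (unnum (tsnd a))))).

Lemma ren_treeE r c : ren_tree r (code c) = code (ren_constraint r c).
Proof. by case: c => * /=; rewrite /ren_tree /= !numK. Qed.

Definition bind_tree (t : tree) : tree :=
  if unnum (tfst t) == 2 then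
    if unnum (tsnd (tsnd t)) == 0 then
      node (num 1) (node (num (unnum (tfst (tsnd t)) + 2)) (num 1))
    else node (num 2) (node (num (unnum (tfst (tsnd t)) + 2)) (tsnd (tsnd (tsnd t))))
  else ren_tree (fun u => u + 2) t.

Lemma bind_treeE c : bind_tree (code c) = code (bind_constraint c).
Proof.
have E u : u + 2 = u.+2 by rewrite addn2.
case: c => [u n|u v|u [|i]|u v w|u v w]; rewrite /bind_tree /= ?numK ?E //.
- by rewrite /ren_tree /= numK E.
- by rewrite /ren_tree /= !numK !E.
- by rewrite /ren_tree /= !numK !E.
- by rewrite /ren_tree /= !numK !E.
Qed.

Definition elems_step (z : tree) : seq tree :=
  let tag := unnum (tfst (tfst z)) in
  let a := tsnd (tfst z) in
  let l := unseq (tfst (tsnd z)) in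
  let l1 := unseq (tfst (tsnd (tsnd z))) in
  let l2 := unseq (tsnd (tsnd (tsnd z))) in
  let par u i := node (num 2) (node (num u) i) in
  let cmp := [seq code c | c <- cmp_constraints] in
  let ternary :=
    [:: par 1 (tfst (tfst a)), par 6 (tsnd (tfst a)), par 7 (tsnd a)
      & code (if tag == 2 then CAdd 2 6 7 else CMul 2 6 7) :: cmp] in
  let binary := code (if tag == 4 then CAdd 0 1 2 else CMul 0 1 2) ::
     [seq ren_tree (fun u => u + u + 1) c | c <- l1] ++
     [seq ren_tree (fun u => u + u + 2) c | c <- l2] in
  if tag == 0 then [:: par 1 (tfst a), node (num 0) (node (num 2) (tsnd a)) & cmp]
  else if tag == 1 then [:: par 1 (tfst a), par 2 (tsnd a) & cmp]
  else if tag <= 3 then ternary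
  else if tag <= 5 then binary
  else code (CVar 0 2) :: [seq bind_tree c | c <- l].

Lemma cf_elems_step : cf (fun z => code (elems_step z)).
Proof. rewrite /elems_step /bind_tree /ren_tree; cbv zeta; cf. Qed.

Lemma elems_tree A : syntax_map (fun z => code (elems_step z)) (code A) = code (elems A).
Proof.
have map_code l : code [seq code c | c <- l] = code (l : seq constraint).
  by elim: l => //= c l ->.
have ren1 (l : seq constraint) : [seq ren_tree (fun u => u + u + 1) c | c <- unseq (code l)] =
    [seq code c | c <- map (ren_constraint (fun u => u.*2.+1)) l].
  rewrite unseq_code -!map_comp; apply: eq_map => c /=.
  by rewrite ren_treeE; case: c => * /=; rewrite ?addnn ?addn1.
have ren2 (l : seq constraint) : [seq ren_tree (fun u => u + u + 2) c | c <- unseq (code l)] =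
    [seq code c | c <- map (ren_constraint (fun u => u.*2.+2)) l].
  rewrite unseq_code -!map_comp; apply: eq_map => c /=.
  by rewrite ren_treeE; case: c => * /=; rewrite ?addnn ?addn2.
set h := fun z => _.
elim: A => [i n|i j|i j k|i j k|A IHA B IHB|A IHA B IHB|A IHA] //.
- transitivity (h (node (node (num 4) (node (code A) (code B)))
    (node (syntax_map h (node (code A) (code B))) (node (code (elems A)) (code (elems B)))))).
    by rewrite -IHA -IHB.
  rewrite /h /elems_step; cbv beta zeta delta [tfst tsnd] iota; rewrite numK ren1 ren2 -map_cat.
  exact: (map_code (_ :: _)).
- transitivity (h (node (node (num 5) (node (code A) (code B)))
    (node (syntax_map h (node (code A) (code B))) (node (code (elems A)) (code (elems B)))))).
    by rewrite -IHA -IHB.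
  rewrite /h /elems_step; cbv beta zeta delta [tfst tsnd] iota; rewrite numK ren1 ren2 -map_cat.
  exact: (map_code (_ :: _)).
(* The second component of the code of [FEx A] is the subformula itself, so the recursive result to
   use is the one for that component, not those for its children. *)
transitivity (h (node (node (num 6) (code A)) (node (code (elems A))
   (tsnd (syntax_rec h (code A)))))).
  by rewrite -IHA /syntax_map -/(syntax_map h _); case: A IHA.
have -> : elems (FEx A) = CVar 0 2 :: map bind_constraint (elems A) by [].
rewrite /h /elems_step; cbv beta zeta delta [tfst tsnd] iota; rewrite numK.
have -> : [seq bind_tree c | c <- unseq (code (elems A))] =
    [seq code c | c <- map bind_constraint (elems A)].
  by rewrite unseq_code -!map_comp; apply: eq_map => c; exact: bind_treeE.
exact: (map_code (_ :: _)).
Qed.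

Theorem DIO_FORM_DIO_ELEM : DIO_FORM ⪯ DIO_ELEM.
Proof.
exists (fun x => (CNat 0 0 :: elems x.1, x.2)); split.
  have cf_g : cf (fun t => node (code (CNat 0 0)) (syntax_map (fun z => code (elems_step z)) t)).
    apply: cf_node; first exact: cf_const.
    exact: cf_syntax_map cf_elems_step.
  have [G [p Hp] Gg] := cf_g; exists p, (pComp pAsk pSnd) => -[A nu]; split; last first.
    by move=> i; apply: eval_comp (eval_snd _ _ _) (eval_ask _ _).
  have E : G nu (code A) = code (CNat 0 0 :: elems A).
    exact: etrans (Gg nu (code A)) (congr1 (node _) (elems_tree A)).
  exact: (eq_ind _ (eval _ p _) (Hp nu (code A)) _ E).
move=> [A nu]; rewrite /DIO_FORM /DIO_ELEM /=.
split=> [/elemsP[phi [Hphi z]]|[phi /andP[/eqP z Hphi]]]; first by exists phi; rewrite z.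
by apply/elemsP; exists phi.
Qed.

(** * Elementary constraints to a single equation *)

Definition lhs (c : constraint) : dpoly nat nat :=
  match c with CNat u _ | CVar u _ | CPar u _ | CAdd u _ _ | CMul u _ _ => PVar u end.

Definition rhs (c : constraint) : dpoly nat nat :=
  match c with
  | CNat _ n => PNat n
  | CVar _ v => PVar v
  | CPar _ i => PPar i
  | CAdd _ v w => PAdd (PVar v) (PVar w)
  | CMul _ v w => PMul (PVar v) (PVar w)
  end.

(* The sum of the [(l - r)^2] vanishes; the negative terms are moved to the right. *)
Definition single (l : seq constraint) : dpoly nat nat * dpoly nat nat :=
  foldr (fun c pq =>
    (PAdd (PAdd (PMul (lhs c) (lhs c)) (PMul (rhs c) (rhs c))) pq.1,
     PAdd (PMul (PNat 2) (PMul (lhs c) (rhs c))) pq.2)) (PNat 0, PNat 0) l.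

Lemma holdsE phi nu c : holds phi nu c = (value phi nu (lhs c) == value phi nu (rhs c)).
Proof. by case: c. Qed.

(** [2 a b <= a^2 + b^2] with equality iff [a = b]. These inequalities all point the same way, so
    equality of the two sums forces equality in every summand. *)
Lemma singleP phi nu l :
  all (holds phi nu) l = (value phi nu (single l).1 == value phi nu (single l).2).
Proof.
suff H : value phi nu (single l).2 <= value phi nu (single l).1 ?= iff all (holds phi nu) l.
  by rewrite eq_sym H.
elim: l => //= c l IHl; apply: leqif_add => //; rewrite holdsE !mulnn eq_sym.
by rewrite eq_sym; exact: nat_Cauchy.
Qed.

Definition lhs_tree (t : tree) : tree :=
  node (num 0) (if unnum (tfst t) <= 2 then tfst (tsnd t) else tfst (tfst (tsnd t))).

Definition rhs_tree (t : tree) : tree :=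
  let a := tsnd t in
  if unnum (tfst t) == 0 then node (num 2) (tsnd a)
  else if unnum (tfst t) == 1 then node (num 0) (tsnd a)
  else if unnum (tfst t) == 2 then node (num 1) (tsnd a)
  else node (tfst t) (node (node (num 0) (tsnd (tfst a))) (node (num 0) (tsnd a))).

Definition single_tree (l : seq tree) : tree * tree :=
  foldr (fun c pq =>
    (node (num 3) (node (node (num 3) (node (node (num 4) (node (lhs_tree c) (lhs_tree c)))
        (node (num 4) (node (rhs_tree c) (rhs_tree c))))) pq.1),
     node (num 3) (node (node (num 4) (node (node (num 2) (num 2))
        (node (num 4) (node (lhs_tree c) (rhs_tree c))))) pq.2)))
   (node (num 2) (num 0), node (num 2) (num 0)) l.

Lemma single_tree_pair l : single_tree (unseq (code l)) = (code (single l).1, code (single l).2).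
Proof. by rewrite unseq_code; elim: l => [//|c l /= ->]; case: c. Qed.

Lemma single_treeE l : code (single_tree (unseq (code l))) = code (single l).
Proof. by rewrite single_tree_pair. Qed.

Theorem DIO_ELEM_DIO_SINGLE : DIO_ELEM ⪯ DIO_SINGLE.
Proof.
exists (fun x => (single x.1, x.2)); split.
  have cf_g : cf (fun t => code (single_tree (unseq t))).
    rewrite /single_tree /lhs_tree /rhs_tree; cbv zeta; cf.
  have [G [p Hp] Gg] := cf_g; exists p, (pComp pAsk pSnd) => -[l nu]; split; last first.
    by move=> i; apply: eval_comp (eval_snd _ _ _) (eval_ask _ _).
  have E : G nu (code l) = code (single l) := etrans (Gg nu (code l)) (single_treeE l).
  exact: (eq_ind _ (eval _ p _) (Hp nu (code l)) _ E).
move=> [l nu]; rewrite /DIO_ELEM /DIO_SINGLE /= [single l]surjective_pairing.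
by split=> -[phi H]; exists phi; move: H; rewrite singleP => /eqP.
Qed.

(** * Eliminating the parameters *)

(** Sums bound the variables as well as maxima would, and are simpler to program. *)
Fixpoint var_max (p : dpoly nat nat) : nat :=
  match p with
  | PVar u => u
  | PPar _ | PNat _ => 0
  | PAdd p q | PMul p q => var_max p + var_max q
  end.

Fixpoint instantiate (nu : nat -> nat) n (p : dpoly nat nat) : dpoly 'I_n.+1 void :=
  match p with
  | PVar u => PVar (inord u)
  | PPar i => PNat (nu i)
  | PNat m => PNat m
  | PAdd p q => PAdd (instantiate nu n p) (instantiate nu n q)
  | PMul p q => PMul (instantiate nu n p) (instantiate nu n q)
  end.

Lemma value_instantiate nu n (phi : {ffun 'I_n.+1 -> nat}) p :
  value phi (of_void nat) (instantiate nu n p) = value (fun u => phi (inord u)) nu p.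
Proof. by elim: p => //= p -> q ->. Qed.

Lemma value_ext phi psi (nu : nat -> nat) p :
  (forall u, u <= var_max p -> phi u = psi u) -> value phi nu p = value psi nu p.
Proof.
elim: p => //= [u|p IHp q IHq|p IHp q IHq] E; first exact: E.
  by rewrite IHp ?IHq // => u le_u; apply: E; lia.
by rewrite IHp ?IHq // => u le_u; apply: E; lia.
Qed.

Definition var_max_step (z : tree) : tree :=
  if unnum (tfst (tfst z)) == 0 then tsnd (tfst z)
  else if unnum (tfst (tfst z)) <= 2 then num 0
  else num (unnum (tfst (tsnd (tsnd z))) + unnum (tsnd (tsnd (tsnd z)))).

Lemma var_max_tree p : syntax_map var_max_step (code p) = num (var_max p).
Proof.
elim: p => // p IHp q IHq.
  transitivity (num (unnum (syntax_map var_max_step (code p)) +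
    unnum (syntax_map var_max_step (code q)))) => //.
  by rewrite IHp IHq !numK.
transitivity (num (unnum (syntax_map var_max_step (code p)) +
  unnum (syntax_map var_max_step (code q)))) => //.
by rewrite IHp IHq !numK.
Qed.

(* The second component is the value of the parameter, if the term is one. *)
Definition instantiate_step (z : tree) : tree :=
  if unnum (tfst (tfst (tfst z))) == 1 then node (num 2) (tsnd z)
  else if unnum (tfst (tfst (tfst z))) <= 2 then tfst (tfst z)
  else node (tfst (tfst (tfst z))) (tsnd (tsnd (tfst z))).

(** The oracle is asked at every node, parameter or not, so that the branching itself is oracle-free
    and falls under [cf]. *)
Definition instantiate_ask (nu : nat -> nat) (z : tree) : tree :=
  instantiate_step (node z (num (nu (unnum (tsnd (tfst z)))))).

Lemma instantiate_tree nu n p : var_max p <= n ->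
  syntax_map (instantiate_ask nu) (code p) = code (instantiate nu n p).
Proof.
elim: p => [u|i|m|p IHp q IHq|p IHp q IHq] /= le_n //.
- by rewrite /code_ord inordK.
- by rewrite /syntax_map /= /instantiate_ask /= numK.
- transitivity (node (num 3) (node (syntax_map (instantiate_ask nu) (code p))
     (syntax_map (instantiate_ask nu) (code q)))) => //.
  by rewrite IHp ?IHq //; lia.
transitivity (node (num 4) (node (syntax_map (instantiate_ask nu) (code p))
   (syntax_map (instantiate_ask nu) (code q)))) => //.
by rewrite IHp ?IHq //; lia.
Qed.

Theorem DIO_SINGLE_H10 : DIO_SINGLE ⪯ H10.
Proof.
pose bound (x : dpoly nat nat * dpoly nat nat) := var_max x.1 + var_max x.2.
exists (fun x => existT (fun n => (dpoly 'I_n void * dpoly 'I_n void)%type) (bound x.1).+1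
  (instantiate x.2 (bound x.1) x.1.1, instantiate x.2 (bound x.1) x.1.2)); split.
  have cf_v : cf (syntax_map var_max_step).
    by apply: cf_syntax_map; rewrite /var_max_step; cf.
  have cf_b : cf (fun t => num (unnum (syntax_map var_max_step (tfst t)) +
      unnum (syntax_map var_max_step (tsnd t))).+1).
    have H1 : cf (fun t => syntax_map var_max_step (tfst t)) by apply: (cf_comp cf_v); cf.
    have H2 : cf (fun t => syntax_map var_max_step (tsnd t)) by apply: (cf_comp cf_v); cf.
    cf.
  have cf_i : cf instantiate_step by rewrite /instantiate_step; cf.
  have [B cB Bb] := cf_b; have [I cI Ii] := cf_i.
  have tc_i : tcomp (fun o => syntax_map (instantiate_ask o)).
    apply/tcomp_fst_of/tcomp_syntax_rec.
    apply: (@tcomp_ext (fun o z => I o (node z (num (o (unnum (tsnd (tfst z)))))))).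
      by move=> o z; exact: Ii.
    apply: (tcomp_comp cI); tcomp.
    by apply: (tcomp_comp tcomp_ask); tcomp.
  have [q Hq] : tcomp (fun o t => node (B o t)
     (node (syntax_map (instantiate_ask o) (tfst t)) (syntax_map (instantiate_ask o) (tsnd t)))).
    by apply: tcomp_node => //; apply: tcomp_node; apply: (tcomp_comp tc_i); tcomp.
  exists q, pLeaf => -[[p p'] nu]; split; last by move=> i; constructor.
  have E1 : B nu (node (code p) (code p')) = num (var_max p + var_max p').+1.
    apply: etrans (Bb nu (node (code p) (code p'))) _.
    by rewrite [LHS]/= !var_max_tree !numK.
  have E2 := @instantiate_tree nu (var_max p + var_max p') p (leq_addr _ _).
  have E3 := @instantiate_tree nu (var_max p + var_max p') p' (leq_addl _ _).
  exact: (eq_ind _ (eval _ q _) (Hq nu (node (code p) (code p'))) _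
    (congr2 node E1 (congr2 node E2 E3))).
move=> [[p q] nu]; rewrite /DIO_SINGLE /H10 /bound /=; split=> [[phi E]|[phi]].
  exists [ffun i : 'I__ => phi i]; rewrite !value_instantiate.
  by rewrite !(@value_ext _ phi) // => u le_u; rewrite ffunE inordK //; lia.
by rewrite !value_instantiate => E; exists (fun u => phi (inord u)).
Qed.

(** * Simulation of Minsky machines in FRACTRAN *)

(* Pairwise coprime numbers, which do as well as primes. *)
Definition sylvester (i : nat) : nat := (iter i (fun m => m * m.+1) 1).+1.

Lemma sylvester_gt1 i : 1 < sylvester i.
Proof. by rewrite ltnS; elim: i => //= i IHi; rewrite muln_gt0 IHi. Qed.

(** In Sylvester's sequence 2, 3, 7, 43, ... each term is one more than the product of all earlier
    terms. *)
Lemma sylvester_coprime i j : i != j -> coprime (sylvester i) (sylvester j).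
Proof.
wlog lt_ij : i j / i < j.
  move=> H ne; have [lt_ij|lt_ji|E] := ltngtP i j; first exact: H.
    by rewrite coprime_sym H // eq_sym.
  by rewrite E eqxx in ne.
move=> _; have : sylvester i %| iter j (fun m => m * m.+1) 1.
  elim: j lt_ij => // j IHj; rewrite ltnS leq_eqVlt => /predU1P[->|/IHj]; rewrite iterS.
    exact: dvdn_mull.
  exact: dvdn_mulr.
by move=> D; apply: coprime_dvdl (coprimenS _); exact: dvdn_trans D _.
Qed.

Lemma fractran_step_det Q x y z : all (fun e => 0 < e.2) Q ->
  fractran_step Q x y -> fractran_step Q x z -> y = z.
Proof.
move=> + Hy; elim: Hy z => {Q x y} [p q Q x y E|p q Q x y nd _ IH] z /= /andP[q_gt0 HQ] Hz;
  inversion Hz as [? ? ? ? ? E'|? ? ? ? ? nd' Hz']; subst.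
- by apply/eqP; rewrite -(eqn_pmul2l q_gt0) E E'.
- by rewrite -E dvdn_mulr in nd'.
- by rewrite -E' dvdn_mulr in nd.
exact: IH.
Qed.

Lemma fractran_skip Q1 Q2 x y : all (fun e => ~~ (e.2 %| e.1 * x)) Q1 ->
  fractran_step Q2 x y -> fractran_step (Q1 ++ Q2) x y.
Proof. by elim: Q1 => //= -[p q] Q1 IHQ /andP[nd /IHQ H] /H; exact: fractran_next. Qed.

Lemma fractran_stuck Q x y : all (fun e => ~~ (e.2 %| e.1 * x)) Q -> ~ fractran_step Q x y.
Proof.
move=> + H; elim: H => {Q x y} [p q Q x y E|p q Q x y nd _ IH] /= /andP[nd' HQ]; last exact: IH.
by rewrite -E dvdn_mulr in nd'.
Qed.

Section Simulation.
Local Notation g := sylvester.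
Variable n : nat.

(* Register [a] is represented by the key [g (3 * a + 2)], and the current label
   [i] by [g (3 * i)], or [g (3 * i + 1)] just after a jump. *)
Definition mm_rule (i : nat) (c : instr n) : seq (nat * nat) :=
  match c with
  | INC a => [:: (g (3 * i.+1) * g (3 * a + 2), g (3 * i)); (g (3 * i), g (3 * i + 1))]
  | DEC a p => [:: (g (3 * i.+1), g (3 * i) * g (3 * a + 2)); (g (3 * p + 1), g (3 * i));
                   (g (3 * i), g (3 * i + 1))]
  end.

Fixpoint mm_rules (i : nat) (P : seq (instr n)) : seq (nat * nat) :=
  if P is c :: P' then mm_rule i c ++ mm_rules i.+1 P' else [::].

Definition mm_vec (v : {ffun 'I_n -> nat}) : nat := \prod_(a < n) g (3 * a + 2) ^ v a.

Lemma g_gt0 i : 0 < g i.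
Proof. exact: ltnW (sylvester_gt1 i). Qed.

(** The criterion for a disabled fraction: its denominator contains a key that is coprime to the
    numerator and to the state. It replaces unique factorisation. *)
Lemma not_dvdn_key k p q x : 1 < k -> k %| q -> coprime k p -> coprime k x -> ~~ (q %| p * x).
Proof.
move=> k_gt1 kq kp kx; apply/negP=> /(dvdn_trans kq); rewrite Gauss_dvdr // => D.
have : k %| gcdn k x by rewrite dvdn_gcd dvdnn.
by rewrite (eqP kx) dvdn1; case: eqP k_gt1 => // ->.
Qed.

Lemma coprime_vec m v : m %% 3 != 2 -> coprime (g m) (mm_vec v).
Proof.
move=> Hm; rewrite /mm_vec; elim/big_ind: _ => [|x y|a _]; first exact: coprimen1.
  by rewrite coprimeMr => -> ->.
by apply: coprimeXr; apply: sylvester_coprime; apply: contraNneq Hm => ->; lia.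
Qed.

Lemma coprime_vec0 (v : {ffun 'I_n -> nat}) a : v a = 0 -> coprime (g (3 * a + 2)) (mm_vec v).
Proof.
move=> va; rewrite /mm_vec; elim/big_rec: _ => [|b y _]; first exact: coprimen1.
rewrite coprimeMr => ->; rewrite andbT.
have [->|ne] := eqVneq b a; first by rewrite va expn0 coprimen1.
apply: coprimeXr; apply: sylvester_coprime; apply: contraNneq ne => E.
by apply/eqP/val_inj => /=; lia.
Qed.

Lemma mm_vec_update (v : {ffun 'I_n -> nat}) a : mm_vec (update v a (v a).+1) = mm_vec v * g (3 * a + 2).
Proof.
rewrite /mm_vec (bigD1 a) //= ffunE eqxx expnSr [in RHS](bigD1 a) //= mulnAC; congr (_ * _ * _).
by apply: eq_bigr => b /negPf ne; rewrite ffunE ne.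
Qed.

Lemma mm_rules_cat i P1 P2 : mm_rules i (P1 ++ P2) = mm_rules i P1 ++ mm_rules (i + size P1) P2.
Proof.
by elim: P1 i => [|c P1 IHP] i /=; rewrite ?addn0 // IHP catA addSnnS.
Qed.

Lemma mm_rule_key i c e : e \in mm_rule i c ->
  exists2 m, m = 3 * i \/ m = 3 * i + 1 & g m %| e.2 /\ coprime (g m) e.1.
Proof.
have co k l : k <> l -> coprime (g k) (g l) by move/eqP; exact: sylvester_coprime.
case: c => [a|a p]; rewrite !inE.
  case/orP=> /eqP -> /=.
    by exists (3 * i); [left | rewrite dvdnn coprimeMr !co //; lia].
  by exists (3 * i + 1); [right | rewrite dvdnn co //; lia].
case/or3P=> /eqP -> /=.
- by exists (3 * i); [left | rewrite dvdn_mulr // co //; lia].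
- by exists (3 * i); [left | rewrite dvdnn co //; lia].
by exists (3 * i + 1); [right | rewrite dvdnn co //; lia].
Qed.

Lemma mm_rules_idle i P c v : c = 0 \/ c = 1 -> forall k, k < i \/ i + size P <= k ->
  all (fun e => ~~ (e.2 %| e.1 * (mm_vec v * g (3 * k + c)))) (mm_rules i P).
Proof.
move=> Hc k; elim: P i => //= d P IHP i Hk; rewrite all_cat IHP; last lia.
rewrite andbT; apply/allP=> e /mm_rule_key[m Hm [m_q m_p]].
apply: not_dvdn_key (sylvester_gt1 m) m_q m_p _.
by rewrite coprimeMr coprime_vec ?sylvester_coprime //; lia.
Qed.

Lemma mm_rules_pos i P : all (fun e => 0 < e.2) (mm_rules i P).
Proof.
elim: P i => //= c P IHP i; rewrite all_cat IHP andbT.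
by case: c => [a|a p] /=; rewrite ?(muln_gt0, g_gt0).
Qed.

Definition mm_repr (x : nat) (s : mm_state n) : Prop :=
  x = mm_vec s.2 * g (3 * s.1 + 0) \/ x = mm_vec s.2 * g (3 * s.1 + 1).

Lemma labels_cat (P : seq (instr n)) i c : labels (1, P) i c ->
  exists P1 P2, P = P1 ++ c :: P2 /\ i = 1 + size P1.
Proof.
case: i => [|i] [//= _]; rewrite subSS subn0.
elim: P i => [|d P IHP] [|i] //=.
  by move=> [->]; exists [::], P.
by move=> /IHP[P1 [P2 [-> [->]]]]; exists (d :: P1), P2.
Qed.

Lemma mm_rules_split P i c : labels (1, P) i c -> exists R1 R2,
  mm_rules 1 P = R1 ++ mm_rule i c ++ R2 /\
  forall v b, b = 0 \/ b = 1 -> all (fun e => ~~ (e.2 %| e.1 * (mm_vec v * g (3 * i + b)))) R1.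
Proof.
move=> /labels_cat[P1 [P2 [-> ->]]]; exists (mm_rules 1 P1), (mm_rules (1 + size P1).+1 P2).
split; first by rewrite mm_rules_cat.
by move=> v b Hb; apply: mm_rules_idle => //; lia.
Qed.

Lemma g_coprime k l : k <> l -> coprime (g k) (g l).
Proof. by move/eqP; exact: sylvester_coprime. Qed.

(* A state entered by a jump is first marked by [g (3 * i + 1)]: a direct jump
   of an instruction to itself would be the fraction [1]. *)
Lemma mm_unmark P i c v x : labels (1, P) i c -> mm_repr x (i, v) ->
  exists k, stepn (fractran_step (mm_rules 1 P)) k x (mm_vec v * g (3 * i + 0)).
Proof.
move=> /mm_rules_split[R1 [R2 [-> idle]]] [->|->] /=; first by exists 0.
exists 1; exists (mm_vec v * g (3 * i + 0)); split=> //.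
apply: fractran_skip; first by apply: idle; right.
have cv : coprime (g (3 * i)) (mm_vec v * g (3 * i + 1)).
  by rewrite coprimeMr coprime_vec ?g_coprime //; lia.
have last Q : fractran_step ((g (3 * i), g (3 * i + 1)) :: Q) (mm_vec v * g (3 * i + 1))
    (mm_vec v * g (3 * i + 0)).
  by apply: fractran_here; rewrite addn0 mulnCA [RHS]mulnCA [_ * g (3 * i)]mulnC.
case: c {idle} => [a|a p] /=; do ?apply: fractran_next => //.
- by apply: (not_dvdn_key (sylvester_gt1 (3 * i))) => //; rewrite coprimeMr !g_coprime //; lia.
- by apply: (not_dvdn_key (sylvester_gt1 (3 * i))); rewrite ?dvdn_mulr // g_coprime //; lia.
by apply: (not_dvdn_key (sylvester_gt1 (3 * i))) => //; rewrite g_coprime //; lia.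
Qed.

Lemma mm_simulate P s s' x : mm_step (1, P) s s' -> mm_repr x s ->
  exists k x', stepn (fractran_step (mm_rules 1 P)) k.+1 x x' /\ mm_repr x' s'.
Proof.
move=> Hs Hx.
have main : exists x', fractran_step (mm_rules 1 P) (mm_vec s.2 * g (3 * s.1 + 0)) x' /\ mm_repr x' s'.
  case: Hs => {s s' x Hx} [i v a|i v a p|i v a p] /mm_rules_split[R1 [R2 [-> idle]]] /=.
  - exists (mm_vec (update v a (v a).+1) * g (3 * i.+1 + 0)); split; last by left.
    apply: fractran_skip; first by apply: idle; left.
    by apply: fractran_here; rewrite mm_vec_update !addn0; lia.
  - move=> va; exists (mm_vec (update v a (v a).-1) * g (3 * i.+1 + 0)); split; last by left.
    apply: fractran_skip; first by apply: idle; left.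
    apply: fractran_here; set v' := update v a _.
    have -> : v = update v' a (v' a).+1.
      apply/ffunP=> b; rewrite !ffunE eqxx prednK //; by case: eqP => // ->.
    by rewrite mm_vec_update !addn0; lia.
  move=> va; exists (mm_vec v * g (3 * p + 1)); split; last by right.
  apply: fractran_skip; first by apply: idle; left.
  apply: fractran_next; last by apply: fractran_here; rewrite addn0; lia.
  apply: (not_dvdn_key (sylvester_gt1 (3 * a + 2))); first exact: dvdn_mull.
    by rewrite g_coprime //; lia.
  by rewrite coprimeMr coprime_vec0 // g_coprime //; lia.
have [c Hc] : exists c, labels (1, P) s.1 c by case: Hs => *; eexists; eauto.
have [k Hk] : exists k, stepn (fractran_step (mm_rules 1 P)) k x (mm_vec s.2 * g (3 * s.1 + 0)).
  by apply: (mm_unmark Hc); case: (s) Hx.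
have [x' [Hx' Hr]] := main; exists k, x'; split=> //.
elim: k x Hk {Hx} => [|k IHk] x /=; first by move=> ->; exists x'.
by move=> [z [Hz /IHk H]]; exists z.
Qed.

Lemma mm_stuck P s x : outside (1, P) s.1 -> mm_repr x s ->
  forall y, ~ fractran_step (mm_rules 1 P) x y.
Proof.
move=> out Hx y; apply: fractran_stuck.
have Hi : s.1 < 1 \/ 1 + size P <= s.1 by case: out => /=; lia.
by case: Hx => ->; apply: mm_rules_idle => //; [left | right].
Qed.

Lemma mm_progress (P : seq (instr n)) s : outside (1, P) s.1 \/ exists s', mm_step (1, P) s s'.
Proof.
case: s => [[|i] v]; first by left; left.
case E : (onth P i) => [c|]; last first.
  left; right; rewrite /= add1n ltnS leqNgt -onthTE E //.
have L : labels (1, P) i.+1 c by split=> //=; rewrite subSS subn0.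
right; case: c L {E} => [a|a p] L; first by eexists; exact: mm_step_inc L.
have [va|va] := posnP (v a); first by eexists; exact: mm_step_jump L va.
by eexists; exact: mm_step_dec L va.
Qed.

Lemma mm_fractran (P : seq (instr n)) v :
  FRACTRAN (mm_rules 1 P, mm_vec v * g 3) <-> mm_terminates (1, P) (1, v).
Proof.
have det := fractran_step_det (mm_rules_pos 1 P).
split=> [[y [/rtc_stepn[k Hk] stuck]]|[s [Hs out]]].
  have: mm_repr (mm_vec v * g 3) (1, v) by left.
  move: (1, v) Hk; elim/ltn_ind: k (mm_vec v * g 3) => k IHk x s Hk Hx.
  have [out|[s' Hs']] := mm_progress P s; first by exists s; split=> //; exact: rt_refl.
  have [j [x' [Hj Hx']]] := mm_simulate Hs' Hx.
  have [lt_jk Hk'] := stepn_det det stuck Hj Hk.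
  have [|t [Ht out]] := IHk (k - j.+1) _ x' s' Hk' Hx'; first by lia.
  by exists t; split=> //; apply: rt_trans (rt_step _ _ _ _ Hs') Ht.
have [k Hk] := iffLR (rtc_stepn _ _ _) Hs.
suff H x : mm_repr x (1, v) -> FRACTRAN (mm_rules 1 P, x) by apply: H; left.
elim: k (1, v) {Hs} Hk x => [|k IHk] t /=.
  by move=> -> x Hx; exists x; split; [exact: rt_refl | exact: mm_stuck out Hx].
move=> [u [Htu Hu]] x Hx; have [j [x' [Hj Hx']]] := mm_simulate Htu Hx.
have [y [Hy stuck]] := IHk u Hu x' Hx'; exists y; split=> //.
by apply: rt_trans Hy; apply/rtc_stepn; exists j.+1.
Qed.

End Simulation.

Definition mm_rule_tree (i : nat) (t : tree) : seq (nat * nat) :=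
  let g := sylvester in
  let a := if unnum (tfst t) == 0 then unnum (tsnd t) else unnum (tfst (tsnd t)) in
  let p := unnum (tsnd (tsnd t)) in
  if unnum (tfst t) == 0 then
    [:: (g (3 * i.+1) * g (3 * a + 2), g (3 * i)); (g (3 * i), g (3 * i + 1))]
  else [:: (g (3 * i.+1), g (3 * i) * g (3 * a + 2)); (g (3 * p + 1), g (3 * i));
           (g (3 * i), g (3 * i + 1))].

(** An instruction needs its label, which a fold from the right does not supply; so the labels are
    enumerated and the instructions fetched by position. *)
Definition mm_rules_tree (i0 : nat) (t : tree) : seq (nat * nat) :=
  flatten [seq mm_rule_tree i (tfst (iter (i - i0) tsnd t)) | i <- iota i0 (size (unseq t))].

Lemma mm_rules_treeE n (P : seq (instr n)) i0 : mm_rules_tree i0 (code P) = mm_rules i0 P.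
Proof.
rewrite /mm_rules_tree; elim: P i0 => // c P IHP i0.
rewrite [mm_rules i0 _]/= -IHP /= subnn; congr (_ ++ flatten _).
  by case: c => [a|a p] /=; rewrite /mm_rule_tree /= !numK.
apply/eq_in_map => i; rewrite mem_iota => /andP[lt_i _].
by rewrite (_ : i - i0 = (i - i0.+1).+1) ?iterSr //; lia.
Qed.

Definition mm_vec_tree (t : tree) : nat :=
  foldr (fun e m => sylvester (3 * unnum (tfst e) + 2) ^ unnum (tsnd e) * m) 1 (unseq t).

Lemma mm_vec_treeE n (v : {ffun 'I_n -> nat}) : mm_vec_tree (code v) = mm_vec v.
Proof.
rewrite /mm_vec -big_enum /mm_vec_tree -[code v]/(code [seq (a, v a) | a <- enum 'I_n]).
rewrite unseq_code; elim: (enum 'I_n) => [|a s IHs] /=; first by rewrite big_nil.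
by rewrite big_cons IHs /= !numK.
Qed.

Theorem MM_FRACTRAN : MM ⪯ FRACTRAN.
Proof.
exists (fun x => (mm_rules 1 (tagged x).1, mm_vec (tagged x).2 * sylvester 3)); split.
  apply: (@computable_cf _ _ _ _ _ (fun t =>
    code (mm_rules_tree 1 (tfst (tsnd t)), mm_vec_tree (tsnd (tsnd t)) * sylvester 3))).
    rewrite /mm_rules_tree /mm_vec_tree /mm_rule_tree /sylvester; cbv zeta; cf.
  move=> [n [P v]].
  by rewrite -[tfst _]/(code P) -[tsnd _]/(code v) mm_rules_treeE mm_vec_treeE.
by move=> [n [P v]]; have := mm_fractran P v; rewrite /MM /=; tauto.
Qed.

(** * Solutions of PCP as lists of dominoes *)

Definition rewrite_step (R : seq (seq nat * seq nat)) (w w' : seq nat) : Prop :=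
  exists u x y v, [/\ (x, y) \in R, w = u ++ x ++ v & w' = u ++ y ++ v].

Lemma PCP_list P : PCP P <-> exists D : seq (seq nat * seq nat),
  [/\ D != [::], {subset D <= P} & flatten (map fst D) = flatten (map snd D)].
Proof.
split=> [[I [I_nil E]]|[D [D_nil DP E]]].
  exists [seq tnth (in_tuple P) i | i <- I]; split; last by rewrite -!map_comp.
    by case: I I_nil {E}.
  by move=> _ /mapP[i _ ->]; exact: mem_tnth.
have [I EI] : exists I, D = [seq tnth (in_tuple P) i | i <- I].
  elim: D DP {D_nil E} => [|d D IHD] DP; first by exists [::].
  have [|I ->] := IHD; first by move=> e eD; apply: DP; rewrite inE eD orbT.
  have /tnthP[i ->] : d \in in_tuple P by apply: DP; rewrite inE eqxx.
  by exists (i :: I).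
by exists I; split; [case: I EI D_nil => // -> | move: E; rewrite EI -!map_comp].
Qed.

(** * String rewriting to PCP *)

(* The successive words of a derivation are written alternately in two copies
   of the alphabet.  A solution must then start with the start domino, as the
   two sides of the other ones begin with different letters; and the top string
   consumes a word exactly when the bottom string has produced the next one. *)
Definition letter (b : bool) (a : nat) : nat := (a + a + b).+2.

Arguments letter : simpl never.

Definition pcp_of_rewriting (m h : nat) (R : seq (seq nat * seq nat)) (w : seq nat) :=
  let R' := [seq ([:: a], [:: a]) | a <- iota 0 m] ++ R in
  ([:: 0], 0 :: map (letter false) w) ::
  [seq (map (letter false) r.1, map (letter true) r.2) | r <- R'] ++
  [seq (map (letter true) r.1, map (letter false) r.2) | r <- R'] ++
  [:: ([:: letter false h; 1], [:: 1]); ([:: letter true h; 1], [:: 1])].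

Lemma letter_inj b c a a' : letter b a = letter c a' -> b = c /\ a = a'.
Proof. by rewrite /letter; case: b; case: c => E; split=> //; lia. Qed.

Lemma cons_inj (a b : nat) (s t : seq nat) : a :: s = b :: t -> a = b /\ s = t.
Proof. by case. Qed.

Section Rewriting.
Variables (m h : nat) (R : seq (seq nat * seq nat)).
Hypothesis R_nil : all (fun r => (r.1 != [::]) && (r.2 != [::])) R.
Hypothesis R_lt : all (fun r => all (fun a => a < m) r.2) R.

Let copies : seq (seq nat * seq nat) := [seq ([:: a], [:: a]) | a <- iota 0 m].

Variant domino w0 : seq nat * seq nat -> Prop :=
  | StartDomino : domino w0 ([:: 0], 0 :: map (letter false) w0)
  | RuleDomino b x y : (x, y) \in copies ++ R ->
      domino w0 (map (letter b) x, map (letter (~~ b)) y)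
  | EndDomino b : domino w0 ([:: letter b h; 1], [:: 1]).

Lemma dominoP w0 d : d \in pcp_of_rewriting m h R w0 <-> domino w0 d.
Proof.
rewrite /pcp_of_rewriting !(inE, mem_cat); split=> [|[|b x y xy|b]].
- case/or4P=> [/eqP ->|/mapP[[x y] xy ->]|/mapP[[x y] xy ->]|/orP[] /eqP ->].
  + exact: StartDomino.
  + exact: (@RuleDomino _ false).
  + exact: (@RuleDomino _ true).
  + exact: (@EndDomino _ false).
  + exact: (@EndDomino _ true).
- by rewrite eqxx.
- have H c : (map (letter c) x, map (letter (~~ c)) y) \in
      [seq (map (letter c) r.1, map (letter (~~ c)) r.2) | r <- copies ++ R].
    exact: (map_f (fun r => (map (letter c) r.1, map (letter (~~ c)) r.2)) xy).
  by case: b; rewrite H ?orbT.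
by case: b; rewrite eqxx ?orbT.
Qed.

Lemma rule_nil x y : (x, y) \in copies ++ R -> x != [::] /\ y != [::].
Proof.
rewrite mem_cat => /orP[/mapP[a _ [-> ->]] //|/(allP R_nil)/andP //].
Qed.

Lemma rule_step u x y v : (x, y) \in copies ++ R ->
  clos_refl_trans _ (rewrite_step R) (u ++ x ++ v) (u ++ y ++ v).
Proof.
rewrite mem_cat => /orP[/mapP[a _ [-> ->]]|xy]; first exact: rt_refl.
by apply: rt_step; exists u, x, y, v.
Qed.

(** As [w] is nonempty and written in the other copy of the alphabet, a left-hand side matched at
    the front cannot reach beyond [u]. *)
Lemma letters_prefix b x u w Z T : w != [::] ->
  map (letter b) u ++ map (letter (~~ b)) w ++ Z = map (letter b) x ++ T ->
  exists2 u', u = x ++ u' & map (letter b) u' ++ map (letter (~~ b)) w ++ Z = T.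
Proof.
move=> w_nil; elim: x u => [|a x IHx] u /=; first by exists u.
case: u => [|a' u] /=; first by case: w w_nil {IHx} => //= c w _ /cons_inj[/letter_inj[E _] _]; case: b E.
by case/cons_inj=> /letter_inj[_ ->] /IHx[u' -> <-]; exists u'.
Qed.

(** Invariant: [u] is the unread rest of the current word and [w] the part of the next word already
    written, so [w ++ u] is a word of the derivation. When [u] is used up, the copies of the
    alphabet exchange roles. *)
Lemma rewriting_sound w0 D b u w : (forall d, d \in D -> domino w0 d) -> u != [::] ->
  map (letter b) u ++ map (letter (~~ b)) w ++ flatten (map snd D) = flatten (map fst D) ->
  clos_refl_trans _ (rewrite_step R) (w ++ u) [:: h].
Proof.
elim: D b u w => [|d D IHD] b u w HD; first by case: u.
have HD' e : e \in D -> domino w0 e by move=> eD; apply: HD; rewrite inE eD orbT.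
have {}IHD b' u' w' := IHD b' u' w' HD'.
have Hd := HD d (mem_head _ _); case: Hd {HD} => {d} [|c x y xy|c] u_nil /=.
- by case: u u_nil.
- have [x_nil y_nil] := rule_nil xy.
  move=> E0; have Ecb : c = b.
    case: u u_nil E0 => // a u _; case: x x_nil {xy} => // a' x _ /=.
    by case/cons_inj=> /letter_inj[].
  move: E0; rewrite Ecb [map _ w ++ _]catA -map_cat.
  have wy_nil : w ++ y != [::] by case: (w).
  move=> /(letters_prefix wy_nil)[u' -> E].
  have step : clos_refl_trans _ (rewrite_step R) (w ++ x ++ u') (w ++ y ++ u').
    exact: rule_step.
  apply: rt_trans step _; have [u'_nil|] := eqVneq u' [::]; last first.
    by move=> u'_nil; rewrite catA; apply: IHD u'_nil E.
  rewrite u'_nil cats0 -[w ++ y]cat0s; apply: (IHD (~~ b)) => //.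
  by rewrite -E u'_nil.
case: u u_nil => // a u _ /= /cons_inj[/letter_inj[_ ->]].
case: u => [|? ?] //=; case: w => [|? ?] //= _; exact: rt_refl.
Qed.

Lemma rewriting_complete w0 w b : clos_refl_trans _ (rewrite_step R) w [:: h] ->
  all (fun a => a < m) w -> exists D, (forall d, d \in D -> domino w0 d) /\
    map (letter b) w ++ flatten (map snd D) = flatten (map fst D).
Proof.
move=> /clos_rt_rt1n_iff H; move E : [:: h] H => t H.
elim: H E b => {w t} [t <-|w w' t Hww' _ IH E] b.
  move=> _; exists [:: ([:: letter b h; 1], [:: 1])]; split=> // d.
  by rewrite inE => /eqP ->; exact: EndDomino.
move=> w_lt; have [u [x [y [v [xy Ew Ew']]]]] := Hww'.
have w'_lt : all (fun a => a < m) w'.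
  by move: w_lt; rewrite Ew Ew' !all_cat (allP R_lt _ xy) => /and3P[-> _ ->].
have [D [HD ED]] := IH E (~~ b) w'_lt.
pose copy s : seq (seq nat * seq nat) := [seq ([:: letter b a], [:: letter (~~ b) a]) | a <- s].
have copy1 s : flatten (map fst (copy s)) = map (letter b) s by elim: s => //= a s ->.
have copy2 s : flatten (map snd (copy s)) = map (letter (~~ b)) s by elim: s => //= a s ->.
have domC s : all (fun a => a < m) s -> forall d, d \in copy s -> domino w0 d.
  move=> s_lt d /mapP[a /(allP s_lt) lt_a ->]; apply: (@RuleDomino _ b [:: a] [:: a]).
  by rewrite mem_cat (map_f (fun a => ([:: a], [:: a]))) // mem_iota.
exists (copy u ++ (map (letter b) x, map (letter (~~ b)) y) :: copy v ++ D); split.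
  move=> d; move: w_lt; rewrite Ew !all_cat => /and3P[u_lt _ v_lt].
  rewrite mem_cat inE mem_cat => /or4P[/(domC u u_lt) //|/eqP ->|/(domC v v_lt) //|/HD //].
  by apply: RuleDomino; rewrite mem_cat xy orbT.
rewrite !(map_cat, map_cons, flatten_cat) /= !(map_cat, flatten_cat) !copy1 !copy2 -ED Ew Ew'.
by rewrite !map_cat -!catA.
Qed.

Lemma pcp_of_rewritingP w : w != [::] -> all (fun a => a < m) w ->
  PCP (pcp_of_rewriting m h R w) <-> clos_refl_trans _ (rewrite_step R) w [:: h].
Proof.
move=> w_nil w_lt; rewrite -> PCP_list; split=> [[[|d D] [//= _ HD E]]|H]; last first.
  have [D [HD E]] := rewriting_complete w false H w_lt.
  exists (([:: 0], 0 :: map (letter false) w) :: D); split=> //=; last by rewrite E.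
  move=> d; rewrite inE => /predU1P[->|/HD ?]; apply/dominoP => //; exact: StartDomino.
have {}HD e : e \in d :: D -> domino w e by move=> /HD/dominoP.
have := HD d (mem_head _ _) => Hd; case: Hd E => [|b x y /rule_nil[]|b] /=.
- case=> E; rewrite -[w]cat0s; apply: (rewriting_sound (b := false) (D := D)) w_nil _ => //.
  by move=> e eD; apply: HD; rewrite inE eD orbT.
- by case: x y => [|a x] [|a' y] // _ _ /cons_inj[/letter_inj[E _] _]; case: b E.
by case.
Qed.

End Rewriting.

(** * Turing machines to string rewriting *)

(* Letters: 0 and 1 delimit the tape, 2 is the target of the derivations, then
   come the [k] symbols and the states.  The state is written to the left of
   the symbol under the head.  In the rules, an optional symbol is given as 0
   for [None] and [a.+1] for [Some a], and a direction as its code. *)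
Definition state_letter (k q : nat) : nat := 3 + k + q.

Definition move_rule (d x q b : nat) : seq nat :=
  if d == 0 then [:: q; x; b] else if d == 1 then [:: x; q; b] else [:: x; b; q].

(** The head reads [None] when the state precedes 0 (left of the tape) or 1 (right of it, or on an
    empty tape if [x] is 0). If then nothing is written, only a move back onto the tape displaces
    the state letter. *)
Definition trans_rules (k q o q' w d : nat) : seq (seq nat * seq nat) :=
  let s := state_letter k q in
  let s' := state_letter k q' in
  if o == 0 then
    ([:: s; 0], if w == 0 then if d == 2 then [:: 0; s'] else [:: s'; 0]
                else move_rule d 0 s' (w + 2)) ::
    [seq ([:: x; s; 1],
          if w == 0 then if (d == 0) && ~~ (x == 0) then [:: s'; x; 1] else [:: x; s'; 1]
          else move_rule d x s' (w + 2) ++ [:: 1]) | x <- 0 :: iota 3 k]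
  else
    [seq ([:: x; s; o + 2], move_rule d x s' (if w == 0 then o + 2 else w + 2)) | x <- 0 :: iota 3 k].

Definition erase_rules (k n : nat) : seq (seq nat * seq nat) :=
  flatten [seq [:: ([:: 2; a], [:: 2]); ([:: a; 2], [:: 2])] | a <- iota 0 (3 + k + n)].

Definition option_nat k (o : option 'I_k) : nat := if o is Some a then a.+1 else 0.
Definition direction_nat (d : direction) : nat :=
  match d with goL => 0 | goN => 1 | goR => 2 end.

Section TM.
Variables (k n : nat) (M : tm k n).

Definition entry_rules (e : 'I_n * option 'I_k) : seq (seq nat * seq nat) :=
  let: (q', (w, d)) := trans M e in
  trans_rules k e.1 (option_nat e.2) q' (option_nat w) (direction_nat d).

Definition halt_rules (q : 'I_n) : seq (seq nat * seq nat) :=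
  if halting M q then [:: ([:: state_letter k q], [:: 2])] else [::].

Definition tm_rules : seq (seq nat * seq nat) :=
  flatten [seq entry_rules e | e <- enum {: 'I_n * option 'I_k}] ++
  flatten [seq halt_rules q | q <- enum 'I_n] ++ erase_rules k n.

Let sym (a : 'I_k) : nat := 3 + a.
Let st (q : 'I_n) : nat := state_letter k q.

Lemma sym_inj : injective sym.
Proof. by move=> a b E; apply: val_inj; exact: addnI E. Qed.

Definition left_word (ls : seq 'I_k) : seq nat := 0 :: rev (map sym ls).
Definition right_word (rs : seq 'I_k) : seq nat := map sym rs ++ [:: 1].

Arguments left_word : simpl never.
Arguments right_word : simpl never.

Definition tape_left (t : tape 'I_k) : seq nat :=
  match t with
  | niltape => left_word [::]
  | leftof _ _ => [::]
  | rightof a ls => left_word (a :: ls)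
  | midtape ls _ _ => left_word ls
  end.

Definition tape_right (t : tape 'I_k) : seq nat :=
  match t with
  | niltape | rightof _ _ => right_word [::]
  | leftof a rs => 0 :: right_word (a :: rs)
  | midtape _ a rs => right_word (a :: rs)
  end.

Definition config_word (c : tm_config k n) : seq nat :=
  tape_left c.2 ++ st c.1 :: tape_right c.2.

Lemma left_word_cons b ls : left_word (b :: ls) = left_word ls ++ [:: sym b].
Proof. by rewrite /left_word /= rev_cons -cats1. Qed.

Variant left_split : seq 'I_k -> seq nat -> nat -> Prop :=
  | LeftEnd : left_split [::] [::] 0
  | LeftCons b ls : left_split (b :: ls) (left_word ls) (sym b).

Lemma left_splitP ls u x : left_word ls = u ++ [:: x] -> left_split ls u x.
Proof.
case: ls => [|b ls]; last first.
  by rewrite left_word_cons !cats1 => /rcons_inj[<- <-]; exact: LeftCons.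
by case: u => [[<-]|? []] //; exact: LeftEnd.
Qed.

Lemma left_split_ex ls : exists u x, left_word ls = u ++ [:: x] /\ left_split ls u x /\
  x \in 0 :: iota 3 k.
Proof.
case: ls => [|b ls]; first by exists [::], 0; do !split; exact: LeftEnd.
exists (left_word ls), (sym b); rewrite left_word_cons; do !split; first exact: LeftCons.
by rewrite inE mem_iota /sym; have := ltn_ord b; lia.
Qed.

(** Leaving the written part needs no separate rule: on the left the state letter passes the
    delimiter 0, on the right it stops in front of 1, and these are the words of [leftof] and
    [rightof]. *)
Lemma move_word ls u x d q b rs : left_split ls u x ->
  u ++ move_rule (direction_nat d) x (st q) (sym b) ++ right_word rs =
  config_word (q, go d (midtape ls b rs)).
Proof.
by case=> [|c {}ls]; case: d; case: rs => [|a rs];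
  rewrite /config_word /move_rule /= ?rev_cons -?cats1 -?catA.
Qed.

Definition no_state (s : seq nat) : bool := all (fun a => (a < 3 + k) && (a != 2)) s.

Lemma no_state_left t : no_state (tape_left t).
Proof.
have H ls : no_state (left_word ls).
  rewrite /no_state /= all_rev all_map; apply/allP=> a _ /=.
  by rewrite /sym; have := ltn_ord a; lia.
by case: t => *; rewrite ?H.
Qed.

Lemma no_state_right t : no_state (tape_right t).
Proof.
have H rs : no_state (right_word rs).
  rewrite /no_state all_cat all_map /= !andbT; apply/allP=> a _ /=.
  by rewrite /sym; have := ltn_ord a; lia.
by case: t => [|a rs|a ls|ls a rs]; rewrite [tape_right _]/= ?H //; exact: (H (a :: rs)).
Qed.

(** A configuration contains a single state letter, so a rule can apply in one place only. *)
Lemma state_split A B A' B' (q : 'I_n) q0 : no_state A -> no_state B ->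
  A ++ st q :: B = A' ++ state_letter k q0 :: B' -> [/\ A = A', q = q0 :> nat & B = B'].
Proof.
have nst s q1 : no_state s -> state_letter k q1 \in s = false.
  move=> Hs; apply/negP=> /(allP Hs); rewrite /state_letter; lia.
move=> HA HB; elim: A A' HA => [|a A IHA] [|a' A'] //= HA.
- by case/cons_inj=> /eqP; rewrite /st /state_letter eqn_add2l => /eqP -> ->.
- by case/cons_inj=> _ E; have := nst _ q0 HB; rewrite E mem_cat inE eqxx orbT.
- by case/cons_inj=> E _; have := nst (a :: A) q0 HA; rewrite E inE eqxx.
by case/cons_inj=> -> /IHA[]; [case/andP: HA | move=> -> -> ->].
Qed.

(** Serves both directions: once some applicable rule has been exhibited by [entry_rules_complete],
    its effect is determined here. *)
Lemma entry_rules_sound q o q0 t u x y v : (x, y) \in entry_rules (q, o) ->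
  config_word (q0, t) = u ++ x ++ v ->
  [/\ q0 = q, o = current t &
      let: (q', (w, d)) := trans M (q, o) in
      u ++ y ++ v = config_word (q', go d (write w t))].
Proof.
rewrite /entry_rules /trans_rules; case: (trans M (q, o)) => q' [w d] /=.
have split A B : tape_left t ++ st q0 :: tape_right t = A ++ state_letter k q :: B ->
    [/\ tape_left t = A, q0 = q & tape_right t = B].
  by case/(state_split (no_state_left t) (no_state_right t)) => -> /val_inj -> ->.
have letterE (a : 'I_k) : a.+1 + 2 = sym a by rewrite /sym; lia.
rewrite /config_word /=; case: o => [a|] /=.
  rewrite -map_cons => /mapP[z _ [-> ->]] /= E.
  have [Hl -> Hr] := split _ _ (etrans E (catA u [:: z] _)).
  case: t {E} split Hl Hr => [|b rs|b ls|ls b rs] _ Hl Hr; try by move: Hr => /cons_inj[]; rewrite ?/sym; lia.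
  move: Hr => /cons_inj[]; rewrite letterE => /sym_inj -> <-; split=> //.
  have Hs := left_splitP Hl.
  case: w => [c|] /=; last exact: (move_word d q' _ rs Hs).
  by rewrite letterE; exact: (move_word d q' c rs Hs).
rewrite inE -map_cons => /predU1P[[-> ->]|/mapP[z _ [-> ->]]] /=.
  move=> E; have [Hl -> Hr] := split _ _ E.
  case: t {E} split Hl Hr => [|b rs|b ls|ls b rs] _ Hl Hr; try by move: Hr => /cons_inj[]; rewrite ?/sym; lia.
  case: Hr => <-; rewrite -Hl; split=> //.
  by case: w => [c|]; [rewrite /= letterE; exact: (move_word d q' c (b :: rs) LeftEnd) | case: d].
move=> E; have [Hl -> Hr] := split _ _ (etrans E (catA u [:: z] _)).
have [ls El Ew] : exists2 ls, left_word ls = u ++ [:: z] &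
  [/\ v = [::], current t = None, (forall c, write (Some c) t = midtape ls c [::]) &
    (ls = [::] -> t = niltape) /\ (forall a ls', ls = a :: ls' -> t = rightof a ls')].
  case: t {E} split Hl Hr => [|b rs|b ls|ls b rs] _ Hl Hr; try by move: Hr => /cons_inj[]; rewrite ?/sym; lia.
    by exists [::] => //; case: Hr.
  exists (b :: ls) => //; split=> //; [by case: Hr | split=> // a ls' [-> ->] //].
case: Ew => -> Et Ew [En Er]; rewrite Et; split=> //; have Hs := left_splitP El.
case: w => [c|]; rewrite ?Ew /=.
  by rewrite letterE -catA; exact: (move_word d q' c [::] Hs).
case: Hs En Er {El Ew} => [|a ls'] En Er.
  by rewrite (En erefl); case: d.
by rewrite (Er a ls' erefl) cats0; case: d => //=; rewrite ?rev_cons -?cats1 -?catA.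
Qed.

Lemma entry_rules_complete q t : exists u x y v, (x, y) \in entry_rules (q, current t) /\
  config_word (q, t) = u ++ x ++ v.
Proof.
rewrite /entry_rules /trans_rules /=; case: (trans M _) => q' [w d].
have letterE (a : 'I_k) : a.+1 + 2 = sym a by rewrite /sym; lia.
case: t => [|a rs|a ls|ls a rs] /=.
- have [u [x [E [_ x_in]]]] := left_split_ex [::].
  eexists u, _, _, [::]; split; first by rewrite inE -map_cons; apply/orP; right; exact: map_f x_in.
  exact: etrans (congr1 (cat^~ _) E) (esym (catA u [:: x] _)).
- eexists [::], _, _, _; split; first by rewrite inE; apply/orP; left; exact/eqP.
  by rewrite /config_word.
- have [u [x [E [_ x_in]]]] := left_split_ex (a :: ls).
  eexists u, _, _, [::]; split; first by rewrite inE -map_cons; apply/orP; right; exact: map_f x_in.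
  exact: etrans (congr1 (cat^~ _) E) (esym (catA u [:: x] _)).
have [u [x [E [_ x_in]]]] := left_split_ex ls.
eexists u, _, _, (right_word rs); split; first by rewrite -map_cons; exact: map_f x_in.
by rewrite /= letterE; exact: etrans (congr1 (cat^~ _) E) (esym (catA u [:: x] _)).
Qed.

Lemma erase_rewrite A B : all (fun a => a < 3 + k + n) (A ++ B) ->
  clos_refl_trans _ (rewrite_step tm_rules) (A ++ 2 :: B) [:: 2].
Proof.
have erase r : r \in erase_rules k n -> r \in tm_rules by rewrite !mem_cat => ->; rewrite !orbT.
have in_erase a : a < 3 + k + n -> ([:: 2; a], [:: 2]) \in erase_rules k n /\
    ([:: a; 2], [:: 2]) \in erase_rules k n.
  move=> lt_a; pose f a := [:: ([:: 2; a], [:: 2]); ([:: a; 2], [:: 2])].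
  have fa : f a \in [seq f a | a <- iota 0 (3 + k + n)] by rewrite map_f // mem_iota.
  by split; apply/flattenP; exists (f a); rewrite // !inE eqxx ?orbT.
rewrite all_cat => /andP[HA HB]; apply: (rt_trans _ _ _ (A ++ [:: 2])).
  elim: B HB => [|b B IHB] /=; first by move=> _; exact: rt_refl.
  case/andP=> /in_erase[/erase b_in _] /IHB; apply: rt_trans; apply: rt_step.
  by exists A, [:: 2; b], [:: 2], B.
elim/last_ind: A HA {HB} => [|A a IHA]; first by move=> _; exact: rt_refl.
rewrite all_rcons => /andP[/in_erase[_ /erase a_in] /IHA]; apply: rt_trans; apply: rt_step.
by exists A, [:: a; 2], [:: 2], [::]; rewrite -cats1 -catA.
Qed.

Lemma config_word_lt c : all (fun a => a < 3 + k + n) (config_word c).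
Proof.
have H s : no_state s -> all (fun a => a < 3 + k + n) s.
  by apply: sub_all => a /andP[lt_a _]; lia.
rewrite /config_word all_cat /= !H ?no_state_left ?no_state_right // andbT /=.
by rewrite /st /state_letter; have := ltn_ord c.1; lia.
Qed.

Lemma tm_rewriting t :
  tm_halts M t <-> clos_refl_trans _ (rewrite_step tm_rules) (config_word (start M, t)) [:: 2].
Proof.
split=> [[c [Hc halt]]|H].
  apply: (rt_trans _ _ _ (config_word c)).
    elim: Hc {halt} => [c1 c2 H|c1|c1 c2 c3 _ IH1 _ IH2]; [|exact: rt_refl|exact: rt_trans IH1 IH2].
    case: H => q t1 q' w d _ Et; apply: rt_step.
    have [u [x [y [v [xy E]]]]] := entry_rules_complete q t1.
    exists u, x, y, v; split=> //; last by case: (entry_rules_sound xy E) => _ _; rewrite Et.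
    rewrite /tm_rules mem_cat; apply/orP; left; apply/flattenP.
    by exists (entry_rules (q, current t1)) => //; apply: map_f; rewrite mem_enum.
  apply: (rt_trans _ _ _ (tape_left c.2 ++ 2 :: tape_right c.2)); last first.
    apply: erase_rewrite; have := config_word_lt c.
    by rewrite /config_word !all_cat /= => /and3P[-> _ ->].
  apply: rt_step; exists (tape_left c.2), [:: st c.1], [:: 2], (tape_right c.2); split=> //.
  rewrite /tm_rules mem_cat [X in _ || X]mem_cat; apply/or3P/Or32/flattenP.
  exists (halt_rules c.1); first by apply: map_f; rewrite mem_enum.
  by rewrite /halt_rules halt inE.
have no2 c : 2 \in config_word c = false.
  have H2 s : no_state s -> (2 \in s) = false by move=> Hs; apply/negP=> /(allP Hs); rewrite andbF.
  by rewrite mem_cat inE !H2 ?no_state_left ?no_state_right.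
(* Halting absorbs the invariant: a halting state may still be rewritten by its transition rules or
   be erased, and the words after that point need no analysis. *)
pose reach w := (exists c, clos_refl_trans _ (tm_step M) (start M, t) c /\ w = config_word c) \/ tm_halts M t.
suff : reach [:: 2] by case=> // -[c [_ E]]; have := no2 c; rewrite -E.
have : reach (config_word (start M, t)).
  by left; exists (start M, t); split=> //; exact: rt_refl.
elim: H => [w1 w2 [u [x [y [v [xy E1 E2]]]]] Hr|//|w1 w2 w3 _ IH1 _ IH2 /IH1/IH2 //].
case: Hr => [[[q1 t1] [Hc Ec]]|]; last by right.
have [halt|nhalt] := boolP (halting M q1); first by right; exists (q1, t1).
move: xy; rewrite /tm_rules mem_cat [X in _ || X]mem_cat => /or3P[].
- case/flattenP=> _ /mapP[[q o] _ ->] xy.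
  have E : config_word (q1, t1) = u ++ x ++ v by rewrite -Ec.
  have [Eq Eo] := entry_rules_sound xy E; case Et: (trans M (q, o)) => [q' [w d]] Ew.
  left; exists (q', go d (write w t1)); split; last by rewrite E2.
  apply: rt_trans Hc (rt_step _ _ _ _ _); apply: tm_step_intro => //.
  by rewrite Eq -Eo.
- case/flattenP=> _ /mapP[q _ ->]; rewrite /halt_rules; case: ifP => // halt.
  rewrite inE => /eqP[Ex _]; right; exists (q1, t1); split=> //=.
  move: Ec; rewrite E1 Ex /config_word /= => /esym.
  by case/(state_split (no_state_left t1) (no_state_right t1)) => _ /val_inj Eq _; rewrite Eq.
rewrite /erase_rules => /flattenP[_ /mapP[a _ ->]]; rewrite !inE => xy; have := no2 (q1, t1).
rewrite -Ec E1 !mem_cat; have -> : 2 \in x by case/orP: xy => /eqP[-> _]; rewrite !inE ?eqxx ?orbT.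
by rewrite orbT.
Qed.

Definition tm_pcp (t : tape 'I_k) : seq (seq nat * seq nat) :=
  pcp_of_rewriting (3 + k + n) 2 tm_rules (config_word (start M, t)).

Definition good_rule (r : seq nat * seq nat) : bool :=
  [&& r.1 != [::], r.2 != [::] & all (fun a => a < 3 + k + n) r.2].

Lemma good_move d x q b z : x < 3 + k + n -> q < 3 + k + n -> b < 3 + k + n ->
  all (fun a => a < 3 + k + n) z -> all (fun a => a < 3 + k + n) (move_rule d x q b ++ z).
Proof. by rewrite /move_rule => Hx Hq Hb Hz; do 2?case: ifP => _; rewrite /= Hz ?Hx ?Hq ?Hb. Qed.

Lemma move_rule_nil d x q b z : move_rule d x q b ++ z != [::].
Proof. by rewrite /move_rule; do 2?case: ifP. Qed.

Lemma good_tm_rules : all good_rule tm_rules.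
Proof.
rewrite /tm_rules all_cat [X in _ && X]all_cat; apply/and3P; split.
- apply/allP=> r /flattenP[_ /mapP[[q o] _ ->]]; rewrite /entry_rules.
  case: (trans M (q, o)) => q' [w d]; rewrite /trans_rules.
  have lt_q : state_letter k q' < 3 + k + n by rewrite /state_letter ltn_add2l.
  have lt_o (p : option 'I_k) : option_nat p + 2 < 3 + k + n.
    by case: p => [a|] /=; [have := ltn_ord a|]; lia.
  have lt_x x : x \in 0 :: iota 3 k -> x < 3 + k + n by rewrite inE mem_iota; lia.
  case: ifP => _ /=.
    rewrite inE -map_cons => /predU1P[->|/mapP[x /lt_x lt ->]]; rewrite /good_rule /=; case: ifP => _.
    + by case: ifP => _ /=; rewrite lt_q.
    + by rewrite -[move_rule _ _ _ _]cats0 move_rule_nil good_move.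
    + by case: ifP => _ /=; rewrite lt lt_q.
    + by rewrite move_rule_nil good_move.
  rewrite -map_cons => /mapP[x /lt_x lt ->]; rewrite /good_rule /=.
  by rewrite -[move_rule _ _ _ _]cats0 move_rule_nil good_move //; case: ifP => _; rewrite lt_o.
- apply/allP=> r /flattenP[_ /mapP[q _ ->]]; rewrite /halt_rules; case: ifP => // _.
  by rewrite inE => /eqP ->.
by apply/allP=> r; rewrite /erase_rules => /flattenP[_ /mapP[a _ ->]]; rewrite !inE => /orP[] /eqP ->.
Qed.

Lemma tm_pcpP t : PCP (tm_pcp t) <-> tm_halts M t.
Proof.
rewrite -> tm_rewriting; apply: pcp_of_rewritingP; last exact: config_word_lt.
- by apply: sub_all good_tm_rules => r /and3P[-> ->].
- by apply: sub_all good_tm_rules => r /and3P[].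
- by rewrite /config_word; case: (tape_left _).
Qed.
End TM.

(** * Computability of the reduction from the halting problem *)

Definition entry_rules_tree (k : nat) (e : tree) : seq (seq nat * seq nat) :=
  trans_rules k (unnum (tfst (tfst e))) (unnum (tsnd (tfst e)))
    (unnum (tfst (tsnd e))) (unnum (tfst (tsnd (tsnd e)))) (unnum (tsnd (tsnd (tsnd e)))).

Definition halt_rules_tree (k : nat) (e : tree) : seq (seq nat * seq nat) :=
  if unnum (tsnd e) == 0 then [::] else [:: ([:: state_letter k (unnum (tfst e))], [:: 2])].

Definition tm_rules_tree (k n : nat) (t : tree) : seq (seq nat * seq nat) :=
  flatten [seq entry_rules_tree k e | e <- unseq (tsnd t)] ++
  flatten [seq halt_rules_tree k e | e <- unseq (tsnd (tfst t))] ++ erase_rules k n.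

Definition left_word_tree (t : tree) : seq nat :=
  0 :: foldr (fun a s => s ++ [:: 3 + unnum a]) [::] (unseq t).

Definition right_word_tree (t : tree) : seq nat := [seq 3 + unnum a | a <- unseq t] ++ [:: 1].

Definition config_word_tree (k : nat) (q t : tree) : seq nat :=
  let s := state_letter k (unnum q) in
  let i := unnum (tfst t) in
  let a := tsnd t in
  if i == 0 then left_word_tree leaf ++ s :: right_word_tree leaf
  else if i == 1 then s :: 0 :: right_word_tree a
  else if i == 2 then left_word_tree a ++ s :: right_word_tree leaf
  else left_word_tree (tfst (tfst a)) ++ s :: right_word_tree (node (tsnd (tfst a)) (tsnd a)).

Definition tm_pcp_tree (x : tree) : seq (seq nat * seq nat) :=
  let k := unnum (tfst x) in
  let n := unnum (tfst (tsnd x)) in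
  let M := tfst (tsnd (tsnd x)) in
  pcp_of_rewriting (3 + k + n) 2 (tm_rules_tree k n M)
    (config_word_tree k (tfst (tfst M)) (tsnd (tsnd (tsnd x)))).

Lemma unseq_ffun (A : finType) X `{coded A} `{coded X} (f : {ffun A -> X}) :
  unseq (code f) = [seq node (code a) (code (f a)) | a <- enum A].
Proof. by rewrite -[code f]/(code [seq (a, f a) | a <- enum A]) unseq_code -map_comp. Qed.

Lemma unnum_option k (o : option 'I_k) : unnum (code o) = option_nat o.
Proof. by case: o => //= a; rewrite numK. Qed.

Lemma tm_rules_treeE k n (M : tm k n) : tm_rules_tree k n (code M) = tm_rules M.
Proof.
rewrite /tm_rules_tree /tm_rules; congr (flatten _ ++ (flatten _ ++ _)).
  rewrite -[tsnd _]/(code (trans M)) unseq_ffun -map_comp; apply: eq_map => -[q o].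
  rewrite /entry_rules /=; case: (trans M (q, o)) => q' [w d].
  have Ed : unnum (code d) = direction_nat d by case: d.
  by rewrite /entry_rules_tree -!unnum_option -Ed /= !numK.
rewrite -[tsnd _]/(code (halting M)) unseq_ffun -map_comp; apply: eq_map => q.
by rewrite /halt_rules_tree /halt_rules /= /code_ord !numK; case: (halting M q).
Qed.

Lemma left_word_treeE k (s : seq 'I_k) : left_word_tree (code s) = left_word s.
Proof.
rewrite /left_word_tree /left_word unseq_code; congr (_ :: _).
by elim: s => //= a s ->; rewrite numK rev_cons -cats1.
Qed.

Lemma right_word_treeE k (s : seq 'I_k) : right_word_tree (code s) = right_word s.
Proof.
rewrite /right_word_tree /right_word unseq_code -map_comp; congr (_ ++ _).
by apply: eq_map => a /=; rewrite numK.
Qed.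

Lemma config_word_treeE k n (q : 'I_n) (t : tape 'I_k) :
  config_word_tree k (code q) (code t) = config_word (q, t).
Proof.
rewrite /config_word_tree -[unnum (code q)]/(unnum (num q)) numK.
pose nil : seq 'I_k := [::]; pose word u v := u ++ state_letter k q :: v.
case: t => [|a s|a s|l a s].
- exact (congr2 word (left_word_treeE nil) (right_word_treeE nil)).
- exact (congr1 (fun u => word [::] (0 :: u)) (right_word_treeE (a :: s))).
- exact (congr2 word (left_word_treeE (a :: s)) (right_word_treeE nil)).
exact (congr2 word (left_word_treeE l) (right_word_treeE (a :: s))).
Qed.

Definition halt_pcp (x : {k : nat & {n : nat & (tm k n * tape 'I_k)%type}}) :=
  let: existT k (existT n (M, t)) := x in tm_pcp M t.

Lemma tm_pcp_treeE x : tm_pcp_tree (code x) = halt_pcp x.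
Proof.
case: x => k [n [M t]]; rewrite /tm_pcp_tree /halt_pcp /tm_pcp.
rewrite -[tfst (code _)]/(num k) -[tfst (tsnd (code _))]/(num n) !numK.
by rewrite -tm_rules_treeE -config_word_treeE.
Qed.

Theorem Halt_PCP : Halt ⪯ PCP.
Proof.
exists halt_pcp; split; last by move=> [k [n [M t]]]; rewrite /Halt /halt_pcp; exact: iff_sym (tm_pcpP M t).
apply: (@computable_cf _ _ _ _ _ (fun t => code (tm_pcp_tree t))).
  rewrite /tm_pcp_tree /tm_rules_tree /entry_rules_tree /halt_rules_tree /config_word_tree
    /left_word_tree /right_word_tree /pcp_of_rewriting /letter /trans_rules /erase_rules
    /move_rule /state_letter; cbv zeta; cf.
by move=> x; rewrite tm_pcp_treeE.
Qed.

Theorem theorem7p4 :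
  (Halt ⪯ PCP /\
   PCP ⪯ MM /\
   MM ⪯ FRACTRAN /\
   FRACTRAN ⪯ DIO_FORM /\
   DIO_FORM ⪯ DIO_ELEM /\
   DIO_ELEM ⪯ DIO_SINGLE /\
   DIO_SINGLE ⪯ H10) /\
  (has_decider H10 -> has_decider Halt).
Proof.
split; last apply: reduces_decider.
  by do !split; [exact: Halt_PCP | exact: PCP_MM | exact: MM_FRACTRAN | exact: FRACTRAN_DIO_FORM
    | exact: DIO_FORM_DIO_ELEM | exact: DIO_ELEM_DIO_SINGLE | exact: DIO_SINGLE_H10].
apply: (reduces_trans Halt_PCP); apply: (reduces_trans PCP_MM).
apply: (reduces_trans MM_FRACTRAN); apply: (reduces_trans FRACTRAN_DIO_FORM).
apply: (reduces_trans DIO_FORM_DIO_ELEM); apply: (reduces_trans DIO_ELEM_DIO_SINGLE).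
exact: DIO_SINGLE_H10.
Qed.
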